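(* Let $d\in\mathbb{N}$, let $L$ be a Lévy basis on $\mathbb{R}^d$ with $\mathbb{E}\,L([0,1]^d)^2<\infty$, let $f\in L^1(\mathbb{R}^d)\cap L^2(\mathbb{R}^d)$ be real-valued, and let $$X_t:=\int_{\mathbb{R}^d} f(t-u)\,dL(u),\qquad t\in\mathbb{R}^d.$$ Let $(\Gamma_n)_{n\in\mathbb{N}}$ be a sequence of finite subsets of $\mathbb{Z}^d$ such that (a) $\Gamma_n\subset\Gamma_{n+1}$ for every $n\in\mathbb{N}$; (b) $|\Gamma_n|\to\infty$ as $n\to\infty$; (c) for each $l\in\mathbb{Z}^d$, $a_l^n:=\dfrac{|\{(t,s)\in\Gamma_n\times\Gamma_n:\ t-s=l\}|}{|\Gamma_n|}$ converges as $n\to\infty$ to some $a_l$. Assume that $$\sum_{t\in\mathbb{Z}^d}\ \sup_{n\in\mathbb{N}} a_t^n\int_{\mathbb{R}^d}|f(-u)f(t-u)|\,\lambda^d(du)<\infty .$$ Then $$\sum_{t\in\mathbb{Z}^d}a_t\,|\operatorname{cov}(X_t,X_0)|<\infty$$ and, as $n\to\infty$, $$\frac{1}{\sqrt{|\Gamma_n|}}\sum_{t\in\Gamma_n}\Big(X_t-\mathbb{E}L([0,1]^d)\int_{\mathbb{R}^d}f(u)\,\lambda^d(du)\Big)\ \xrightarrow{d}\ N\Big(0,\sum_{t\in\mathbb{Z}^d}a_t\operatorname{cov}(X_t,X_0)\Big).$$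
   Context: $\lambda^d$ is Lebesgue measure on $\mathbb{R}^d$; $|A|$ is the number of elements of a finite set $A$; $N(a,b)$ is the normal distribution with mean $a$ and variance $b\ge 0$ ($b=0$ allowed, meaning the Dirac measure at $a$); $\xrightarrow{d}$ is convergence in distribution. If $\Gamma_n=\emptyset$ for some (necessarily finitely many) $n$, set $a_l^n:=0$. Lévy basis: a family $(L(A))_{A\in\mathcal{B}_b(\mathbb{R}^d)}$ of real random variables indexed by the bounded Borel subsets of $\mathbb{R}^d$ such that (i) $L(\bigcup_n A_n)=\sum_n L(A_n)$ a.s. for pairwise disjoint $(A_n)_{n\in\mathbb{N}_0}\subset\mathcal{B}_b(\mathbb{R}^d)$ with $\bigcup_n A_n\in\mathcal{B}_b(\mathbb{R}^d)$; (ii) $L(A_1),\dots,L(A_n)$ are independent for pairwise disjoint $A_1,\dots,A_n\in\mathcal{B}_b(\mathbb{R}^d)$; (iii) there are $a\ge 0$, $\gamma\in\mathbb{R}$ and a Lévy measure $\nu$ on $\mathbb{R}$ (i.e. $\nu(\{0\})=0$, $\int\min\{1,x^2\}\nu(dx)<\infty$) such that $\mathbb{E}e^{izL(A)}=\exp(\psi(z)\lambda^d(A))$ for all $z\in\mathbb{R}$, $A\in\mathcal{B}_b(\mathbb{R}^d)$, where $\psi(z)=i\gamma z-\frac12 az^2+\int_{\mathbb{R}}(e^{ixz}-1-ixz\mathbf{1}_{[-1,1]}(x))\nu(dx)$. Integral: for a simple function $f=\sum_{j=1}^n x_j\mathbf{1}_{A_j}$ with $x_j\in\mathbb{R}$,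 $A_j\in\mathcal{B}_b(\mathbb{R}^d)$, and Borel $A$, $\int_A f\,dL:=\sum_j x_jL(A_j\cap A)$. A Borel function $f:\mathbb{R}^d\to\mathbb{R}$ is integrable with respect to $L$ if there are simple functions $f_n\to f$ $\lambda^d$-a.e. such that $\int_A f_n\,dL$ converges in probability for every Borel set $A$; the limit is $\int_A f\,dL$. If $f\in L^1(\mathbb{R}^d)\cap L^2(\mathbb{R}^d)$ and $\mathbb{E}L([0,1]^d)^2<\infty$, then $f$ is integrable with respect to $L$ and $\int_{\mathbb{R}^d}f\,dL$ has finite second moment. *)

(* Defs.v *)
From HB Require Import structures.
From mathcomp Require Import all_boot all_order all_algebra finmap.
From mathcomp Require Import complex.
From mathcomp Require Import ring lra.
From mathcomp Require Import all_classical all_reals all_analysis.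
Set Implicit Arguments.
Unset Strict Implicit.
Unset Printing Implicit Defensive.
Import Order.TTheory GRing.Theory Num.Theory.
Import numFieldNormedType.Exports.
Local Open Scope classical_set_scope.
Local Open Scope ring_scope.

(* Borel sigma-algebra of R^d, generated by the open sets of the matrix topology *)
HB.instance Definition _ (R : realType) (d : nat) :=
  @isMeasurable.Build (sigma_display (@open 'rV[R]_d)) 'rV[R]_d
    <<s @open 'rV[R]_d >> (@sigma_algebra0 _ setT _) (@sigma_algebraC _ _)
    (@sigma_algebra_bigcup _ setT _).

Section lebesgue_tuple.
Context {R : realType}.
Section step.
Variables (n : nat) (m : {sigma_finite_measure set (n.-tuple R) -> \bar R}).

Let consT (p : R * n.-tuple R) : n.+1.-tuple R := [tuple of p.1 :: p.2].
Let mconsT : measurable_fun setT consT.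
Proof. exact: measurable_cons. Qed.
Definition leb_step : set (n.+1.-tuple R) -> \bar R :=
  fun A => (lebesgue_measure \x m)%E (consT @^-1` A).
Let step0 : leb_step set0 = 0%E.
Proof. by rewrite /leb_step preimage_set0 measure0. Qed.
Let step_ge0 A : (0 <= leb_step A)%E.
Proof. exact: measure_ge0. Qed.
Let step_sigma_additive : semi_sigma_additive leb_step.
Proof. move=> F mF tF mUF; rewrite /leb_step preimage_bigcup.
apply: measure_semi_sigma_additive.
- by move=> k; rewrite -[X in measurable X]setTI; exact: mconsT.
- apply/trivIsetP => /= i j _ _ ij; rewrite -preimage_setI.
  by move/trivIsetP : tF => /(_ _ _ _ _ ij) ->//; rewrite preimage_set0.
- by rewrite -preimage_bigcup -[X in measurable X]setTI; exact: mconsT.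
Qed.
HB.instance Definition _ := isMeasure.Build _ _ _
  leb_step step0 step_ge0 step_sigma_additive.
Let step_sigma_finite : sigma_finite setT leb_step.
Proof.
have /sigma_finiteP[F [FT ndF Foo]] := sigma_finiteT (@lebesgue_measure R).
have /sigma_finiteP[G [GT ndG Goo]] := sigma_finiteT m.
pose g (t : n.+1.-tuple R) : R * n.-tuple R := (thead t, [tuple of behead t]).
have mg : measurable_fun setT g.
  apply/measurable_fun_pairP; split; last exact: measurable_behead.
  exact: measurable_tnth.
have gK p : g (consT p) = p.
  by case: p => x t; rewrite /g theadE; congr pair; apply: val_inj.
exists (fun k => g @^-1` (F k `*` G k)).
  rewrite -preimage_bigcup -(preimage_setT g); congr (_ @^-1` _).
  rewrite -setXTT FT GT predeqE => -[x y]; split.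
    move=> [/= [p _ Fpx] [q _ Gqy]]; exists (maxn p q) => //; split.
    - by move: x Fpx; exact/subsetPset/ndF/leq_maxl.
    - by move: y Gqy; exact/subsetPset/ndG/leq_maxr.
  by move=> [p _ []/= ? ?]; split; exists p.
move=> k; have [mFk Fk] := Foo k; have [mGk Gk] := Goo k.
have mFG : measurable (F k `*` G k) by exact: measurableX.
split; first by rewrite -[X in measurable X]setTI; exact: mg.
rewrite /leb_step; have -> : consT @^-1` (g @^-1` (F k `*` G k)) = F k `*` G k.
  by apply/funext => p; exact: (congr1 (F k `*` G k) (gK p)).
by rewrite product_measure1E// lte_mul_pinfty// ge0_fin_numE.
Qed.
HB.instance Definition _ := Measure_isSigmaFinite.Build _ _ _ leb_step
  step_sigma_finite.
End step.
(* n-fold product of the one-dimensional Lebesgue measure *)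
Fixpoint lebesgue_tuple n : {sigma_finite_measure set (n.-tuple R) -> \bar R} :=
  if n is k.+1 then
    [the {sigma_finite_measure set _ -> \bar R} of leb_step (lebesgue_tuple k)]
  else [the {sigma_finite_measure set _ -> \bar R} of \d_([tuple] : 0.-tuple R)].
End lebesgue_tuple.

Section lebesgue_rV.
Context {R : realType} {d : nat}.
Definition row_of_tuple (t : d.-tuple R) : 'rV[R]_d := \row_i tnth t i.

Lemma measurable_row_of_tuple : measurable_fun [set: d.-tuple R] row_of_tuple.
Proof.
apply: (measurability (@open 'rV[R]_d)) => // _ [U oU <-]; rewrite setTI.
pose c (q : d.-tuple rat) : 'rV[R]_d := \row_i ratr (tnth q i).
pose e (k : nat) : R := k.+1%:R^-1.
pose B (p : d.-tuple rat * nat) : set (d.-tuple R) :=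
  if `[< ball (c p.1) (e p.2) `<=` U >] then row_of_tuple @^-1` ball (c p.1) (e p.2)
  else set0.
have -> : row_of_tuple @^-1` U = \bigcup_p B p.
  apply/seteqP; split=> [t Ut|t [p _]]; last first.
    by rewrite /B; case: ifPn => // /asboolP sU tB; exact: sU tB.
  have /nbhs_ballP[r /= r0 rU] : nbhs (row_of_tuple t) U by exact: open_nbhs_nbhs.
  have [k _ kr] := near_infty_natSinv_lt (PosNum (divr_gt0 r0 (ltr0Sn R 1))).
  have {kr}kr : e k < r / 2 by exact: (kr k (leqnn k)).
  have e0 : 0 < e k by rewrite invr_gt0.
  have qP i : {q : rat | tnth t i - e k < ratr q < tnth t i + e k}.
    apply: cid; have /rat_in_itvoo[q] : tnth t i - e k < tnth t i + e k by lra.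
    by rewrite in_itv /=; exists q.
  pose q := [tuple sval (qP i) | i < d].
  have qt i : ball (ratr (tnth q i) : R) (e k) (tnth t i).
    rewrite tnth_mktuple; case: (qP i) => /= z /andP[zl zr].
    by rewrite /ball/= ltr_norml; apply/andP; split; lra.
  have cU : ball (c q) (e k) `<=` U.
    move=> y [_ cy]; apply: rU; split=> // i j; rewrite ord1.
    have := cy 0 j; rewrite !mxE => qy.
    apply: (@le_ball _ _ _ (e k + e k)); first by lra.
    exact: (ball_triangle (ball_sym (qt j)) qy).
  exists (q, k) => //; rewrite /B /= asboolT//.
  by split=> // i j; rewrite !mxE.
apply: countable_bigcupT_measurable => [|[q k]]; first exact: countableP.
rewrite /B /=; case: ifPn => // _.
rewrite (_ : _ @^-1` _ = \bigcap_(i in [set: 'I_d])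
   (fun t : d.-tuple R => tnth t i) @^-1` ball (ratr (tnth q i) : R) (e k)); last first.
  apply/seteqP; split=> [t [_ qt] i _|t qt].
    by have := qt 0 i; rewrite !mxE.
  split=> [|i j]; first by rewrite invr_gt0.
  by rewrite !mxE; exact: qt.
apply: fin_bigcap_measurable => // i _.
rewrite -[X in measurable X]setTI; apply: measurable_tnth => //.
rewrite ball_itv; exact: measurable_itv.
Qed.

(* image of lebesgue_tuple under the identification of tuples with row vectors;
   lebesgue_rV_box below computes it on boxes *)
Definition lebesgue_rV : set 'rV[R]_d -> \bar R :=
  fun A => lebesgue_tuple d (row_of_tuple @^-1` A).
Let leb0 : lebesgue_rV set0 = 0%E.
Proof. by rewrite /lebesgue_rV preimage_set0 measure0. Qed.
Let leb_ge0 A : (0 <= lebesgue_rV A)%E.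
Proof. exact: measure_ge0. Qed.
Let leb_sigma_additive : semi_sigma_additive lebesgue_rV.
Proof.
move=> F mF tF mUF; rewrite /lebesgue_rV preimage_bigcup.
apply: measure_semi_sigma_additive.
- by move=> k; rewrite -[X in measurable X]setTI; exact: measurable_row_of_tuple.
- apply/trivIsetP => /= i j _ _ ij; rewrite -preimage_setI.
  by move/trivIsetP : tF => /(_ _ _ _ _ ij) ->//; rewrite preimage_set0.
- rewrite -preimage_bigcup -[X in measurable X]setTI.
  exact: measurable_row_of_tuple.
Qed.
HB.instance Definition _ := isMeasure.Build _ _ _
  lebesgue_rV leb0 leb_ge0 leb_sigma_additive.
End lebesgue_rV.

Lemma measurable_tuple_box (R : realType) n (a b : 'I_n -> R) :
  measurable [set t : n.-tuple R | forall i, a i <= tnth t i <= b i].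
Proof.
rewrite (_ : mkset _ = \bigcap_(i in [set: 'I_n])
  (fun t : n.-tuple R => tnth t i) @^-1` `[a i, b i]); last first.
  by apply/seteqP; split=> t /= tab i; have := tab i; rewrite /= in_itv//=; exact.
apply: fin_bigcap_measurable => // i _.
by rewrite -[X in measurable X]setTI; exact: measurable_tnth.
Qed.

Lemma lebesgue_tuple_box (R : realType) n (a b : 'I_n -> R) :
  (forall i, a i <= b i) ->
  lebesgue_tuple n [set t : n.-tuple R | forall i, a i <= tnth t i <= b i] =
  (\prod_(i < n) (b i - a i))%:E.
Proof.
elim: n a b => [|n ih] a b ab.
  by rewrite big_ord0 /= diracE mem_set// => -[].
have itvE : lebesgue_measure (`[a ord0, b ord0]%classic : set R) = (b ord0 - a ord0)%:E.
  rewrite lebesgue_measure_itv /= lte_fin.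
  by case: ltgtP (ab ord0) => // <- _; rewrite subrr.
rewrite /= /leb_step (_ : _ @^-1` _ = `[a ord0, b ord0]%classic `*`
    [set t : n.-tuple R | forall i, a (lift ord0 i) <= tnth t i <= b (lift ord0 i)]).
  rewrite product_measure1E//; last exact: measurable_tuple_box.
  by rewrite ih// big_ord_recl EFinM; congr (_ * _)%E.
apply/seteqP; split=> -[x t] /=.
  move=> h; split=> [|i]; first by have := h ord0; rewrite /= in_itv.
  by have := h (lift ord0 i); rewrite tnthS.
rewrite in_itv/= => -[x01 h] i; case: (unliftP ord0 i) => [j|] ->//.
by rewrite tnthS.
Qed.

Lemma lebesgue_rV_box (R : realType) (d : nat) (a b : 'rV[R]_d) :
  (forall i, a 0 i <= b 0 i) ->
  lebesgue_rV [set u | forall i, a 0 i <= u 0 i <= b 0 i] =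
  (\prod_(i < d) (b 0 i - a 0 i))%:E.
Proof.
move=> ab; rewrite /lebesgue_rV -(lebesgue_tuple_box ab); congr (_ _).
by apply/seteqP; split=> t /= tab i; have := tab i; rewrite mxE.
Qed.

Section complex_valued.
Context {R : realType}.
Local Open Scope complex_scope.

Definition expC (w : R[i]) : R[i] :=
  (expR (complex.Re w) * cos (complex.Im w)) +i*
  (expR (complex.Re w) * sin (complex.Im w)).

Definition Cintegral (d : measure_display) (T : measurableType d)
    (mu : {measure set T -> \bar R}) (f : T -> R[i]) : R[i] :=
  (\int[mu]_x complex.Re (f x)) +i* (\int[mu]_x complex.Im (f x)).

Definition levy_measure (nu : {measure set R -> \bar R}) :=
  nu [set 0] = 0%E /\ (\int[nu]_x (Num.min 1 (x ^+ 2))%:E < +oo)%E.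

Definition levy_exponent (gamma a : R) (nu : {measure set R -> \bar R})
    (z : R) : R[i] :=
  'i%C * (gamma * z)%:C - (2^-1 * a * z ^+ 2)%:C +
  Cintegral nu (fun x =>
    expC ('i%C * (x * z)%:C) - 1 - 'i%C * (x * z * \1_`[-1, 1]%classic x)%:C).

End complex_valued.

Section probability_notions.
Context {d : measure_display} {T : measurableType d} {R : realType}.
Variable P : probability T R.

(* subfamilies are covered by taking B i := setT *)
Definition independent_RVs (n : nat) (X : 'I_n -> {RV P >-> R}) :=
  forall B : 'I_n -> set R, (forall i, measurable (B i)) ->
    P (\bigcap_(i in [set: 'I_n]) X i @^-1` B i) =
    (\prod_(i < n) P (X i @^-1` B i))%E.

Definition cvg_in_probability (Y : nat -> T -> R) (Z : T -> R) :=
  forall e : R, 0 < e ->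
    P [set w | e <= `|Y n w - Z w|] @[n --> \oo] --> 0%E.

Definition cvg_in_distribution (Y : nat -> T -> R)
    (mu : probability (measurableTypeR R) R) :=
  forall g : R -> R, continuous g -> (exists M : R, forall x, `|g x| <= M) ->
    \int[P]_w g (Y n w) @[n --> \oo] --> \int[mu]_x g x.

End probability_notions.

(* The library's normal_prob takes the standard deviation, and normal_prob m 0 is
   not the Dirac measure, whence the case distinction. Meaningful for 0 <= v. *)
Definition normal_law {R : realType} (m v : R) :
    probability (measurableTypeR R) R :=
  if v == 0 then
    [the probability (measurableTypeR R) R of \d_(m : measurableTypeR R)]
  else [the probability (measurableTypeR R) R of normal_prob m (Num.sqrt v)].

(* \esum is only meaningful for nonnegative families; this is the value of the sum
   of an absolutely summable family *)
Definition signed_esum {R : realType} {I : choiceType} (F : I -> \bar R) : R :=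
  fine (\esum_(i in [set: I]) F^\+ i - \esum_(i in [set: I]) F^\- i)%E.

Section levy_basis.
Context {dT : measure_display} {T : measurableType dT} {R : realType}.
Context (P : probability T R) {d : nat}.
Local Notation V := 'rV[R]_d.
Local Notation lambda := (@lebesgue_rV R d).

Definition bounded_borel (A : set V) := measurable A /\ bounded_set A.

(* L is indexed by all sets for convenience; only its values on bounded Borel sets
   are constrained. *)
Definition levy_basis (L : set V -> {RV P >-> R}) :=
  [/\ forall A : nat -> set V, (forall n, bounded_borel (A n)) ->
        trivIset [set: nat] A -> bounded_borel (\bigcup_n A n) ->
        {ae P, forall w, \sum_(0 <= k < n) L (A k) w @[n --> \oo] -->
          L (\bigcup_n A n) w},
      forall (n : nat) (A : 'I_n -> set V), (forall i, bounded_borel (A i)) ->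
        trivIset [set: 'I_n] A -> independent_RVs (fun i => L (A i)) &
      exists (a gamma : R) (nu : {measure set R -> \bar R}),
        [/\ 0 <= a, levy_measure nu &
          forall (z : R) (A : set V), bounded_borel A ->
            Cintegral P (fun w => expC ('i%C * (z * L A w)%:C%C)) =
            expC (levy_exponent gamma a nu z * (fine (lambda A))%:C%C)]].

(* A list of pairs (x, A) represents the function sum x 1_A; the sets need not be
   disjoint. For a Levy basis, simple_integral only depends on the represented
   function up to almost sure equality. *)
Definition simple_fun (s : seq (R * set V)) (u : V) : R :=
  \sum_(p <- s) p.1 * \1_p.2 u.

Definition simple_integral (L : set V -> {RV P >-> R}) (s : seq (R * set V))
    (A : set V) (w : T) : R :=
  \sum_(p <- s) p.1 * L (p.2 `&` A) w.

(* Y is a version of the integral of f over A: a limit in probability is only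
   determined up to almost sure equality. *)
Definition is_levy_integral (L : set V -> {RV P >-> R}) (f : V -> R)
    (A : set V) (Y : {RV P >-> R}) :=
  measurable_fun [set: V] f /\
  exists s : nat -> seq (R * set V),
    [/\ forall n p, p \in s n -> bounded_borel p.2,
        {ae lambda, forall u, simple_fun (s n) u @[n --> \oo] --> f u},
        forall B, measurable B -> exists Z : {RV P >-> R},
          cvg_in_probability P (fun n => simple_integral L (s n) B) Z &
        cvg_in_probability P (fun n => simple_integral L (s n) A) Y].

Definition unit_cube : set V := [set u | forall i, 0 <= u 0 i <= 1].

End levy_basis.

Definition rV_of_int {R : realType} {d : nat} (t : 'rV[int]_d) : 'rV[R]_d :=
  map_mx intr t.

(* equal to 0 when G is empty, since x / 0 = 0 *)
Definition diff_freq {R : realType} {d : nat} (G : {fset 'rV[int]_d})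
    (l : 'rV[int]_d) : R :=
  #|` [fset p in G `*` G | p.1 - p.2 == l]%fset|%:R / #|` G|%:R.

(* Main.v *)
Require Import Defs.
From HB Require Import structures.
From mathcomp Require Import all_boot all_order all_algebra finmap.
From mathcomp Require Import complex ring lra zify.
From mathcomp Require Import all_classical all_reals all_analysis.
From mathcomp Require Import measurable_realfun.
Set Implicit Arguments.
Unset Strict Implicit.
Unset Printing Implicit Defensive.
Import Order.TTheory GRing.Theory Num.Theory.
Import numFieldNormedType.Exports.
Local Open Scope classical_set_scope.
Local Open Scope ring_scope.

(* The sum of the X_t over Gamma_n is the integral of F_n = sum_t f(t - .), so with
   v, c the variance and mean of L([0,1]^d) its characteristic function is governed by
   the exponent expansion psi(z) = i c z - v z^2 / 2 + o(z^2): the integral of g has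
   characteristic function exp(- v/2 int g^2) e^(i c int g), up to an error e int g^2
   plus a multiple of the integral of (|g| - del)_+^2. This holds for simple functions by
   independence over atoms and survives in the limit because, by a gliding hump
   argument, the integral of a function in L^1 and L^2 is a limit in probability of
   integrals of simple functions converging in L^1 and L^2. Second order expansion at 0
   gives means and covariances, in particular cov(X_t, X_0) = v int f(t - u) f(- u) du.

   With g = F_n / sqrt |Gamma_n|, the integral of g^2 is the sum of
   a_l^n int f(l - u) f(- u) du, which converges by dominated convergence for series.
   Cutting f to a bounded function with bounded support splits F_n into a part bounded
   uniformly in n, which the threshold del absorbs, and a part of small mean square; so
   the error vanishes, and Levy's continuity theorem concludes. *)

(** The definition of the integral is the first obstacle: it provides simple functions that converge
    almost everywhere and whose integrals over every Borel set converge in probability, but it says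
    nothing about their L^1 and L^2 norms. Cutting them to sets [E k] on which they are uniformly
    bounded repairs the norms, at the risk of changing the limit of the integrals. A single Borel
    set [B], made of alternate shells of the [E k], excludes this: along two interlaced subsequences
    the integrals over [B] have the same limit, and their difference is, up to null terms, what the
    cut has removed. The second obstacle is that only second moments are assumed, so the remainder
    of psi is o(z^2) without a rate. The term in (|g| - del)_+ then plays the part of a Lindeberg
    condition: it needs no further moments of L, and it vanishes for g = F_n / sqrt |Gamma_n|
    although the F_n need not be uniformly bounded. *)

(** * Integrals of real functions and dominated convergence *)

Section real_dominated_convergence.
Context {d} {T : measurableType d} {R : realType}.
Variable mu : {measure set T -> \bar R}.
Implicit Types f g : T -> R.

Lemma integrable_dominated f g : measurable_fun setT f ->
  mu.-integrable setT (EFin \o g) -> (forall x, `|f x| <= `|g x|) ->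
  mu.-integrable setT (EFin \o f).
Proof.
move=> mf ig fg; apply: le_integrable ig => //; first exact/measurable_EFinP.
by move=> x _; rewrite /= lee_fin.
Qed.

Lemma Rintegral_dominated_cvg (f_ : nat -> T -> R) f g :
  (forall n, measurable_fun setT (f_ n)) -> measurable_fun setT f ->
  {ae mu, forall x, f_ ^~ x @ \oo --> f x} ->
  mu.-integrable setT (EFin \o g) ->
  {ae mu, forall x n, `|f_ n x| <= g x} ->
  \int[mu]_x f_ n x @[n --> \oo] --> \int[mu]_x f x.
Proof.
move=> mf_ mf cf ig fg.
have [] := @dominated_convergence _ _ _ mu setT measurableT
  (fun n => EFin \o f_ n) (EFin \o f) (EFin \o g).
- by move=> n; exact/measurable_EFinP.
- exact/measurable_EFinP.
- by apply: filterS cf => x fx _; apply: cvg_EFin; [exact: nearW|exact: fx].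
- exact: ig.
- by apply: filterS fg => x fx n _ /=; rewrite lee_fin.
move=> intf _ h; apply: fine_cvg.
rewrite fineK; first exact: h.
exact: integrable_fin_num.
Qed.

Lemma measurable_Ml k f : measurable_fun setT f ->
  measurable_fun setT (fun x => k * f x).
Proof. by move=> mf; exact: measurable_funM (measurable_cst _) mf. Qed.

Lemma measurable_cosM k f : measurable_fun setT f ->
  measurable_fun setT (fun x => cos (k * f x)).
Proof.
move=> /(measurable_Ml k); apply: measurableT_comp.
by apply: continuous_measurable_fun; exact: continuous_cos.
Qed.

Lemma measurable_sinM k f : measurable_fun setT f ->
  measurable_fun setT (fun x => sin (k * f x)).
Proof.
move=> /(measurable_Ml k); apply: measurableT_comp.
by apply: continuous_measurable_fun; exact: continuous_sin.
Qed.

Lemma integrableRZ k f : mu.-integrable setT (EFin \o f) ->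
  mu.-integrable setT (EFin \o (fun x => k * f x)).
Proof. by move=> /(integrableZl measurableT k). Qed.

Lemma integrableRD f g : mu.-integrable setT (EFin \o f) ->
  mu.-integrable setT (EFin \o g) -> mu.-integrable setT (EFin \o (fun x => f x + g x)).
Proof. by move=> hf /(integrableD measurableT hf). Qed.

Lemma integrableRB f g : mu.-integrable setT (EFin \o f) ->
  mu.-integrable setT (EFin \o g) -> mu.-integrable setT (EFin \o (fun x => f x - g x)).
Proof. by move=> hf /(integrableB measurableT hf). Qed.

End real_dominated_convergence.

Section bounded_on_probability.
Context {d} {T : measurableType d} {R : realType} (P : probability T R).
Implicit Types f g : T -> R.

Lemma prob_integrable_bounded f M : measurable_fun setT f ->
  (forall x, `|f x| <= M) -> P.-integrable setT (EFin \o f).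
Proof.
move=> mf fM; apply: measurable_bounded_integrable => //.
  by rewrite [ltLHS]probability_setT ltry.
exists M; split; first exact: num_real.
by move=> x Mx y _ /=; rewrite (le_trans (fM _))// ltW.
Qed.

Lemma prob_Rintegral_cst a : \int[P]_x a = a.
Proof.
by rewrite Rintegral_cst// [X in fine X]probability_setT mulr1.
Qed.

(** The integrands are [e]-close off [A] and differ by at most [2 * M] on it. Both tightness and
    convergence in probability are used in this form, with [A] an event of small probability. *)
Lemma prob_Rintegral_near f g (A : set T) M e : measurable A ->
  measurable_fun setT f -> measurable_fun setT g ->
  (forall x, `|f x| <= M) -> (forall x, `|g x| <= M) ->
  (forall x, ~ A x -> `|f x - g x| <= e) -> 0 <= e ->
  `|\int[P]_x f x - \int[P]_x g x| <= e + 2 * M * fine (P A).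
Proof.
move=> mA mf mg fM gM fg e0.
have iF := prob_integrable_bounded mf fM.
have iG := prob_integrable_bounded mg gM.
rewrite -RintegralB//.
have mfg : measurable_fun setT (fun x => f x - g x) by exact: measurable_funB.
have fgM x : `|f x - g x| <= 2 * M.
  by rewrite (le_trans (ler_normB _ _))// mulr_natl mulr2n lerD.
have ifg : P.-integrable setT (EFin \o (fun x => f x - g x)).
  exact: prob_integrable_bounded fgM.
apply: le_trans (le_normr_Rintegral _ ifg) _ => //.
have iA : P.-integrable setT (EFin \o (\1_A : T -> R)).
  apply: (@prob_integrable_bounded _ 1) => // x.
  by rewrite indicE; case: (_ \in _); rewrite ?normr0 ?normr1.
have -> : e + 2 * M * fine (P A) = \int[P]_x (e + 2 * M * \1_A x).
  rewrite RintegralD//.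
  - rewrite prob_Rintegral_cst; congr (_ + _).
    rewrite RintegralZl//; congr (_ * _).
    by rewrite /Rintegral integral_indic// setIT.
  - by apply: (@prob_integrable_bounded _ e) => // x; rewrite ger0_norm.
  - rewrite (_ : EFin \o _ = (fun x => (2 * M)%:E * (EFin \o \1_A) x)%E)//.
    exact: integrableZl.
apply: le_Rintegral => //.
- apply: (@prob_integrable_bounded _ (2 * M)); first exact: measurableT_comp.
  by move=> x; rewrite normr_id.
- apply: (@prob_integrable_bounded _ (e + 2 * `|M|)).
    by apply: measurable_funD => //; apply: measurable_funM.
  move=> x; rewrite (le_trans (ler_normD _ _))// ger0_norm// lerD2l normrM normrM.
  rewrite (@ger0_norm _ 2)// ler_piMr ?mulr_ge0//.
  by rewrite indicE; case: (_ \in _); rewrite ?normr0 ?normr1.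
- move=> x _; rewrite indicE; case: (boolP (x \in A)) => [|/negP]; rewrite inE => xA.
    by rewrite mulr1 (le_trans (fgM x))// lerDr.
  by rewrite mulr0 addr0 fg.
Qed.

End bounded_on_probability.

(** * Reflection invariance of Lebesgue measure *)

Section measure_preserving.
Context {d} {X : measurableType d} {R : realType}.
Variables (mu : {measure set X -> \bar R}) (phi : X -> X).
Hypothesis mphi : measurable_fun setT phi.
Hypothesis phi_mu : forall A, measurable A -> mu (phi @^-1` A) = mu A.

Lemma ge0_integral_preserving (f : X -> \bar R) : measurable_fun setT f ->
  (forall x, 0 <= f x)%E -> (\int[mu]_x f (phi x) = \int[mu]_x f x)%E.
Proof.
move=> mf f0; have := @ge0_integral_pushforward _ _ _ _ _ _ mphi mu setT f measurableT mf.
move=> /(_ (fun x _ => f0 x)) <-.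
by apply: eq_measure_integral => A mA _; exact: phi_mu.
Qed.

Lemma integral_preserving (f : X -> \bar R) : measurable_fun setT f ->
  (\int[mu]_x f (phi x) = \int[mu]_x f x)%E.
Proof.
move=> mf; rewrite integralE [RHS]integralE; congr (_ - _)%E.
  rewrite -[RHS]ge0_integral_preserving//; last exact: measurable_funepos.
  by apply: eq_integral => x _; rewrite !funeposE.
rewrite -[RHS]ge0_integral_preserving//; last exact: measurable_funeneg.
by apply: eq_integral => x _; rewrite !funenegE.
Qed.

Lemma Rintegral_preserving (f : X -> R) : measurable_fun setT f ->
  \int[mu]_x f (phi x) = \int[mu]_x f x.
Proof.
move=> mf; congr fine; apply: (@integral_preserving (EFin \o f)).
exact/measurable_EFinP.
Qed.

Lemma integrable_preserving (f : X -> R) : mu.-integrable setT (EFin \o f) ->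
  mu.-integrable setT (EFin \o (f \o phi)).
Proof.
move=> /integrableP[mf foo]; apply/integrableP; split.
  by apply/measurable_EFinP; apply: measurableT_comp => //; exact/measurable_EFinP.
rewrite (@integral_preserving (fun x => `|(f x)%:E|)%E)//.
exact: measurableT_comp.
Qed.

End measure_preserving.

Section lebesgue_reflection.
Context {R : realType}.
Local Notation mu := (@lebesgue_measure R).

(** Reflections are all that is needed: the kernel [f (t - .)] is a reflection of [f], and a
    translation is a composite of two reflections. *)
Lemma lebesgue_measure_reflect (c : R) (A : set R) : measurable A ->
  mu ((fun x => c - x) @^-1` A) = mu A.
Proof.
move=> mA; apply/esym.
have mphi : measurable_fun [set: measurableTypeR R]
    ((fun x : R => c - x) : measurableTypeR R -> measurableTypeR R).
  exact: measurable_funB.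
pose mphi_mixin := isMeasurableFun.Build _ _ _ _ _ mphi.
pose phi : {mfun (measurableTypeR R) >-> (measurableTypeR R)} :=
  HB.pack ((fun x : R => c - x) : measurableTypeR R -> measurableTypeR R) mphi_mixin.
have := @lebesgue_measure_unique R
  [the {measure set (measurableTypeR R) -> \bar R} of pushforward mu phi].
apply=> // _ [[a b] /= _ <-].
rewrite /pushforward.
(* Uniqueness is tested on half-open intervals, and reflection exchanges the two kinds of them; the
   length does not see the endpoints. *)
have -> : phi @^-1` `]a, b]%classic = `[c - b, c - a[%classic.
  by apply/seteqP; split=> x /=; rewrite !in_itv/= => /andP[h1 h2]; apply/andP; split; lra.
rewrite !lebesgue_measure_itv /= !lte_fin ltrD2l ltrN2.
by case: ifPn => // _; rewrite -!EFinD; congr EFin; ring.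
Qed.

Definition reflect_tuple n (c t : n.-tuple R) := [tuple tnth c i - tnth t i | i < n].

(** By Fubini: the induction hypothesis reflects each section in the last [n] coordinates, and a
    one-dimensional change of variables reflects the first one. *)
Lemma lebesgue_tuple_reflect n (c : n.-tuple R) (A : set (n.-tuple R)) : measurable A ->
  lebesgue_tuple n (reflect_tuple c @^-1` A) = lebesgue_tuple n A.
Proof.
elim: n c A => [|n ih] c A mA.
  congr (_ _); apply/seteqP; split=> t /=; rewrite (tuple0 t).
    by rewrite (tuple0 (reflect_tuple _ _)).
  by rewrite (tuple0 (reflect_tuple _ _)).
rewrite /= /leb_step.
pose consT (p : R * n.-tuple R) : n.+1.-tuple R := [tuple of p.1 :: p.2].
rewrite -!/consT; pose B := consT @^-1` A.
have mB : measurable B.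
  have mc : measurable_fun setT (fun p : R * n.-tuple R => [the n.+1.-tuple R of p.1 :: p.2]).
    by apply: measurable_cons.
  by rewrite -[B]setTI; exact: mc.
pose c' : n.-tuple R := [tuple of behead c].
have -> : consT @^-1` (reflect_tuple c @^-1` A) =
    (fun p => (thead c - p.1, reflect_tuple c' p.2)) @^-1` B.
  apply/funext => -[x t] /=; rewrite /B /consT /=; congr (A _).
  apply: eq_from_tnth => i; rewrite tnth_mktuple; case: (unliftP ord0 i) => [j|] ->.
    rewrite !tnthS tnth_mktuple tnth_behead; congr (tnth c _ - _).
    by apply/val_inj; rewrite /= inordK ?ltnS.
  by rewrite /thead.
rewrite /product_measure1.
pose h x := lebesgue_tuple n (xsection B x).
transitivity (\int[mu]_x h (thead c - x)%R)%E.
  apply: eq_integral => x _; rewrite /h -(ih c'); last exact: measurable_xsection.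
  congr (_ _); apply/seteqP; split => t /=; rewrite /xsection /= !inE//.
rewrite (@ge0_integral_preserving _ _ _ mu (fun x : R => thead c - x))//.
- exact: measurable_funB.
- by move=> C mC; exact: lebesgue_measure_reflect.
- exact: measurable_fun_xsection.
Qed.

End lebesgue_reflection.

(** * Norms, boxes and bounded Borel sets of Euclidean space *)

Section euclidean.
Context {R : realType} {d : nat}.
Local Notation V := 'rV[R]_d.
Local Notation lambda := (@lebesgue_rV R d).

Lemma continuous_measurable_rV (phi : V -> V) : continuous phi -> measurable_fun setT phi.
Proof.
move=> cphi; apply: (measurability (@open V)) => // _ [U oU <-]; rewrite setTI.
by apply: sub_sigma_algebra; move/continuousP : cphi; exact.
Qed.

Lemma continuous_measurable_rVR (phi : V -> R) : continuous phi -> measurable_fun setT phi.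
Proof.
move=> cphi; apply: (measurability _ (RGenOpens.measurableE R)).
move=> _ [_ [a [b ->] <-]]; rewrite setTI; apply: sub_sigma_algebra.
move/continuousP : cphi; apply.
exact: interval_open.
Qed.

Lemma measurable_reflect (c : V) : measurable_fun setT (fun u : V => c - u).
Proof.
apply: continuous_measurable_rV => u.
apply: (@cvgB R V _ (nbhs u) _ (fun=> c) id c u); [exact: cvg_cst|exact: cvg_id].
Qed.

Lemma lebesgue_rV_reflect (c : V) (A : set V) : measurable A ->
  lambda ((fun u => c - u) @^-1` A) = lambda A.
Proof.
move=> mA; rewrite /lebesgue_rV -[RHS](@lebesgue_tuple_reflect _ _ [tuple c 0 i | i < d]).
  congr (_ _); apply/funext => t /=; congr (A _); apply/rowP => i.
  by rewrite !mxE !tnth_mktuple.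
by rewrite -[X in measurable X]setTI; exact: measurable_row_of_tuple.
Qed.

(** The norm is a maximum over the coordinates that starts from 0; for [d = 0] it is 0 and the
    right-hand side holds vacuously, whence the sign condition. *)
Lemma norm_rV_le (u : V) (M : R) : 0 <= M -> (`|u| <= M) = [forall i, `|u 0 i| <= M].
Proof.
move=> M0; have -> : `|u| = mx_norm u by [].
rewrite mx_normrE; apply/idP/forallP => [h i|h].
  by apply: le_trans h; exact: (le_bigmax _ (fun ij : 'I_1 * 'I_d => `|u ij.1 ij.2|) (0, i)).
by apply/bigmax_leP; split=> // -[i j] _ /=; rewrite ord1.
Qed.

Lemma bounded_set_norm (A : set V) :
  bounded_set A <-> exists M : R, forall u, A u -> `|u| <= M.
Proof.
split=> [[M [_ AM]]|[M AM]].
  by exists (M + 1) => u Au; apply: AM Au; rewrite ltrDl.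
exists M; split; first exact: num_real.
by move=> x /ltW Mx u /AM /le_trans; exact.
Qed.

Lemma measurable_box (M : R) : measurable [set u : V | `|u| <= M].
Proof.
have cn : continuous (fun u : V => `|u|) by exact: norm_continuous.
have -> : [set u : V | `|u| <= M] = ~` [set u : V | M < `|u|].
  by apply/seteqP; split=> u /=; rewrite leNgt => /negP.
apply: measurableC; apply: sub_sigma_algebra.
have -> : [set u : V | M < `|u|] = (fun u : V => `|u|) @^-1` [set x | M < x] by [].
by apply: open_comp => [u _|]; [exact: cn|exact: open_gt].
Qed.

Lemma lebesgue_rV_box_lty (M : R) : (lambda [set u : V | `|u| <= M]%R < +oo)%E.
Proof.
have [M0|M0] := leP 0 M; last first.
  rewrite (_ : mkset _ = set0) ?measure0 ?ltry//.
  by rewrite -subset0 => u /=; rewrite leNgt (lt_le_trans M0).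
pose b : V := const_mx M.
have -> : [set u : V | `|u| <= M] = [set u | forall i, (- b) 0 i <= u 0 i <= b 0 i].
  apply/seteqP; split=> u /=; rewrite norm_rV_le// => h.
    by move=> i; rewrite !mxE -ler_norml; move/forallP: h.
  by apply/forallP => i; have := h i; rewrite !mxE -ler_norml.
rewrite lebesgue_rV_box ?ltry// => i.
by rewrite !mxE; lra.
Qed.

Lemma bounded_borel_lty (A : set V) : bounded_borel A -> (lambda A < +oo)%E.
Proof.
move=> [mA /bounded_set_norm[M AM]]; apply: le_lt_trans (lebesgue_rV_box_lty M).
by apply: le_measure; rewrite ?inE//; exact: measurable_box.
Qed.

Lemma bounded_borel_sub (A B : set V) : measurable A -> A `<=` B ->
  bounded_borel B -> bounded_borel A.
Proof.
move=> mA AB [_ /bounded_set_norm[M BM]]; split=> //.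
by apply/bounded_set_norm; exists M => u /AB; exact: BM.
Qed.

Lemma bounded_borel0 : bounded_borel (set0 : set V).
Proof. by split; [exact: measurable0|apply/bounded_set_norm; exists 0]. Qed.

Lemma bounded_borel_box (M : R) : bounded_borel [set u : V | `|u| <= M].
Proof. by split; [exact: measurable_box|apply/bounded_set_norm; exists M]. Qed.

Lemma unit_cubeE : unit_cube = [set u : V | forall i, (0 : V) 0 i <= u 0 i <= (const_mx 1 : V) 0 i].
Proof. by apply/seteqP; split=> u /= h i; have := h i; rewrite !mxE. Qed.

Lemma bounded_borel_unit_cube : bounded_borel (unit_cube : set V).
Proof.
split.
  have -> : (unit_cube : set V) =
      \bigcap_(i in [set: 'I_d]) (fun u : V => u 0 i) @^-1` `[0%R, 1%R].
    apply/seteqP; split=> u /= h i; first by move=> _; rewrite /= in_itv/= h.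
    by have := h i I; rewrite /= in_itv.
  apply: fin_bigcap_measurable => // i _; rewrite -[X in measurable X]setTI.
  apply: continuous_measurable_rVR => //; exact: coord_continuous.
apply/bounded_set_norm; exists 1 => u h; rewrite norm_rV_le//; apply/forallP => i.
by have /andP[h0 h1] := h i; rewrite ger0_norm.
Qed.

Lemma lebesgue_unit_cube : lambda unit_cube = 1%E.
Proof.
rewrite unit_cubeE lebesgue_rV_box => [|i]; last by rewrite !mxE.
by congr EFin; apply: big1 => i _; rewrite !mxE subr0.
Qed.

End euclidean.

(** * Levy's continuity theorem *)

Section bernstein.
Context {R : realType}.
Implicit Types (h k : nat -> R) (x : R) (G : R -> R).

(* Bernstein polynomials, presented as the expectation of [h] at a binomial random
   variable, one Bernoulli trial at a time. *)
Fixpoint bern n h x : R :=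
  if n is m.+1 then x * bern m (fun i => h i.+1) x + (1 - x) * bern m h x else h 0%N.

Lemma bern_linear n h k a x :
  bern n (fun i => a * h i + k i) x = a * bern n h x + bern n k x.
Proof.
elim: n h k => [//|n ih] h k /=.
by rewrite (ih (fun i => h i.+1) (fun i => k i.+1)) ih; ring.
Qed.

Lemma bern_cst n a x : bern n (fun=> a) x = a.
Proof. by elim: n => [//|n ih] /=; rewrite ih; ring. Qed.

Lemma le_bern n h k x : 0 <= x <= 1 -> (forall i, h i <= k i) ->
  bern n h x <= bern n k x.
Proof.
move=> /andP[x0 x1]; elim: n h k => [|n ih] h k hk /=; first exact: hk.
by rewrite lerD// ler_wpM2l ?subr_ge0// ih.
Qed.

(** Squared bias plus variance of a binomial variable. A success amounts to replacing [c] by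
    [c - 1], so the induction runs over all [c]. *)
Lemma bern_sqr n c x :
  bern n (fun i => (i%:R - c) ^+ 2) x = (n%:R * x - c) ^+ 2 + n%:R * (x * (1 - x)).
Proof.
elim: n c => [|n ih] c /=; first by ring.
rewrite ih (_ : (fun i : nat => _) = (fun i : nat => (i%:R - (c - 1)) ^+ 2)).
  by rewrite ih -!natr1; ring.
by apply/funext => i; rewrite -natr1; ring.
Qed.

(** Bernstein's theorem by Chebyshev: the quadratic bound on [G y - G x] is averaged over the law of
    [i / N], with [N = n + 1], whose variance [x (1 - x) / N] is at most [1 / N]. *)
Lemma bern_near G (e C : R) n x : 0 <= C -> 0 <= x <= 1 ->
  (forall y, `|G y - G x| <= e + C * (y - x) ^+ 2) ->
  `|bern n.+1 (fun i => G (i%:R / n.+1%:R)) x - G x| <= e + C / n.+1%:R.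
Proof.
move=> C0 x01 Gx; set h := fun i : nat => G _.
set N : R := n.+1%:R; have N0 : N != 0 by rewrite pnatr_eq0.
have Ngt0 : 0 < N by rewrite ltr0n.
pose q (i : nat) : R := (C / N ^+ 2) * (i%:R - N * x) ^+ 2 + e.
have qE : bern n.+1 q x <= e + C / N.
  rewrite bern_linear bern_cst bern_sqr -/N addrC lerD2l subrr expr0n/= add0r.
  rewrite (_ : C / _ * _ = C / N * (x * (1 - x))); last by field.
  case/andP: x01 => x0 x1.
  rewrite ler_piMr//; first by rewrite divr_ge0// ltW.
  by nra.
have hq i : `|h i - G x| <= q i.
  apply: le_trans (Gx _) _; rewrite addrC lerD2r -/N.
  by rewrite le_eqVlt; apply/orP; left; apply/eqP; field.
have hE a b : bern n.+1 (fun i => a * h i + b) x = a * bern n.+1 h x + b.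
  by rewrite bern_linear bern_cst.
have qE' b : bern n.+1 (fun i => 1 * q i + b) x = bern n.+1 q x + b.
  by rewrite bern_linear bern_cst mul1r.
(* Here [a] is a sign; its two values give the two halves of the absolute value. *)
have up a : a ^+ 2 = 1 -> a * bern n.+1 h x - a * G x <= bern n.+1 q x.
  move=> a1; rewrite -(hE a) -[leRHS]addr0 -(qE' 0); apply: le_bern => // i.
  rewrite mul1r addr0 -mulrBr; apply: le_trans (hq i).
  rewrite (le_trans (ler_norm _))// normrM (_ : `|a| = 1) ?mul1r//.
  by apply/eqP; rewrite -sqrp_eq1// real_normK ?num_real// a1.
have upN := up (-1); rewrite sqrrN expr1n in upN.
have {up} upP := up 1; rewrite expr1n in upP.
apply: le_trans qE; rewrite ler_norml lerNl opprB.
move: (upN erefl) (upP erefl); rewrite !mulN1r !mul1r opprK addrC => -> ->.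
by [].
Qed.

Lemma bern_bounded n h M x : 0 <= x <= 1 -> (forall i, `|h i| <= M) ->
  `|bern n h x| <= M.
Proof.
move=> x01 hM; rewrite ler_norml; apply/andP; split.
  rewrite -[leLHS](bern_cst n (- M) x); apply: le_bern => // i.
  by have := hM i; rewrite ler_norml => /andP[].
rewrite -[leRHS](bern_cst n M x); apply: le_bern => // i.
by have := hM i; rewrite ler_norml => /andP[].
Qed.

(** Uniform continuity without a radius: near [x] the oscillation is at most [e], and farther away
    the trivial bound [2 * M] is absorbed by the quadratic term. Compactness concerns only [x],
    while [y] ranges over the line. *)
Lemma quadratic_modulus G (M : R) : continuous G -> (forall x, `|G x| <= M) ->
  forall e : R, 0 < e -> exists2 C : R, 0 <= C &
    forall x y, 0 <= x <= 1 -> `|G y - G x| <= e + C * (y - x) ^+ 2.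
Proof.
move=> cG GM e e0.
have M0 : 0 <= M by exact: le_trans (GM 0).
have : near_covering `[0%R : R, 1%R].
  by apply/compact_near_coveringP; exact: segment_compact.
(* Every point has a neighbourhood on which one radius [1 / (n + 1)] serves; compactness turns this
   into one radius for the whole segment. *)
move=> /(_ nat \oo (fun n x => forall y, `|y - x| < n.+1%:R^-1 -> `|G y - G x| <= e) _).
case.
  move=> x _.
  have e20 : 0 < e / 2 by rewrite divr_gt0.
  have := cG x; move/cvgrPdist_lt => /(_ _ e20)[del /= del0 Gdel].
  have del20 : 0 < del / 2 by rewrite divr_gt0.
  have H := near_infty_natSinv_lt (PosNum del20).
  near=> x' n => /= y yx'.
  have xx' : `|x - x'| < del / 2.
    by near: x'; exists (del / 2).
  have xy : `|x - y| < del.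
    rewrite -(subrKA x') (le_lt_trans (ler_normD _ _))//.
    rewrite [ltRHS](splitr del) ltrD// distrC (lt_trans yx')//.
    by near: n.
  have h1 := Gdel _ xy.
  have h2 : `|G x - G x'| < e / 2.
    by apply: Gdel => /=; rewrite (lt_trans xx')// ltr_pdivrMr// ltr_pMr// ltr1n.
  rewrite -(subrKA (G x)) (le_trans (ler_normD _ _))// [leRHS](splitr e) lerD//.
    by rewrite distrC ltW.
  exact: ltW.
move=> N _ /(_ N (leqnn N)) /= GN.
(* With this constant the quadratic term is at least [2 * M] as soon as [|y - x| >= 1 / (N + 1)]. *)
exists (2 * M * N.+1%:R ^+ 2).
  by apply: mulr_ge0 (sqr_ge0 _); exact: mulr_ge0.
move=> x y x01; have [yx|yx] := ltP `|y - x| N.+1%:R^-1.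
  have GN' : `|G y - G x| <= e by apply: GN => //=; rewrite in_itv.
  rewrite (le_trans GN')// lerDl; apply: mulr_ge0 (sqr_ge0 _).
  by apply: mulr_ge0 (sqr_ge0 _); exact: mulr_ge0.
have h : 1 <= N.+1%:R ^+ 2 * (y - x) ^+ 2.
  rewrite -exprMn -[leRHS]real_normK ?num_real// expr_ge1// normrM ger0_norm//.
  by rewrite mulrC -ler_pdivrMr// div1r.
rewrite (le_trans (ler_normB _ _))// (le_trans (lerD (GM _) (GM _)))//.
have : 2 * M * 1 <= 2 * M * (N.+1%:R ^+ 2 * (y - x) ^+ 2).
  by apply: ler_wpM2l => //; exact: mulr_ge0.
by rewrite mulr1 mulrA; move: (2 * M * _ * _) => Z; lra.
Unshelve. all: end_near. Qed.

End bernstein.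

Section trigonometric_polynomials.
Context {R : realType}.
Implicit Types (u v : R -> R) (z w a : R).

Inductive trigpoly : (R -> R) -> Prop :=
| trigpoly_cos z : trigpoly (fun t => cos (z * t))
| trigpoly_sin z : trigpoly (fun t => sin (z * t))
| trigpolyD u v of trigpoly u & trigpoly v : trigpoly (fun t => u t + v t)
| trigpolyZ a u of trigpoly u : trigpoly (fun t => a * u t).

Lemma trigpoly_cst a : trigpoly (fun=> a).
Proof.
rewrite (_ : (fun=> a) = (fun t => a * cos (0 * t))).
  exact/trigpolyZ/trigpoly_cos.
by apply/funext => t; rewrite mul0r cos0 mulr1.
Qed.

(** Product-to-sum formulas. No other products occur below: at [x = (1 + sin (w t)) / 2] the
    recursion of [bern] multiplies by [(1 + sin (w t)) / 2] and [(1 - sin (w t)) / 2] only. *)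
Lemma trigpoly_Msin w u : trigpoly u -> trigpoly (fun t => sin (w * t) * u t).
Proof.
elim=> [z|z|{}u v _ hu _ hv|a {}u _ hu].
- rewrite (_ : (fun t => _) = (fun t => 2^-1 * sin ((w + z) * t) +
      2^-1 * sin ((w - z) * t))).
    by apply: trigpolyD; exact/trigpolyZ/trigpoly_sin.
  by apply/funext => t; rewrite !mulrDl mulNr !sinD sinN cosN; field.
- rewrite (_ : (fun t => _) = (fun t => 2^-1 * cos ((w - z) * t) +
      (- 2^-1) * cos ((w + z) * t))).
    by apply: trigpolyD; exact/trigpolyZ/trigpoly_cos.
  by apply/funext => t; rewrite !mulrDl mulNr !cosD sinN cosN; field.
- rewrite (_ : (fun t => _) = (fun t => sin (w * t) * u t + sin (w * t) * v t)).
    exact: trigpolyD.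
  by apply/funext => t; rewrite mulrDr.
- rewrite (_ : (fun t => _) = (fun t => a * (sin (w * t) * u t))).
    exact: trigpolyZ.
  by apply/funext => t; rewrite mulrCA.
Qed.

Lemma trigpoly_bern n h w : trigpoly (fun t => bern n h ((1 + sin (w * t)) / 2)).
Proof.
elim: n h => [|n ih] h /=; first exact: trigpoly_cst.
pose u t := bern n (fun i => h i.+1) ((1 + sin (w * t)) / 2).
pose v t := bern n h ((1 + sin (w * t)) / 2).
rewrite (_ : (fun t => _) = (fun t =>
  2^-1 * ((u t + v t) + (sin (w * t) * u t + -1 * (sin (w * t) * v t))))).
  apply/trigpolyZ/trigpolyD; apply: trigpolyD; [exact: ih|exact: ih| |].
    exact/trigpoly_Msin/ih.
  exact/trigpolyZ/trigpoly_Msin/ih.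
by apply/funext => t; rewrite -/(u t) -/(v t); field.
Qed.

Lemma trigpoly_measurable u : trigpoly u -> measurable_fun setT u.
Proof.
elim=> [z|z|{}u v _ hu _ hv|a {}u _ hu].
- apply: continuous_measurable_fun => t; apply: continuous_comp; [exact: mulrl_continuous|exact: continuous_cos].
- apply: continuous_measurable_fun => t; apply: continuous_comp; [exact: mulrl_continuous|exact: continuous_sin].
- exact: measurable_funD.
- exact: measurable_funM.
Qed.

Lemma trigpoly_bounded u : trigpoly u -> exists M, forall t, `|u t| <= M.
Proof.
elim=> [z|z|{}u v _ [M hM] _ [N hN]|a {}u _ [M hM]].
- by exists 1 => t; rewrite ler_norml cos_geN1 cos_le1.
- by exists 1 => t; rewrite ler_norml sin_geN1 sin_le1.
- by exists (M + N) => t; rewrite (le_trans (ler_normD _ _))// lerD.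
- by exists (`|a| * M) => t; rewrite normrM ler_wpM2l.
Qed.

End trigonometric_polynomials.

Section levy_continuity.
Context {d} {T : measurableType d} {R : realType} (P : probability T R).
Variables (Y : nat -> T -> R) (mu : probability (measurableTypeR R) R).
Hypothesis mY : forall n, measurable_fun setT (Y n).
Hypothesis cosY : forall z,
  \int[P]_w cos (z * Y n w) @[n --> \oo] --> \int[mu]_x cos (z * x).
Hypothesis sinY : forall z,
  \int[P]_w sin (z * Y n w) @[n --> \oo] --> \int[mu]_x sin (z * x).
Hypothesis tightY : forall e : R, 0 < e ->
  exists K : R, forall n, fine (P [set w | K <= `|Y n w|]) <= e.

Let cvg_trigpoly u : trigpoly u ->
  \int[P]_w u (Y n w) @[n --> \oo] --> \int[mu]_x u x.
Proof.
elim=> [z|z|{}u v hu cu hv cv|a {}u hu cu] //.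
- have [[M hM] [N hN]] := (trigpoly_bounded hu, trigpoly_bounded hv).
  have [mu' mv'] := (trigpoly_measurable hu, trigpoly_measurable hv).
  rewrite (_ : (fun n => _) =
      (fun n => \int[P]_w u (Y n w) + \int[P]_w v (Y n w))); last first.
    apply/funext => n; rewrite RintegralD//.
      by apply: (@prob_integrable_bounded _ _ _ _ _ M) => //; exact: measurableT_comp.
    by apply: (@prob_integrable_bounded _ _ _ _ _ N) => //; exact: measurableT_comp.
  rewrite RintegralD//; first exact: cvgD.
    exact: (@prob_integrable_bounded _ _ _ _ _ M).
  exact: (@prob_integrable_bounded _ _ _ _ _ N).
- have [M hM] := trigpoly_bounded hu; have mu' := trigpoly_measurable hu.
  rewrite (_ : (fun n => _) = (fun n => a * \int[P]_w u (Y n w))); last first.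
    apply/funext => n; rewrite RintegralZl//.
    by apply: (@prob_integrable_bounded _ _ _ _ _ M) => //; exact: measurableT_comp.
  rewrite RintegralZl//; first exact: cvgMr.
  exact: (@prob_integrable_bounded _ _ _ _ _ M).
Qed.

Let tight_mu : forall e : R, 0 < e ->
  exists K : R, fine (mu [set x | K <= `|x|]) <= e.
Proof.
move=> e e0; pose A (n : nat) : set R := [set x | n%:R <= `|x|].
have mA n : measurable (A n).
  have -> : A n = (fun x : R => `|x|) @^-1` `[n%:R, +oo[.
    by apply/seteqP; split=> x; rewrite /A /= in_itv/= andbT.
  by rewrite -[X in measurable X]setTI; apply: normr_measurable.
have : mu (A n) @[n --> \oo] --> mu (\bigcap_n A n).
  apply: nonincreasing_cvg_mu => //.
  - exact: le_lt_trans (probability_le1 mu (mA 0%N)) (ltry 1).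
  - exact: bigcapT_measurable.
  - move=> m n mn; apply/subsetPset => x; rewrite /A /=.
    by apply: le_trans; rewrite ler_nat.
have -> : \bigcap_n A n = set0.
  rewrite -subset0 => x Ax; have := Ax (Num.truncn `|x|).+1 I; rewrite /A /=.
  by rewrite leNgt truncnS_gt.
rewrite measure0 => /fine_cvgP[_ /cvgrPdist_le/(_ _ e0)[N _ /(_ N (leqnn N))]].
rewrite /= sub0r normrN => h; exists N%:R; rewrite (le_trans (ler_norm _))//.
Qed.

(* On [-K, K] the substitution t |-> sin (t / K) is injective, so a continuous
   function is there a continuous function of sin (t / K), and its Bernstein
   polynomials in sin (t / K) are trigonometric polynomials in t. *)
Let trigpoly_approx (g : R -> R) (M K e : R) : continuous g ->
  (forall x, `|g x| <= M) -> 0 < K -> 0 < e ->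
  exists u, [/\ trigpoly u, forall t, `|u t| <= M &
     forall t, `|t| <= K -> `|g t - u t| <= e].
Proof.
move=> cg gM K0 e0.
(* For [|t| <= K] this keeps [w * t] within [[-1/2, 1/2]], inside the interval on which [asin]
   inverts [sin]. *)
pose w := (2 * K)^-1.
have K0' : K != 0 by rewrite gt_eqF.
have w0 : 0 < w by rewrite invr_gt0 mulr_gt0.
have pi1 : 1 <= pi / 2 :> R := pihalf_ge1 R.
have in1 (x : R) : -1 <= x <= 1 -> x \in `[- (pi / 2), pi / 2].
  by rewrite in_itv/= => /andP[h1 h2]; apply/andP; split; lra.
pose s : R := sin 2^-1.
have s1 : s < 1.
  rewrite /s -[ltRHS](sin_pihalf R) ltr_sin; [by lra|by apply: in1; lra|].
  by rewrite in_itv/= lexx andbT; lra.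
have s0 : 0 <= s.
  by rewrite -[leLHS]sin0 ltW// ltr_sin ?in1//; apply/andP; split; lra.
(* Clamping to [[-s, s]] with [s < 1] keeps the argument of [asin] inside the open interval where it
   is continuous, so [G] is continuous on the whole line; for [|t| <= K] the clamp does nothing. *)
pose cl (x : R) : R := Num.max (- s) (Num.min (2 * x - 1) s).
have clb x : -1 < cl x < 1.
  rewrite /cl lt_max gt_max ltrN2 s1/=.
  by rewrite gt_min s1 orbT andbT (le_lt_trans (_ : _ <= 0)) ?oppr_le0 ?ltr01.
pose G (x : R) : R := g (w^-1 * asin (cl x)).
have cG : continuous G.
  move=> x; apply: continuous_comp; last exact: cg.
  apply: continuous_comp; last exact: mulrl_continuous.
  apply: continuous_comp; last exact: continuous_asin.
  apply: continuous_max; first exact: cvg_cst.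
  apply: continuous_min; last exact: cvg_cst.
  by apply: cvgB; [exact: mulrl_continuous|exact: cvg_cst].
have GM x : `|G x| <= M by exact: gM.
have e20 : 0 < e / 2 by rewrite divr_gt0.
have [C C0 hC] := quadratic_modulus cG GM e20.
have [n hn] : exists n, C / n.+1%:R <= e / 2.
  exists (Num.truncn (C / (e / 2))).
  rewrite ler_pdivrMr ?ltr0n// mulrC -ler_pdivrMr// ltW//.
  exact: truncnS_gt.
have x01 (t : R) : 0 <= (1 + sin (w * t)) / 2 <= 1.
  by have := sin_geN1 (w * t); have := sin_le1 (w * t) => h1 h2; apply/andP; split; lra.
exists (fun t => bern n.+1 (fun i => G (i%:R / n.+1%:R)) ((1 + sin (w * t)) / 2)).
split=> [|t|t tK]; first exact: trigpoly_bern.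
  by apply: bern_bounded => // i; exact: GM.
have /andP[tI1 tI2] : - 2^-1 <= w * t <= 2^-1.
  rewrite -ler_norml normrM gtr0_norm// /w invfM -mulrA ler_piMr ?invr_ge0//.
  by rewrite mulrC ler_pdivrMr// mul1r.
have tI : w * t \in `[- (pi / 2), pi / 2] by apply: in1; apply/andP; split; lra.
have gE : g t = G ((1 + sin (w * t)) / 2).
  rewrite /G /cl (_ : 2 * _ - 1 = sin (w * t)); last by field.
  have sinK1 : sin (w * t) <= s.
    by rewrite leNgt ltr_sin -?leNgt// in1//; apply/andP; split; lra.
  have sinN1 : - s <= sin (w * t).
    by rewrite leNgt /s -sinN ltr_sin -?leNgt// in1//; apply/andP; split; lra.
  by rewrite (min_idPl _)// (max_idPr _)// sinK// mulrA mulVf ?mul1r// gt_eqF.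
rewrite gE distrC (le_trans (bern_near n C0 (x01 t) (fun y => hC _ y (x01 t))))//.
by rewrite [leRHS](splitr e) lerD.
Qed.

(** Within [[-K, K]] the test function is close to a trigonometric polynomial [u] with the same
    bound [M]. Outside, where [u] is not close, tightness of [Y n] and of [mu] makes the bound
    [2 * M] harmless. *)
Lemma levy_continuity : cvg_in_distribution P Y mu.
Proof.
move=> g cg [M gM]; apply/cvgrPdist_le => e e0.
have M0 : 0 <= M by exact: le_trans (gM 0).
have mg : measurable_fun setT g by exact: continuous_measurable_fun.
(* The budget is [3 * e1 + 4 * M * e1]: twice [e1 + 2 * M * e1] for replacing [g] by [u], and [e1]
   for the convergence of the integrals of [u]. *)
pose e1 := e / (4 * (1 + M)).
have M1 : 0 < 1 + M by rewrite ltr_pwDl.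
have e10 : 0 < e1 by rewrite divr_gt0// mulr_gt0.
have [K1 hK1] := tightY e10; have [K2 hK2] := tight_mu e10.
pose K := 1 + `|K1| + `|K2|.
have K0 : 0 < K by rewrite /K -addrA ltr_pwDl// addr_ge0.
have [u [tu uM ug]] := trigpoly_approx cg gM K0 e10.
have mu' := trigpoly_measurable tu.
have mA (n : nat) : measurable [set w | K <= `|Y n w|].
  have -> : [set w | K <= `|Y n w|] = (fun w => `|Y n w|) @^-1` `[K, +oo[.
    by apply/seteqP; split=> x; rewrite /= in_itv/= andbT.
  by rewrite -[X in measurable X]setTI; apply: measurableT_comp.
have mB : measurable [set x : R | K <= `|x|].
  have -> : [set x : R | K <= `|x|] = (fun x : R => `|x|) @^-1` `[K, +oo[.
    by apply/seteqP; split=> x; rewrite /= in_itv/= andbT.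
  by rewrite -[X in measurable X]setTI; exact: normr_measurable.
have tail d' (T' : measurableType d') (Q : probability T' R) (A B : set T') :
    measurable A -> measurable B -> A `<=` B -> fine (Q B) <= e1 -> fine (Q A) <= e1.
  move=> mA' mB' AB; apply: le_trans; apply: fine_le; rewrite ?fin_num_measure//.
  by apply: le_measure; rewrite ?inE.
have hY n : `|\int[P]_w g (Y n w) - \int[P]_w u (Y n w)| <= e1 + 2 * M * e1.
  have mgY : measurable_fun setT (fun w => g (Y n w)) by exact: measurableT_comp.
  have muY : measurable_fun setT (fun w => u (Y n w)) by exact: measurableT_comp.
  have ugY w : ~ [set w | K <= `|Y n w|] w -> `|g (Y n w) - u (Y n w)| <= e1.
    by move=> /= /negP; rewrite -ltNge => /ltW/ug.
  apply: le_trans (prob_Rintegral_near P (mA n) mgY muY (fun=> gM _) (fun=> uM _)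
    ugY (ltW e10)) _.
  rewrite lerD2l; apply: ler_wpM2l; first exact: mulr_ge0.
  apply: tail (hK1 n) => //.
    have -> : [set w | K1 <= `|Y n w|] = (fun w => `|Y n w|) @^-1` `[K1, +oo[.
      by apply/seteqP; split=> x; rewrite /= in_itv/= andbT.
    by rewrite -[X in measurable X]setTI; apply: measurableT_comp.
  move=> w /=; apply: le_trans; rewrite /K (le_trans (ler_norm K1))//.
  by have := normr_ge0 K2; lra.
have hmu : `|\int[mu]_x g x - \int[mu]_x u x| <= e1 + 2 * M * e1.
  have ugx x : ~ [set x : R | K <= `|x|] x -> `|g x - u x| <= e1.
    by move=> /= /negP; rewrite -ltNge => /ltW/ug.
  apply: le_trans (prob_Rintegral_near mu mB mg mu' gM uM ugx (ltW e10)) _.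
  rewrite lerD2l; apply: ler_wpM2l; first exact: mulr_ge0.
  apply: tail hK2 => //.
    have -> : [set x : R | K2 <= `|x|] = (fun x : R => `|x|) @^-1` `[K2, +oo[.
      by apply/seteqP; split=> x; rewrite /= in_itv/= andbT.
    by rewrite -[X in measurable X]setTI; exact: normr_measurable.
  move=> w /=; apply: le_trans; rewrite /K (le_trans (ler_norm K2))//.
  by have := normr_ge0 K1; lra.
have /cvgrPdist_le/(_ _ e10) cu := cvg_trigpoly tu.
near=> n.
have cun : `|\int[mu]_x u x - \int[P]_w u (Y n w)| <= e1 by near: n.
have eE : e = 4 * e1 + 4 * (M * e1).
  by rewrite /e1; field; rewrite gt_eqF.
have Me : 0 <= M * e1 by rewrite mulr_ge0// ltW.
have := hY n; move: hmu cun; rewrite !ler_norml => /andP[a1 a2] /andP[b1 b2] /andP[c1 c2].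
by apply/andP; split; lra.
Unshelve. all: end_near. Qed.

End levy_continuity.

(** * The characteristic function of the normal law *)

Section real_derivatives.
Context {R : realType}.
Implicit Types (f g : R -> R) (a b k x : R).

Lemma is_derive_mul f g x a b : is_derive x 1 f a -> is_derive x 1 g b ->
  is_derive x 1 (fun y => f y * g y) (a * g x + f x * b).
Proof.
move=> df dg; apply: is_derive_eq (is_deriveM df dg) _.
by rewrite addrC; congr (_ + _); rewrite mulrC.
Qed.

Lemma is_derive_comp f g x a b : is_derive (g x) 1 f a -> is_derive x 1 g b ->
  is_derive x 1 (fun y => f (g y)) (a * b).
Proof. exact: is_derive1_comp. Qed.

Lemma is_derive_add f g x a b : is_derive x 1 f a -> is_derive x 1 g b ->
  is_derive x 1 (fun y => f y + g y) (a + b).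
Proof. exact: is_deriveD. Qed.

Lemma is_derive_Ml f k x a : is_derive x 1 f a ->
  is_derive x 1 (fun y => k * f y) (k * a).
Proof.
move=> df; apply: is_derive_eq (is_derive_mul (is_derive_cst k x 1) df) _.
by rewrite mul0r add0r.
Qed.

Lemma is_derive_sqr x : is_derive x 1 (fun y : R => y * y) (2 * x).
Proof.
apply: is_derive_eq (is_derive_mul (is_derive_id x 1) (is_derive_id x 1)) _.
by rewrite mul1r mulr1 mulr_natl mulr2n.
Qed.

Lemma is_derive_linear k b x : is_derive x 1 (fun y : R => k * y + b) k.
Proof.
apply: is_derive_eq (is_deriveD (is_derive_Ml k (is_derive_id x 1)) (is_derive_cst b x 1)) _.
by rewrite mulr1 addr0.
Qed.

End real_derivatives.

Section integral_of_derivative.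
Context {R : realType}.
Local Notation mu := (@lebesgue_measure R).

Lemma Rintegral_derive_line (F f : R -> R) :
  (forall x : R, is_derive x 1 F (f x)) -> continuous f ->
  mu.-integrable setT (EFin \o f) ->
  F n%:R @[n --> \oo] --> 0 -> F (- n%:R) @[n --> \oo] --> 0 ->
  \int[mu]_x f x = 0.
Proof.
move=> dF cf intf Fy FNy.
have cF : continuous F.
  by move=> x; apply/differentiable_continuous/derivable1_diffP; have [] := dF x.
have mf : measurable_fun setT f by exact: continuous_measurable_fun.
have h n : \int[mu]_x ((f \_ `[- n.+1%:R, n.+1%:R]) x) = F n.+1%:R - F (- n.+1%:R).
  rewrite -Rintegral_mkcond /Rintegral (@continuous_FTC2 _ f F)//.
  - by rewrite gtrN.
  - exact: continuous_subspaceT.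
  - by split; [move=> x _; have [] := dF x|apply: cvg_at_right_filter; exact: cF|apply: cvg_at_left_filter; exact: cF].
  - by move=> x _; rewrite derive1E derive_val.
have l0 : \int[mu]_x ((f \_ `[- n.+1%:R, n.+1%:R]) x) @[n --> \oo] --> 0.
  have : F n.+1%:R - F (- n.+1%:R) @[n --> \oo] --> (0 - 0 : R).
    apply: cvgB; first by rewrite (cvg_shiftS (fun n => F n%:R)).
    by rewrite (cvg_shiftS (fun n => F (- n%:R))).
  by rewrite subr0; apply: cvg_trans; apply: near_eq_cvg; apply: nearW => n; rewrite h.
have l1 : \int[mu]_x ((f \_ `[- n.+1%:R, n.+1%:R]) x) @[n --> \oo] --> \int[mu]_x f x.
  apply: (@Rintegral_dominated_cvg _ _ _ mu (fun n => f \_ `[- n.+1%:R, n.+1%:R]) f (fun x => `|f x|)) => //.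
  - move=> n; apply/measurable_restrict => //; exact: measurable_funS mf.
  - apply: aeW => x; apply: cvg_near_cst.
    exists (Num.truncn `|x|) => // n /= xn.
    rewrite patchE mem_set//= in_itv/= -ler_norml.
    by rewrite ltW// (lt_le_trans (truncnS_gt _))// ler_nat.
  - exact: integrable_norm.
  - by apply: aeW => x n; rewrite patchE; case: ifPn => // _; rewrite normr0.
exact: (cvg_unique _ l1 l0).
Qed.

End integral_of_derivative.

Section normal_characteristic_function.
Context {R : realType}.
Variable s : R.
Hypothesis s0 : s != 0.
Local Notation mu := (@lebesgue_measure R).
Let p := normal_pdf 0 s : R -> R.

Lemma integral_normal_prob f : measurable_fun setT f ->
  (normal_prob 0 s).-integrable setT f ->
  (\int[normal_prob 0 s]_x f x = \int[mu]_x (f x * (normal_pdf 0 s x)%:E))%E.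
Proof.
move=> mf intf.
have dom := normal_prob_dominates (0 : R) s.
rewrite -(Radon_Nikodym_change_of_variables dom)//=.
apply: ae_eq_integral => //.
- exact: emeasurable_funM.
- by apply: emeasurable_funM => //=; apply/measurable_EFinP; exact: measurable_normal_pdf.
- apply: ae_eqe_mul2l => /=.
  rewrite Radon_NikodymE//=.
  case: cid => /= h [h1 h2 h3].
  apply: integral_ae_eq => //=.
  + by apply/measurable_EFinP; exact: measurable_normal_pdf.
  + by move=> E E01 mE; rewrite -h3//= /normal_prob.
Qed.

Let pE x : p x = normal_peak s * expR (- (x * x) / (s ^+ 2 *+ 2)).
Proof. by rewrite /p normal_pdfE// /normal_fun subr0 expr2. Qed.

Let dp (x : R) : is_derive x 1 p (- x / s ^+ 2 * p x).
Proof.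
have -> : p = (fun x => normal_peak s * expR (- (s ^+ 2 *+ 2)^-1 * (x * x))).
  by apply/funext => y; rewrite pE; congr (_ * expR _); rewrite !mulNr mulrC.
have dq := is_derive_Ml (- (s ^+ 2 *+ 2)^-1) (is_derive_sqr x).
apply: is_derive_eq (is_derive_Ml _ (is_derive_comp (is_derive_expR _) dq)) _.
by move: (expR _) => E; field.
Qed.

Let cp : continuous p. Proof. exact: continuous_normal_pdf. Qed.
Let mp : measurable_fun setT p. Proof. exact: measurable_normal_pdf. Qed.
Let p_ge0 x : 0 <= p x. Proof. exact: normal_pdf_ge0. Qed.
Let ip : mu.-integrable setT (EFin \o p). Proof. exact: integrable_normal_pdf. Qed.

(** Half of the Gaussian exponent absorbs the factor [|x|], and the other half is a density of twice
    the variance. This yields both the integrability of [|x| * p x] and the decay of [p] at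
    infinity. *)
Let xp_bound : exists C, forall x, `|x| * p x <= C * normal_pdf 0 (Num.sqrt 2 * s) x.
Proof.
have s20 : Num.sqrt 2 * s != 0 by rewrite mulf_neq0// gt_eqF// sqrtr_gt0.
exists (2 * `|s| * normal_peak s / normal_peak (Num.sqrt 2 * s)) => x.
have peak0 := normal_peak_gt0 s20.
rewrite pE normal_pdfE// /normal_fun subr0.
rewrite [leRHS](_ : _ = normal_peak s * (2 * `|s| *
  expR (- x ^+ 2 / ((Num.sqrt 2 * s) ^+ 2 *+ 2)))); last first.
  by move: (expR _) => E; field; rewrite gt_eqF.
rewrite mulrCA ler_wpM2l ?normal_peak_ge0//.
pose t := x ^+ 2 / (4 * s ^+ 2).
have -> : - (x * x) / (s ^+ 2 *+ 2) = - t - t by rewrite /t; field.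
have -> : - x ^+ 2 / ((Num.sqrt 2 * s) ^+ 2 *+ 2) = - t.
  by rewrite exprMn sqr_sqrtr// /t; field.
rewrite expRD mulrA ler_wpM2r ?expR_ge0// expRN ler_pdivrMr ?expR_gt0//.
have s0' : 0 < `|s| by rewrite normr_gt0.
have h1 : 1 + t <= expR t by exact: expR_ge1Dx.
apply: (@le_trans _ _ (2 * `|s| * (1 + t))); last by rewrite ler_wpM2l ?mulr_ge0.
(* In terms of [a = |x| / (2 |s|)] the claim becomes [a <= 1 + a ^ 2]. *)
have -> : t = (`|x| / (2 * `|s|)) ^+ 2.
  by rewrite /t expr_div_n exprMn !real_normK ?num_real// -natrX.
set a := `|x| / _.
have -> : `|x| = 2 * `|s| * a by rewrite /a mulrC divfK// gt_eqF// mulr_gt0.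
rewrite ler_wpM2l ?mulr_ge0//.
by have := sqr_ge0 (a - 2^-1); nra.
Qed.

Let ixp : mu.-integrable setT (EFin \o (fun x => `|x| * p x)).
Proof.
have [C hC] := xp_bound.
have ic : mu.-integrable setT (EFin \o (fun x => C * normal_pdf 0 (Num.sqrt 2 * s) x)).
  exact/integrableRZ/integrable_normal_pdf.
apply: integrable_dominated ic _; first exact: measurable_funM.
move=> x; rewrite ger0_norm ?mulr_ge0//.
exact: le_trans (hC x) (ler_norm _).
Qed.

Let p_cvg0 : p n%:R @[n --> \oo] --> 0 /\ p (- n%:R) @[n --> \oo] --> 0.
Proof.
have s20 : Num.sqrt 2 * s != 0 by rewrite mulf_neq0// gt_eqF// sqrtr_gt0.
have [C hC] := xp_bound; pose K := `|C| * normal_peak (Num.sqrt 2 * s).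
have hK x : `|x| * p x <= K.
  rewrite (le_trans (hC x))// (le_trans (ler_norm _))// normrM ler_wpM2l//.
  by rewrite ger0_norm ?normal_pdf_ge0// normal_pdf_ub.
have K0 : K * n.+1%:R^-1 @[n --> \oo] --> 0.
  by rewrite -[X in _ --> X](mulr0 K); apply: cvgMr; exact: cvg_harmonic.
split; rewrite -cvg_shiftS; apply: (squeeze_cvgr _ (cvg_cst 0) K0); near=> n;
  rewrite p_ge0/= ler_pdivlMr// mulrC (le_trans _ (hK n.+1%:R))//.
  by rewrite ger0_norm.
by rewrite ger0_norm// !pE mulrNN.
Unshelve. all: end_near. Qed.

Variable th : R.
(** The phase [th] treats cosine ([th = 0]) and sine ([th = - pi / 2]) together. As a function of
    [z] this solves [F' = - s^2 z F], by differentiation under the integral and integration by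
    parts. *)
Let F z := \int[mu]_x (cos (z * x + th) * p x).

Let dcos (a y : R) : is_derive y 1 (fun t => cos (a * t + th)) (- a * sin (a * y + th)).
Proof.
apply: is_derive_eq (is_derive_comp (is_derive_cos _) (is_derive_linear a th y)) _.
by ring.
Qed.

Let dsin (a y : R) : is_derive y 1 (fun t => sin (a * t + th)) (a * cos (a * y + th)).
Proof.
apply: is_derive_eq (is_derive_comp (is_derive_sin _) (is_derive_linear a th y)) _.
by ring.
Qed.

Let clin z : continuous (fun x : R => z * x + th).
Proof. by move=> x; apply: cvgD; [exact: mulrl_continuous|exact: cvg_cst]. Qed.
Let ccos z : continuous (fun x : R => cos (z * x + th)).
Proof. by move=> x; apply: continuous_comp; [exact: clin|exact: continuous_cos]. Qed.
Let csin z : continuous (fun x : R => sin (z * x + th)).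
Proof. by move=> x; apply: continuous_comp; [exact: clin|exact: continuous_sin]. Qed.
Let norm_sin (x : R) : `|sin x| <= 1.
Proof. by rewrite ler_norml sin_geN1 sin_le1. Qed.
Let norm_cos (x : R) : `|cos x| <= 1.
Proof. by rewrite ler_norml cos_geN1 cos_le1. Qed.

Let icos z : mu.-integrable setT (EFin \o (fun x => cos (z * x + th) * p x)).
Proof.
apply: integrable_dominated ip _.
  by apply: measurable_funM => //; exact: continuous_measurable_fun.
by move=> x; rewrite normrM ler_piMl.
Qed.

Let isin z : mu.-integrable setT (EFin \o (fun x => x * sin (z * x + th) * p x)).
Proof.
apply: integrable_dominated ixp _.
  apply: measurable_funM => //; apply: measurable_funM => //.
  exact: continuous_measurable_fun.
by move=> x; rewrite !normrM normr_id mulrAC ler_piMr ?mulr_ge0.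
Qed.

Let dF (z : R) : is_derive z 1 F (- \int[mu]_x (x * sin (z * x + th) * p x)).
Proof.
have d1 (z' y : R) : is_derive z' 1 (fun t => cos (t * y + th) * p y) (- (y * sin (z' * y + th) * p y)).
  have dc : is_derive z' 1 (fun t => cos (t * y + th)) (- y * sin (z' * y + th)).
    have := dcos y z'; rewrite [y * z']mulrC; congr is_derive.
    by apply/funext => t; rewrite mulrC.
  apply: is_derive_eq (is_derive_mul dc (is_derive_cst (p y) z' 1)) _.
  by rewrite mulr0 addr0 !mulNr.
have Iz : `]z - 1, z + 1[%classic z by rewrite /= in_itv/=; apply/andP; split; lra.
have h1 (x : R) : `]z - 1, z + 1[%classic x ->
  mu.-integrable setT (EFin \o (fun y : R => cos (x * y + th) * p y)) by move=> _; exact: icos.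
have h2 (x y : R) : `]z - 1, z + 1[%classic x -> setT y ->
  derivable (fun t : R => cos (t * y + th) * p y) x 1 by move=> _ _; have [] := d1 x y.
have h3 (y : R) : 0 <= `|y| * p y by rewrite mulr_ge0.
have h4 (x y : R) : `]z - 1, z + 1[%classic x -> setT y ->
  `|partial1of2 (fun x y : R => cos (x * y + th) * p y) x y| <= `|y| * p y.
  move=> _ _; rewrite partial1of2E derive_val normrN !normrM (ger0_norm (p_ge0 _)).
  by rewrite ler_wpM2r// ler_piMr.
have D1 := derivable_under_integral measurableT Iz h1 h2 h3 ixp h4.
have D2 := differentiation_under_integral measurableT Iz h1 h2 h3 ixp h4.
apply: DeriveDef => //; rewrite -derive1E D2 -mulN1r -RintegralZl//.
by apply: eq_Rintegral => y _; rewrite partial1of2E derive_val mulN1r.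
Qed.

(** Integration by parts with [p' x = - x / s^2 * p x]: the function [h] below is the derivative of
    [sin (z * x + th) * p x], which vanishes at infinity, so its integral is 0. *)
Let ibp z : \int[mu]_x (x * sin (z * x + th) * p x) = s ^+ 2 * z * F z.
Proof.
have s20 : s ^+ 2 != 0 by rewrite expf_neq0.
pose h x := z * (cos (z * x + th) * p x) - (s ^+ 2)^-1 * (x * sin (z * x + th) * p x).
have i1 : mu.-integrable setT (EFin \o (fun x => z * (cos (z * x + th) * p x))).
  exact: integrableRZ.
have i2 : mu.-integrable setT
    (EFin \o (fun x => (s ^+ 2)^-1 * (x * sin (z * x + th) * p x))).
  exact: integrableRZ.
have : \int[mu]_x h x = 0.
  apply: (@Rintegral_derive_line _ (fun x => sin (z * x + th) * p x)).
  - move=> x.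
    apply: is_derive_eq (is_derive_mul (dsin z x) (dp x)) _.
    by rewrite /h; field.
  - move=> x; apply: cvgB; apply: cvgM; [exact: cvg_cst| |exact: cvg_cst|].
      by apply: cvgM; [exact: ccos|exact: cp].
    by apply: cvgM; [apply: cvgM; [exact: cvg_id|exact: csin]|exact: cp].
  - exact: integrableRB.
  - apply/norm_cvg0P; apply: (squeeze_cvgr _ (cvg_cst 0) p_cvg0.1); near=> n.
    by rewrite normr_ge0/= normrM (ger0_norm (p_ge0 _)) ler_piMl.
  - apply/norm_cvg0P; apply: (squeeze_cvgr _ (cvg_cst 0) p_cvg0.2); near=> n.
    by rewrite normr_ge0/= normrM (ger0_norm (p_ge0 _)) ler_piMl.
rewrite RintegralB// (RintegralZl z measurableT (icos z)).
rewrite (RintegralZl (s ^+ 2)^-1 measurableT (isin z)).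
move/eqP; rewrite subr_eq0 -/(F z) => /eqP h0.
by rewrite -mulrA h0 mulrA divff// mul1r.
Unshelve. all: end_near. Qed.

(** The differential equation makes [F * E] constant for [E z = expR (s^2 z^2 / 2)], and its value
    at 0 is [cos th]. *)
Lemma normal_pdf_cos z :
  \int[mu]_x (cos (z * x + th) * p x) = cos th * expR (- (s ^+ 2 * z ^+ 2) / 2).
Proof.
pose E (z : R) := expR (s ^+ 2 / 2 * (z * z)).
have dE (x : R) : is_derive x 1 E (s ^+ 2 * x * E x).
  have dq := is_derive_Ml (s ^+ 2 / 2) (is_derive_sqr x).
  apply: is_derive_eq (is_derive_comp (is_derive_expR _) dq) _.
  by rewrite /E; move: (expR _) => e; field.
have d0 (x : R) : is_derive x 1 (fun y => F y * E y) 0.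
  apply: is_derive_eq (is_derive_mul (dF x) (dE x)) _.
  by rewrite ibp; ring.
have /= := is_derive_0_is_cst z 0 d0.
have -> : E 0 = 1 by rewrite /E !mulr0 expR0.
have -> : F 0 = cos th.
  rewrite /F (@eq_Rintegral _ _ _ mu setT (fun x => cos th * p x)); last first.
    by move=> x _; rewrite mul0r add0r.
  rewrite RintegralZl// -[RHS]mulr1; congr (_ * _).
  by rewrite /Rintegral integral_normal_pdf.
rewrite mulr1 => <-; rewrite -[LHS]/(F z) -mulrA -expRD.
rewrite (_ : _ + _ = 0) ?expR0 ?mulr1//.
by rewrite -expr2; ring.
Qed.

End normal_characteristic_function.

Lemma normal_law_cos (R : realType) (v z th : R) : 0 <= v ->
  \int[normal_law 0 v]_x cos (z * x + th) = cos th * expR (- (v * z ^+ 2) / 2).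
Proof.
move=> v0; have mc : measurable_fun setT (fun x : R => cos (z * x + th)).
  apply: continuous_measurable_fun => x; apply: continuous_comp; last exact: continuous_cos.
  by apply: cvgD; [exact: mulrl_continuous|exact: cvg_cst].
rewrite /normal_law; case: eqP => [->|/eqP vn0].
  rewrite /Rintegral /= integral_dirac//=; last exact/measurable_EFinP.
  by rewrite indicT mul1r mulr0 add0r mul0r oppr0 mul0r expR0 mulr1.
have sv0 : Num.sqrt v != 0 by rewrite sqrtr_eq0 -ltNge lt_neqAle eq_sym vn0.
rewrite /Rintegral /= integral_normal_prob//; last 2 first.
- exact/measurable_EFinP.
- apply: (@prob_integrable_bounded _ _ _ (normal_prob 0 (Num.sqrt v)) _ 1) => //.
  by move=> x; rewrite ler_norml cos_geN1 cos_le1.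
have := normal_pdf_cos sv0 th z; rewrite sqr_sqrtr// => <-.
Qed.

(** * Moments from characteristic functions *)

Section trigonometric_estimates.
Context {R : realType}.
Implicit Types (a b s t x y : R).

(** The mean value theorem from 0, for [t] of either sign. It replaces Taylor's formula below: each
    application gains one power of [t] over the bound for the derivative. *)
Lemma mean_value0 (f f' : R -> R) t : (forall x, is_derive x 1 f (f' x)) ->
  f 0 = 0 -> exists2 x, `|x| <= `|t| & f t = t * f' x.
Proof.
move=> df f0.
have cf : continuous f.
  by move=> x; apply/differentiable_continuous/derivable1_diffP; have [] := df x.
have [t0|t0] := leP 0 t.
  have [|x xt] := @MVT_segment R f f' 0 t t0 (fun x _ => df x).
    exact: continuous_subspaceT.
  rewrite f0 !subr0 => ->; exists x; last by rewrite mulrC.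
  by move: xt; rewrite in_itv/= => /andP[x0 xt]; rewrite !ger0_norm// (le_trans x0).
have [|x xt] := @MVT_segment R f f' t 0 (ltW t0) (fun x _ => df x).
  exact: continuous_subspaceT.
rewrite f0 !sub0r mulrN => /oppr_inj ->; exists x; last by rewrite mulrC.
move: xt; rewrite in_itv/= => /andP[xt x0].
by rewrite ler0_norm// ltr0_norm// lerN2.
Qed.

Lemma norm_cos_le1 x : `|cos x| <= 1.
Proof. by rewrite ler_norml cos_geN1 cos_le1. Qed.

Lemma norm_sin_le1 x : `|sin x| <= 1.
Proof. by rewrite ler_norml sin_geN1 sin_le1. Qed.

Lemma norm_sin_le x : `|sin x| <= `|x|.
Proof.
have [y _ ->] := @mean_value0 sin cos x (fun x => is_derive_sin x) (sin0 R).
by rewrite normrM ler_piMr// norm_cos_le1.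
Qed.

Lemma onem_cos_ge0 x : 0 <= 1 - cos x.
Proof. by rewrite subr_ge0 cos_le1. Qed.

Lemma onem_cos_le x : 1 - cos x <= x ^+ 2 / 2.
Proof.
have -> : 1 - cos x = 2 * sin (x / 2) ^+ 2.
  have {1}-> : x = x / 2 + x / 2 by field.
  rewrite cosD; have := cos2Dsin2 (x / 2); rewrite -!expr2 => h.
  by rewrite -{1}h; ring.
have := norm_sin_le (x / 2); rewrite -ler_sqr ?nnegrE// !real_normK ?num_real// => h.
apply: (@le_trans _ _ (2 * (x / 2) ^+ 2)); first by rewrite ler_wpM2l.
by rewrite le_eqVlt; apply/orP; left; apply/eqP; field.
Qed.

Lemma norm_sinB_le3 x : `|sin x - x| <= `|x| ^+ 3 / 2.
Proof.
have df (y : R) : is_derive y 1 (fun y : R => sin y - y) (cos y - 1).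
  exact: is_deriveB.
have [|y yx ->] := mean_value0 x df; first by rewrite sin0 subr0.
rewrite normrM distrC (ger0_norm (onem_cos_ge0 _)) exprS -mulrA ler_wpM2l//.
rewrite (le_trans (onem_cos_le _))// ler_pM2r// -[leLHS]real_normK ?num_real//.
by rewrite ler_sqr ?nnegrE.
Qed.

(** Cubic smallness serves for [|x| <= 1] and the linear bound beyond; the quadratic form is
    integrable against a Levy measure with finite second moment. *)
Lemma norm_sinB_le2 x : `|sin x - x| <= 2 * x ^+ 2.
Proof.
have [x1|x1] := leP `|x| 1.
  apply: le_trans (norm_sinB_le3 x) _; rewrite -(real_normK (num_real x)).
  move: x1 (normr_ge0 x); move: `|x| => t t1 t0.
  have : 0 <= t ^+ 2 * (1 - t) by rewrite mulr_ge0 ?sqr_ge0 ?subr_ge0.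
  by nra.
apply: le_trans (ler_normB _ _) _; apply: le_trans (lerD (norm_sin_le1 x) (lexx _)) _.
by rewrite -(real_normK (num_real x)); move: x1; move: `|x| => t t1; nra.
Qed.

Lemma cosDsqr_ge0 x : 0 <= cos x - 1 + x ^+ 2 / 2.
Proof. by have := onem_cos_le x; lra. Qed.

Lemma cosDsqr_le2 x : cos x - 1 + x ^+ 2 / 2 <= x ^+ 2 / 2.
Proof. by have := cos_le1 x; lra. Qed.

Lemma cosDsqr_le4 x : cos x - 1 + x ^+ 2 / 2 <= x ^+ 4 / 2.
Proof.
have df (y : R) : is_derive y 1 (fun y : R => cos y - 1 + 2^-1 * (y * y)) (- (sin y - y)).
  apply: is_derive_eq (is_derive_add (is_derive_add (is_derive_cos y)
    (is_derive_cst (- 1 : R) y 1)) (is_derive_Ml 2^-1 (is_derive_sqr y))) _.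
  by field.
have [|y yx] := mean_value0 x df; first by rewrite cos0 subrr mulr0 mulr0 addr0.
rewrite -expr2 [x ^+ 2 / 2]mulrC => ->.
apply: le_trans (ler_norm _) _; rewrite normrM normrN.
apply: (@le_trans _ _ (`|x| * (`|x| ^+ 3 / 2))).
  rewrite ler_wpM2l// (le_trans (norm_sinB_le3 _))// ler_pM2r//.
  by rewrite lerXn2r ?nnegrE.
by rewrite mulrA -exprS -normrX ger0_norm// exprn_even_ge0.
Qed.

Lemma norm_cosB_le a b : `|cos a - cos b| <= `|a - b|.
Proof.
have df (y : R) : is_derive y 1 (fun y : R => cos (1 * y + b) - cos b) (- sin (1 * y + b) * 1).
  apply: is_derive_eq (is_derive_add (is_derive_comp (is_derive_cos _)
    (is_derive_linear 1 b y)) (is_derive_cst (- cos b) y 1)) _.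
  by rewrite addr0.
have [|y _] := mean_value0 (a - b) df; first by rewrite mulr0 add0r subrr.
rewrite mul1r subrK => ->; rewrite normrM ler_piMr//.
by rewrite mulr1 normrN norm_sin_le1.
Qed.

Lemma norm_sinB_le a b : `|sin a - sin b| <= `|a - b|.
Proof.
have := norm_cosB_le (a - pi / 2) (b - pi / 2).
by rewrite !cosBpihalf (_ : _ - _ - _ = a - b)//; ring.
Qed.

Lemma norm_expRB_le a b : a <= 0 -> b <= 0 -> `|expR a - expR b| <= `|a - b|.
Proof.
wlog ab : a b / a <= b => [H a0 b0|a0 b0].
  have [ab|/ltW ba] := leP a b; first exact: H.
  by rewrite distrC (distrC a); exact: H.
rewrite distrC ger0_norm ?subr_ge0 ?ler_expR// distrC ger0_norm ?subr_ge0//.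
have -> : expR b - expR a = expR b * (1 - expR (a - b)).
  by rewrite mulrBr mulr1 -expRD subrKC.
have eb : expR b <= 1 by rewrite -expR0 ler_expR.
have := expR_ge1Dx (a - b) => h.
apply: le_trans (ler_wpM2r _ eb) _; last by rewrite mul1r; lra.
by rewrite subr_ge0 -expR0 ler_expR subr_le0.
Qed.

(** On nonpositive reals [expR] is 1-Lipschitz and at most 1, so errors in the exponent pass to the
    characteristic function with constant 1. *)
Lemma expRcos_lipschitz a b a' b' : a <= 0 -> a' <= 0 ->
  `|expR a * cos b - expR a' * cos b'| <= `|a - a'| + `|b - b'|.
Proof.
move=> a0 a'0.
have -> : expR a * cos b - expR a' * cos b' =
  (expR a - expR a') * cos b + expR a' * (cos b - cos b') by ring.
apply: le_trans (ler_normD _ _) _; rewrite !normrM lerD//.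
  by apply: le_trans (norm_expRB_le a0 a'0); rewrite ler_piMr// norm_cos_le1.
apply: le_trans (norm_cosB_le b b'); rewrite ler_piMl//.
by rewrite ger0_norm ?expR_ge0// -expR0 ler_expR.
Qed.

Lemma expRsin_lipschitz a b a' b' : a <= 0 -> a' <= 0 ->
  `|expR a * sin b - expR a' * sin b'| <= `|a - a'| + `|b - b'|.
Proof.
move=> a0 a'0; have := expRcos_lipschitz (b - pi / 2) (b' - pi / 2) a0 a'0.
by rewrite !cosBpihalf (_ : _ - _ - _ = b - b')//; ring.
Qed.

(** From [expR s >= 1 + s] and [(1 + s) (1 - s + s^2) = 1 + s^3]. *)
Lemma expRN_le s : 0 <= s -> expR (- s) <= 1 - s + s ^+ 2.
Proof.
move=> s0; rewrite expRN; apply: (@le_trans _ _ (1 + s)^-1).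
  by rewrite lef_pV2 ?posrE ?expR_gt0 ?expR_ge1Dx// ltr_pwDl.
rewrite -[_^-1]mul1r ler_pdivrMr ?ltr_pwDl//.
by have h3 : 0 <= s ^+ 3; [rewrite exprn_ge0|nra].
Qed.

Lemma onem_expRcos s x : 0 <= s ->
  `|1 - expR (- s) * cos x - (s + x ^+ 2 / 2)| <= s ^+ 2 + x ^+ 4 / 2 + s * (x ^+ 2 / 2).
Proof.
move=> s0; have h1 := expRN_le s0; have h2 := expR_ge1Dx (- s).
have h3 := cosDsqr_le4 x; have h4 := cosDsqr_ge0 x; have h5 := onem_cos_le x.
have h6 := onem_cos_ge0 x; have h7 := expR_ge0 (- s).
have h8 : expR (- s) <= 1 by rewrite -expR0 ler_expR oppr_le0.
move: h1 h2 h3 h4 h5 h6 h7 h8; move: (expR _) (cos _) (x ^+ 2 / 2) (x ^+ 4 / 2) => e c x2 x4.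
move=> h1 h2 h3 h4 h5 h6 h7 h8.
have x40 : 0 <= x4 by apply: le_trans h4 h3.
have x20 : 0 <= x2 by apply: le_trans h6 h5.
have p1 : 0 <= (1 - e) * (1 - c) by rewrite mulr_ge0// subr_ge0.
have p2 : 0 <= e * (x4 - (c - 1 + x2)) by rewrite mulr_ge0// subr_ge0.
have p3 : 0 <= (s - (1 - e)) * x2 by rewrite mulr_ge0//; lra.
have p4 : 0 <= (1 - e) * x4 by rewrite mulr_ge0// subr_ge0.
have p5 : 0 <= s * x2 by rewrite mulr_ge0.
have p6 := sqr_ge0 s.
rewrite ler_norml; apply/andP; split; lra.
Qed.

Lemma expRsin_near s x : 0 <= s ->
  `|expR (- s) * sin x - x| <= `|x| ^+ 3 / 2 + s * `|x|.
Proof.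
move=> s0; have -> : expR (- s) * sin x - x = (sin x - x) - (1 - expR (- s)) * sin x by ring.
apply: le_trans (ler_normB _ _) _; rewrite lerD ?norm_sinB_le3// normrM.
have h8 : expR (- s) <= 1 by rewrite -expR0 ler_expR oppr_le0.
have h2 := expR_ge1Dx (- s).
rewrite ger0_norm ?subr_ge0// ler_pM ?subr_ge0 ?norm_sin_le//.
by lra.
Qed.

End trigonometric_estimates.

Section moments_from_characteristic_function.
Context {d} {T : measurableType d} {R : realType}.

(* [2 n^2 (1 - cos (y / n))] is the squared chord approximating [y^2]. *)
Definition chord_sqr (n : nat) (y : R) : R :=
  2 * n.+1%:R ^+ 2 * (1 - cos (n.+1%:R^-1 * y)).

Lemma chord_sqr_ge0 n y : 0 <= chord_sqr n y.
Proof. by rewrite /chord_sqr mulr_ge0 ?onem_cos_ge0// mulr_ge0// exprn_ge0. Qed.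

Lemma chord_sqr_le n y : chord_sqr n y <= y ^+ 2.
Proof.
have n0 : n.+1%:R != 0 :> R by rewrite pnatr_eq0.
apply: (@le_trans _ _ (2 * n.+1%:R ^+ 2 * ((n.+1%:R^-1 * y) ^+ 2 / 2))).
  by rewrite ler_wpM2l ?onem_cos_le// mulr_ge0// exprn_ge0.
rewrite le_eqVlt; apply/orP; left; apply/eqP.
by move: n0; move: (n.+1%:R) => m m0; field.
Qed.

Lemma cvg_chord_sqr y : chord_sqr n y @[n --> \oo] --> y ^+ 2.
Proof.
have K0 : y ^+ 4 * harmonic n @[n --> \oo] --> 0.
  by rewrite -[X in _ --> X](mulr0 (y ^+ 4)); apply: cvgMr; exact: cvg_harmonic.
apply/subr_cvg0/norm_cvg0P; apply: (squeeze_cvgr _ (cvg_cst 0) K0).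
near=> n; rewrite normr_ge0/= /chord_sqr /harmonic.
set m : R := n.+1%:R; have m0 : 0 < m by rewrite ltr0n.
have m1 : 1 <= m by rewrite ler1n.
have -> : 2 * m ^+ 2 * (1 - cos (m^-1 * y)) - y ^+ 2 =
  - (2 * m ^+ 2 * (cos (m^-1 * y) - 1 + (m^-1 * y) ^+ 2 / 2)).
  by move: (cos _) => c; field; rewrite gt_eqF.
rewrite normrN ger0_norm; last first.
  by rewrite mulr_ge0 ?cosDsqr_ge0// mulr_ge0// exprn_ge0// ltW.
apply: (@le_trans _ _ (2 * m ^+ 2 * ((m^-1 * y) ^+ 4 / 2))).
  by rewrite ler_wpM2l ?cosDsqr_le4// mulr_ge0// exprn_ge0// ltW.
rewrite (_ : _ * (_ / 2) = y ^+ 4 * m^-1 * m^-1); last by field; rewrite gt_eqF.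
by rewrite ler_piMr ?invf_le1// mulr_ge0 ?invr_ge0 ?(ltW m0)// exprn_even_ge0.
Unshelve. all: end_near. Qed.

Lemma measurable_chord_sqr n (Y : T -> R) : measurable_fun setT Y ->
  measurable_fun setT (fun w => chord_sqr n (Y w)).
Proof.
move=> mY; apply: measurable_funM => //; apply: measurable_funB => //.
exact: measurable_cosM.
Qed.

(** Bounds on the chord squares come from a characteristic function alone, so no integrability of
    [Y] is presupposed. The measure is arbitrary because the lemma also serves for the Levy
    measure. *)
Lemma fatou_second_moment (mu : {measure set T -> \bar R}) (Y : T -> R)
    (u : nat -> R) (M : R) : measurable_fun setT Y ->
  (forall n, \int[mu]_w (chord_sqr n (Y w))%:E <= (u n)%:E)%E ->
  u n @[n --> \oo] --> M ->
  (\int[mu]_w (Y w ^+ 2)%:E <= M%:E)%E.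
Proof.
move=> mY uY uM.
have := @fatou _ _ _ mu setT measurableT (fun n w => (chord_sqr n (Y w))%:E).
move=> /(_ _ _)/le_trans H.
have -> : (\int[mu]_w (Y w ^+ 2)%:E =
    \int[mu]_w limn_einf (fun n => (chord_sqr n (Y w))%:E))%E.
  apply: eq_integral => w _; apply/esym.
  have /cvg_limn_einf_sup[] : (chord_sqr n (Y w))%:E @[n --> \oo] --> (Y w ^+ 2)%:E.
    by apply: cvg_EFin; [exact: nearW|exact: cvg_chord_sqr].
  by [].
apply: H.
- by move=> n; apply/measurable_EFinP/measurable_chord_sqr.
- by move=> n w _; rewrite lee_fin chord_sqr_ge0.
have uM' : (u n)%:E @[n --> \oo] --> M%:E by apply: cvg_EFin; [exact: nearW|exact: uM].
have [<- _] := cvg_limn_einf_sup uM'.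
rewrite !limn_einf_lim; apply: lee_lim; [exact: is_cvg_einfs|exact: is_cvg_einfs|].
apply: nearW => n; apply: le_ereal_inf_tmp => _ [m /= nm <-].
by apply: le_trans (uY m); apply: ereal_inf_lbound; exists m.
Qed.

Lemma integrable_sqr_fin (mu : {measure set T -> \bar R}) (Y : T -> R) (M : R) :
  measurable_fun setT Y -> (\int[mu]_w (Y w ^+ 2)%:E <= M%:E)%E ->
  mu.-integrable setT (EFin \o (fun w => Y w ^+ 2)).
Proof.
move=> mY YM; apply/integrableP; split.
  by apply/measurable_EFinP; exact: measurable_funX.
under eq_integral do rewrite /= ger0_norm ?sqr_ge0//.
by rewrite (le_lt_trans YM)// ltry.
Qed.

Variable P : probability T R.

Lemma integrable_of_sqr (Y : T -> R) : measurable_fun setT Y ->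
  P.-integrable setT (EFin \o (fun w => Y w ^+ 2)) ->
  P.-integrable setT (EFin \o Y).
Proof.
move=> mY iY; have i1 : P.-integrable setT (EFin \o (fun w => 1 + Y w ^+ 2)).
  apply: integrableRD => //; apply: (@prob_integrable_bounded _ _ _ P _ 1) => // x.
  by rewrite normr1.
apply: integrable_dominated i1 _ => // w.
rewrite [leRHS]ger0_norm ?addr_ge0 ?sqr_ge0// -(real_normK (num_real (Y w))).
by move: (`|Y w|) => t; have := sqr_ge0 (t - 1); nra.
Qed.

Lemma cvg_chord_moment (Y : T -> R) : measurable_fun setT Y ->
  P.-integrable setT (EFin \o (fun w => Y w ^+ 2)) ->
  \int[P]_w chord_sqr n (Y w) @[n --> \oo] --> \int[P]_w (Y w ^+ 2).
Proof.
move=> mY iY; apply: (@Rintegral_dominated_cvg _ _ _ P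
  (fun n w => chord_sqr n (Y w)) _ (fun w => Y w ^+ 2)) => //.
- by move=> n; exact: measurable_chord_sqr.
- exact: measurable_funX.
- by apply: aeW => w; exact: cvg_chord_sqr.
- by apply: aeW => w n; rewrite ger0_norm ?chord_sqr_ge0 ?chord_sqr_le.
Qed.

Lemma cvg_sin_moment (Y : T -> R) : measurable_fun setT Y ->
  P.-integrable setT (EFin \o (fun w => Y w ^+ 2)) ->
  \int[P]_w (n.+1%:R * sin (n.+1%:R^-1 * Y w)) @[n --> \oo] --> \int[P]_w Y w.
Proof.
move=> mY iY; apply: (@Rintegral_dominated_cvg _ _ _ P
  (fun n w => n.+1%:R * sin (n.+1%:R^-1 * Y w)) _ (fun w => `|Y w|)) => //.
- by move=> n; apply: measurable_Ml; exact: measurable_sinM.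
- apply: aeW => w; set y := Y w.
  have K0 : `|y| ^+ 3 * harmonic n @[n --> \oo] --> 0.
    by rewrite -[X in _ --> X](mulr0 (`|y| ^+ 3)); apply: cvgMr; exact: cvg_harmonic.
  apply/subr_cvg0/norm_cvg0P; apply: (squeeze_cvgr _ (cvg_cst 0) K0).
  near=> n; rewrite normr_ge0/= /harmonic.
  set m : R := n.+1%:R; have m0 : 0 < m by rewrite ltr0n.
  have m1 : 1 <= m by rewrite ler1n.
  have -> : m * sin (m^-1 * y) - y = m * (sin (m^-1 * y) - m^-1 * y).
    by move: (sin _) => c; field; rewrite gt_eqF.
  rewrite normrM (gtr0_norm m0).
  apply: le_trans (ler_wpM2l (ltW m0) (norm_sinB_le3 _)) _.
  rewrite normrM gtr0_norm ?invr_gt0//.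
  rewrite (_ : m * _ = `|y| ^+ 3 * m^-1 * (m^-1 / 2)); last by field; rewrite gt_eqF.
  rewrite ler_piMr//; first by rewrite mulr_ge0 ?invr_ge0 ?(ltW m0)// exprn_ge0.
  by rewrite mulr_ile1 ?invr_ge0 ?(ltW m0)// ?invf_le1// ler1n.
- exact/integrable_norm/integrable_of_sqr.
- apply: aeW => w n; rewrite normrM ger0_norm//.
  apply: le_trans (ler_wpM2l _ (norm_sin_le _)) _ => //.
  by rewrite normrM ger0_norm ?invr_ge0// mulrA divff ?mul1r// pnatr_eq0.
Unshelve. all: end_near. Qed.

Lemma prob_Rintegral_chord n (Y : T -> R) : measurable_fun setT Y ->
  \int[P]_w chord_sqr n (Y w) =
  2 * n.+1%:R ^+ 2 * (1 - \int[P]_w cos (n.+1%:R^-1 * Y w)).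
Proof.
move=> mY; have ic : P.-integrable setT (EFin \o (fun w => cos (n.+1%:R^-1 * Y w))).
  apply: (@prob_integrable_bounded _ _ _ P _ 1) => [|x]; last exact: norm_cos_le1.
  exact: measurable_cosM.
have i1 : P.-integrable setT (EFin \o (fun=> 1 : R)).
  by apply: (@prob_integrable_bounded _ _ _ P _ 1) => // x; rewrite normr1.
rewrite /chord_sqr RintegralZl//; last exact: integrableRB.
by rewrite RintegralB// prob_Rintegral_cst.
Qed.

Lemma integral_chordE n (Y : T -> R) : measurable_fun setT Y ->
  (\int[P]_w (chord_sqr n (Y w))%:E = (\int[P]_w chord_sqr n (Y w))%:E)%E.
Proof.
move=> mY; rewrite /Rintegral fineK//; apply: integrable_fin_num => //.
apply: (@prob_integrable_bounded _ _ _ P _ (2 * n.+1%:R ^+ 2 * 2)).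
  exact: measurable_chord_sqr.
move=> w; rewrite ger0_norm ?chord_sqr_ge0// /chord_sqr ler_wpM2l//.
by have := cos_geN1 (n.+1%:R^-1 * Y w); lra.
Qed.

(** An expansion with error o(z^2) along [z = 1 / (n + 1)] determines two moments. The cosine part
    gives the limit of the chord moments, hence a finite second moment by Fatou; only then is the
    sine part dominated and its limit the mean. *)
Lemma moments_of_expansion (Y : T -> R) (m q : R) (eps : nat -> R) :
  measurable_fun setT Y -> 0 <= q -> eps n @[n --> \oo] --> 0 ->
  (forall n, `|\int[P]_w cos (n.+1%:R^-1 * Y w) -
     expR (- (q / 2 * n.+1%:R^-1 ^+ 2)) * cos (n.+1%:R^-1 * m)| <=
     n.+1%:R^-1 ^+ 2 * eps n) ->
  (forall n, `|\int[P]_w sin (n.+1%:R^-1 * Y w) -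
     expR (- (q / 2 * n.+1%:R^-1 ^+ 2)) * sin (n.+1%:R^-1 * m)| <=
     n.+1%:R^-1 ^+ 2 * eps n) ->
  [/\ P.-integrable setT (EFin \o (fun w => Y w ^+ 2)),
      \int[P]_w Y w = m & \int[P]_w (Y w ^+ 2) = q + m ^+ 2].
Proof.
move=> mY q0 eps0 cosY sinY.
pose h (n : nat) : R := n.+1%:R^-1.
have h0 n : 0 < h n by rewrite invr_gt0 ltr0n.
have h1 n : h n <= 1 by rewrite invf_le1 ?ler1n ?ltr0n.
have hn n : n.+1%:R = (h n)^-1 by rewrite invrK.
have hcvg : h n @[n --> \oo] --> 0 by exact: cvg_harmonic.
(* With [s = q / 2 * h^2] and [x = h * m], the error in [onem_expRcos] multiplied by [2 / h^2]
   equals [K * h^2], which is at most [K * h]. *)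
pose K := q ^+ 2 / 2 + m ^+ 4 + q * m ^+ 2 / 2.
have chord n : `|\int[P]_w chord_sqr n (Y w) - (q + m ^+ 2)| <= 2 * eps n + K * h n.
  rewrite prob_Rintegral_chord// [X in 2 * X ^+ 2]hn.
  have := cosY n; rewrite -/(h n).
  move: (\int[P]_w cos _) => I hI.
  have sq0 : 0 <= q / 2 * h n ^+ 2 by apply: mulr_ge0 (sqr_ge0 _); exact: divr_ge0.
  have := onem_expRcos (h n * m) sq0; move: (expR _ * cos _) hI => E hI hE.
  have h20 : 0 < h n ^+ 2 by rewrite exprn_gt0.
  have -> : 2 * (h n)^-1 ^+ 2 * (1 - I) - (q + m ^+ 2) =
    2 * (h n)^-1 ^+ 2 * (- (I - E)) + 2 * (h n)^-1 ^+ 2 *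
      (1 - E - (q / 2 * h n ^+ 2 + (h n * m) ^+ 2 / 2)).
    by field; rewrite gt_eqF.
  have c0 : 0 <= 2 * (h n)^-1 ^+ 2 by apply: mulr_ge0 (sqr_ge0 _).
  apply: le_trans (ler_normD _ _) _.
  rewrite !(normrM (2 * (h n)^-1 ^+ 2)) normrN (ger0_norm c0).
  apply: lerD.
    apply: le_trans (ler_wpM2l c0 hI) _.
    by rewrite le_eqVlt; apply/orP; left; apply/eqP; field; rewrite gt_eqF.
  apply: le_trans (ler_wpM2l c0 hE) _.
  rewrite [leLHS](_ : _ = K * h n * h n); last by rewrite /K; field; rewrite gt_eqF.
  rewrite ler_piMr// mulr_ge0 ?(ltW (h0 n))// /K.
  have m40 : 0 <= m ^+ 4 by rewrite exprn_even_ge0.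
  have q20 : 0 <= q ^+ 2 / 2 by rewrite divr_ge0 ?sqr_ge0.
  have qm0 : 0 <= q * m ^+ 2 / 2 by apply: divr_ge0 => //; exact: mulr_ge0 q0 (sqr_ge0 _).
  by rewrite !addr_ge0.
have bnd0 : 2 * eps n + K * h n @[n --> \oo] --> 0.
  rewrite -[X in _ --> X]addr0; apply: cvgD.
    by rewrite -[X in _ --> X](mulr0 2); exact: cvgMr.
  by rewrite -[X in _ --> X](mulr0 K); exact: cvgMr.
have chordcvg : \int[P]_w chord_sqr n (Y w) @[n --> \oo] --> q + m ^+ 2.
  apply/subr_cvg0/norm_cvg0P; apply: (squeeze_cvgr _ (cvg_cst 0) bnd0).
  by near=> n; rewrite normr_ge0 chord.
have iY : P.-integrable setT (EFin \o (fun w => Y w ^+ 2)).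
  apply: (@integrable_sqr_fin P Y (q + m ^+ 2)) => //.
  apply: fatou_second_moment chordcvg => // n.
  by rewrite integral_chordE.
split=> //; last exact: cvg_unique (cvg_chord_moment mY iY) chordcvg.
apply: cvg_unique (cvg_sin_moment mY iY) _ => //.
pose K' := `|m| ^+ 3 / 2 + q / 2 * `|m|.
have bnd1 : eps n + K' * h n @[n --> \oo] --> 0.
  rewrite -[X in _ --> X]addr0; apply: cvgD => //.
  by rewrite -[X in _ --> X](mulr0 K'); exact: cvgMr.
apply/subr_cvg0/norm_cvg0P; apply: (squeeze_cvgr _ (cvg_cst 0) bnd1).
near=> n; rewrite normr_ge0/= RintegralZl//; last first.
  apply: (@prob_integrable_bounded _ _ _ P _ 1) => [|x]; last exact: norm_sin_le1.
  exact: measurable_sinM.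
rewrite [X in `|X * _ - m|]hn; have := sinY n; rewrite -/(h n).
move: (\int[P]_w sin _) => I hI.
have sq0 : 0 <= q / 2 * h n ^+ 2 by apply: mulr_ge0 (sqr_ge0 _); exact: divr_ge0.
have := expRsin_near (h n * m) sq0; move: (expR _ * sin _) hI => E hI hE.
have -> : (h n)^-1 * I - m = (h n)^-1 * (I - E) + (h n)^-1 * (E - h n * m).
  by field; rewrite gt_eqF.
apply: le_trans (ler_normD _ _) _; rewrite !normrM.
have c0 : 0 <= (h n)^-1 by rewrite invr_ge0 ltW.
rewrite (ger0_norm c0); apply: lerD.
  apply: le_trans (ler_wpM2l c0 hI) _.
  rewrite [leLHS](_ : _ = h n * eps n); last by field; rewrite gt_eqF.
  rewrite ler_piMl//.
  have := le_trans (normr_ge0 _) (cosY n); rewrite -/(h n) pmulr_rge0//.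
  by rewrite exprn_gt0.
apply: le_trans (ler_wpM2l c0 hE) _.
rewrite normrM (gtr0_norm (h0 n)).
rewrite [leLHS](_ : _ = K' * h n * h n); last by rewrite /K'; field; rewrite gt_eqF.
rewrite ler_piMr// mulr_ge0 ?(ltW (h0 n))// /K'.
by rewrite addr_ge0 ?divr_ge0 ?mulr_ge0 ?exprn_ge0 ?divr_ge0.
Unshelve. all: end_near. Qed.

End moments_from_characteristic_function.

(** * Independence *)

Section bounded_measurable.
Context {d} {T : measurableType d} {R : realType}.
Implicit Types f g : T -> R.

Definition bounded_measurable f :=
  measurable_fun setT f /\ exists M : R, forall x, `|f x| <= M.

Lemma bounded_measurable_cst a : bounded_measurable (fun=> a).
Proof. by split=> //; exists `|a|. Qed.

Lemma bounded_measurable_indic (B : set T) : measurable B ->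
  bounded_measurable (\1_B : T -> R).
Proof.
move=> mB; split=> //; exists 1 => x.
by rewrite indicE; case: (_ \in _); rewrite ?normr0 ?normr1.
Qed.

Lemma bounded_measurableD f g : bounded_measurable f -> bounded_measurable g ->
  bounded_measurable (fun x => f x + g x).
Proof.
move=> [mf [M fM]] [mg [N gN]]; split; first exact: measurable_funD.
by exists (M + N) => x; rewrite (le_trans (ler_normD _ _))// lerD.
Qed.

Lemma bounded_measurableM f g : bounded_measurable f -> bounded_measurable g ->
  bounded_measurable (fun x => f x * g x).
Proof.
move=> [mf [M fM]] [mg [N gN]]; split; first exact: measurable_funM.
by exists (M * N) => x; rewrite normrM ler_pM.
Qed.

Lemma bounded_measurable_prod (I : finType) (Q : pred I) (f : I -> T -> R) :
  (forall i, bounded_measurable (f i)) ->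
  bounded_measurable (fun x => \prod_(i | Q i) f i x).
Proof.
move=> hf; elim: (index_enum I) => [|i s ih].
  under eq_fun do rewrite big_nil.
  exact: bounded_measurable_cst.
under eq_fun do rewrite big_cons.
by case: (Q i) => //; exact: bounded_measurableM.
Qed.

Lemma bounded_measurable_cos f : measurable_fun setT f ->
  bounded_measurable (fun x => cos (f x)).
Proof.
move=> mf; split; last by exists 1 => x; exact: norm_cos_le1.
by apply: measurableT_comp mf; apply: continuous_measurable_fun; exact: continuous_cos.
Qed.

Lemma bounded_measurable_sin f : measurable_fun setT f ->
  bounded_measurable (fun x => sin (f x)).
Proof.
move=> mf; split; last by exists 1 => x; exact: norm_sin_le1.
by apply: measurableT_comp mf; apply: continuous_measurable_fun; exact: continuous_sin.
Qed.

Lemma bounded_measurable_integrable (P : probability T R) f :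
  bounded_measurable f -> P.-integrable setT (EFin \o f).
Proof. by move=> [mf [M fM]]; exact: prob_integrable_bounded fM. Qed.

End bounded_measurable.

Section bounded_measurable_induction.
Context {R : realType}.
Implicit Types (u v h : R -> R).

Let sum_ltn K m : (m <= K)%N -> \sum_(j < K) (if (j < m)%N then 1 else 0) = m%:R :> R.
Proof.
by move=> mK; rewrite -big_mkcond -(big_ord_widen K (fun=> 1))// sumr_const card_ord.
Qed.

(** A functional monotone class principle; it lifts the product formula of independence from sets to
    bounded measurable functions. *)
Lemma bounded_measurable_ind (Q : (R -> R) -> Prop) :
  (forall B, measurable B -> Q \1_B) ->
  (forall a u v, Q u -> Q v -> Q (fun x => a * u x + v x)) ->
  (forall (s : nat -> R -> R) h (M : R), (forall n, Q (s n)) -> measurable_fun setT h ->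
     (forall n x, `|s n x| <= M) -> (forall x, s n x @[n --> \oo] --> h x) -> Q h) ->
  forall h, bounded_measurable h -> Q h.
Proof.
move=> Qi Ql Qc.
have Q0 : Q (fun=> 0).
  by rewrite (_ : (fun=> 0) = \1_set0); [exact: Qi|apply/funext => x; rewrite indic0].
have Q1 : Q (fun=> 1).
  by rewrite (_ : (fun=> 1) = \1_setT); [exact: Qi|apply/funext => x; rewrite indicT].
have QZ a u : Q u -> Q (fun x => a * u x).
  move=> Qu; rewrite (_ : (fun x => _) = (fun x => a * u x + 0)); first exact: Ql.
  by apply/funext => x; rewrite addr0.
have Qsum (K : nat) (F : nat -> R -> R) : (forall j, Q (F j)) ->
    Q (fun x => \sum_(j < K) F j x).
  move=> QF; elim: K => [|K ih].
    by under eq_fun do rewrite big_ord0.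
  rewrite (_ : (fun x => _) = (fun x => 1 * (\sum_(j < K) F j x) + F K x)).
    exact: Ql.
  by apply/funext => x; rewrite big_ord_recr mul1r.
(* [s n] rounds [h] down to a multiple of 1/(n+1): it counts the j >= 1 with
   j/(n+1) <= h. *)
have pos h (M : R) : measurable_fun setT h -> (forall x, 0 <= h x <= M) -> Q h.
  move=> mh hM.
  pose B n j : set R := [set x | j.+1%:R <= n.+1%:R * h x].
  have mB n j : measurable (B n j).
    have -> : B n j = (fun x => n.+1%:R * h x) @^-1` `[j.+1%:R, +oo[.
      by apply/seteqP; split=> x; rewrite /B /= in_itv/= andbT.
    by rewrite -[X in measurable X]setTI; apply: measurable_Ml.
  pose K n := Num.truncn (n.+1%:R * M).
  pose s n x : R := n.+1%:R^-1 * \sum_(j < K n) \1_(B n j) x.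
  have sE n x : s n x = n.+1%:R^-1 * (Num.truncn (n.+1%:R * h x))%:R.
    have /andP[h0 hxM] := hM x.
    rewrite /s; congr (_ * _); rewrite -(@sum_ltn (K n) (Num.truncn (n.+1%:R * h x))); last first.
      by apply: le_truncn; rewrite ler_wpM2l.
    apply: eq_bigr => j _; rewrite indicE.
    rewrite [in RHS]truncn_ge_nat ?mulr_ge0//.
    rewrite (_ : (x \in B n j) = (j.+1%:R <= n.+1%:R * h x)); first by case: ifP.
    by apply/idP/idP; rewrite inE.
  have snear n x : 0 <= h x - s n x <= n.+1%:R^-1.
    have /andP[h0 hxM] := hM x.
    have n0 : 0 < n.+1%:R :> R by rewrite ltr0n.
    have hx0 : 0 <= n.+1%:R * h x by rewrite mulr_ge0.
    have := truncn_itv hx0; rewrite sE => /andP[t1 t2].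
    have -> : h x - n.+1%:R^-1 * (Num.truncn (n.+1%:R * h x))%:R =
       n.+1%:R^-1 * (n.+1%:R * h x - (Num.truncn (n.+1%:R * h x))%:R).
      by rewrite mulrBr mulKf ?gt_eqF.
    rewrite mulr_ge0 ?invr_ge0 ?subr_ge0//=.
    by rewrite ler_piMr ?invr_ge0// lerBlDr addrC natr1 ltW.
  apply: (Qc s h M) => //.
  - move=> n; apply: (QZ _ (fun x => \sum_(j < K n) \1_(B n j) x)).
    by apply: (Qsum (K n) (fun j => \1_(B n j))) => j; exact: Qi.
  - move=> n x; have /andP[h0 hxM] := hM x; have /andP[s1 s2] := snear n x.
    rewrite ger0_norm; last by rewrite sE mulr_ge0.
    by apply: le_trans hxM; rewrite -subr_ge0.
  - move=> x; apply/subr_cvg0/norm_cvg0P.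
    apply: (squeeze_cvgr _ (cvg_cst 0) (@cvg_harmonic R)).
    near=> n; rewrite normr_ge0/= distrC.
    by have /andP[s1 s2] := snear n x; rewrite ger0_norm.
move=> h [mh [M hM]].
have M0 : 0 <= M by exact: le_trans (hM 0).
rewrite (_ : h = (fun x => (- M) * 1 + (h x + M))).
  apply: Ql => //; apply: (pos _ (M + M)).
    exact: measurable_funD.
  by move=> x; have := hM x; rewrite ler_norml => /andP[h1 h2]; apply/andP; split; lra.
by apply/funext => x; rewrite mulr1 addrCA addNr addr0.
Unshelve. all: end_near. Qed.

End bounded_measurable_induction.

Section independent_products.
Context {d} {T : measurableType d} {R : realType} (P : probability T R).
Variables (n : nat) (X : 'I_n -> {RV P >-> R}).
Hypothesis hX : independent_RVs X.

Let comp_bm i (u : R -> R) : bounded_measurable u ->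
  bounded_measurable (fun w => u (X i w)).
Proof.
by move=> [mu [M uM]]; split; [exact: measurableT_comp|exists M => w; exact: uM].
Qed.

Lemma independent_prod (h : 'I_n -> R -> R) :
  (forall i, bounded_measurable (h i)) ->
  \int[P]_w \prod_(i < n) h i (X i w) = \prod_(i < n) \int[P]_w h i (X i w).
Proof.
(* Factors of index at least [l] are indicators. For [l = 0] this is the definition of independence;
   each step frees one more factor, by induction over bounded measurable functions in that
   factor. *)
suff claim l : forall h : 'I_n -> R -> R, (forall i, bounded_measurable (h i)) ->
    (forall i : 'I_n, (l <= i)%N -> exists2 B, measurable B & h i = \1_B) ->
    \int[P]_w \prod_(i < n) h i (X i w) = \prod_(i < n) \int[P]_w h i (X i w).
  by move=> bh; apply: (claim n) => // i; rewrite leqNgt ltn_ord.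
elim: l => {h} [h bh hB|l ih h bh hB].
  have B i : {B | measurable B & h i = \1_B} by apply/cid2/hB.
  pose C i := s2val (B i).
  have mC i : measurable (C i) by exact: s2valP (B i).
  have hE i : h i = \1_(C i) by exact: s2valP' (B i).
  have iC i : \int[P]_w h i (X i w) = fine (P (X i @^-1` C i)).
    have mXC : measurable (X i @^-1` C i).
      by rewrite -[X in measurable X]setTI; exact: measurable_funP.
    by rewrite hE /Rintegral (integral_indic P measurableT mXC) setIT.
  under [RHS]eq_bigr do rewrite iC.
  have -> : \prod_(i < n) fine (P (X i @^-1` C i)) =
      fine (P (\bigcap_(i in [set: 'I_n]) X i @^-1` C i)).
    rewrite hX//.
    suff -> : (\prod_(i < n) P (X i @^-1` C i))%E =
      (\prod_(i < n) fine (P (X i @^-1` C i)))%:E by [].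
    elim/big_rec2 : _ => // i y x _ ->.
    rewrite EFinM fineK// fin_num_measure//.
    by rewrite -[X in measurable X]setTI; exact: measurable_funP.
  have mcap : measurable (\bigcap_(i in [set: 'I_n]) X i @^-1` C i).
    apply: fin_bigcap_measurable => // i _.
    by rewrite -[X in measurable X]setTI; exact: measurable_funP.
  have := integral_indic P measurableT mcap; rewrite setIT => <-.
  congr fine; apply: eq_integral => w _; congr EFin.
  rewrite indicE; have [|] := boolP (w \in _).
    rewrite inE => wC; apply: big1 => i _.
    by rewrite hE indicE mem_set//; exact: wC.
  rewrite notin_setE => /existsNP[i /not_implyP[_ wC]].
  by rewrite (bigD1 i)//= hE indicE memNset// mul0r.
have [ln|nl] := ltnP l n; last first.
  by apply: ih => // i li; have := leq_trans nl li; rewrite leqNgt ltn_ord.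
pose k := Ordinal ln.
pose upd (u : R -> R) i := if i == k then u else h i.
pose G w := \prod_(i < n | i != k) h i (X i w).
pose g := \prod_(i < n | i != k) \int[P]_w h i (X i w).
have bG : bounded_measurable G by apply: bounded_measurable_prod => i; exact: comp_bm.
(* Isolating the factor [k] turns the product formula into an identity linear in [u], hence stable
   under the operations of [bounded_measurable_ind]. *)
have updE u : (\int[P]_w \prod_(i < n) upd u i (X i w) =
    \prod_(i < n) \int[P]_w upd u i (X i w)) <->
    (\int[P]_w (u (X k w) * G w) = (\int[P]_w u (X k w)) * g).
  have -> : (fun w => \prod_(i < n) upd u i (X i w)) = (fun w => u (X k w) * G w).
    apply/funext => w; rewrite (bigD1 k)//= /upd eqxx; congr (_ * _).
    by apply: eq_bigr => i /negbTE ->.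
  suff -> : \prod_(i < n) \int[P]_w upd u i (X i w) = \int[P]_w u (X k w) * g by [].
  rewrite (bigD1 k)//=; congr (_ * _); first by rewrite /upd eqxx.
  by apply: eq_bigr => i /negbTE ik; rewrite /upd ik.
have -> : h = upd (h k) by apply/funext => i; rewrite /upd; case: eqP => [->|].
apply/updE.
have ik u : bounded_measurable u -> bounded_measurable (fun w => u (X k w) * G w).
  by move=> bu; apply: bounded_measurableM => //; exact: comp_bm.
pose Q u := bounded_measurable u /\
  \int[P]_w (u (X k w) * G w) = \int[P]_w u (X k w) * g.
suff : Q (h k) by case.
apply: bounded_measurable_ind => //.
- move=> B mB; split; first exact: bounded_measurable_indic.
  apply/updE/ih => [i|i li]; rewrite /upd.
    by case: eqP => // _; exact: bounded_measurable_indic.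
  case: eqP => [_|/eqP ik']; first by exists B.
  apply: hB; rewrite ltn_neqAle li andbT; apply: contra ik' => /eqP lE.
  by apply/eqP/val_inj.
- move=> a u v [bu hu] [bv hv]; split.
    exact: bounded_measurableD (bounded_measurableM (bounded_measurable_cst a) bu) bv.
  have iu := bounded_measurable_integrable P (ik _ bu).
  have iv := bounded_measurable_integrable P (ik _ bv).
  have iu' := bounded_measurable_integrable P (comp_bm k bu).
  have iv' := bounded_measurable_integrable P (comp_bm k bv).
  under eq_Rintegral do rewrite mulrDl -mulrA.
  rewrite RintegralD//; last exact: integrableRZ.
  rewrite RintegralZl// RintegralD//; last exact: integrableRZ.
  by rewrite RintegralZl// hu hv mulrDl mulrA.
- move=> s u M Qs mu sM su.
  have uM x : `|u x| <= M.
    have su' : `|s m x| @[m --> \oo] --> `|u x| by exact: cvg_norm (su x).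
    rewrite -(cvg_lim _ su')//.
    by apply: limr_le; [apply/cvg_ex; exists (`|u x|) | apply: nearW => m; exact: sM].
  have bu : bounded_measurable u by split=> //; exists M.
  split=> //; case: (bG) => mG [N GN].
  have M0 : 0 <= M by exact: le_trans (uM 0).
  have l1 : \int[P]_w (s m (X k w) * G w) @[m --> \oo] --> \int[P]_w (u (X k w) * G w).
    apply: (@Rintegral_dominated_cvg _ _ _ P (fun m w => s m (X k w) * G w) _ (fun=> M * N)).
    - by move=> m; have [/ik[]] := Qs m.
    - by have [] := ik _ bu.
    - by apply: aeW => w; apply: cvgM; [exact: su|exact: cvg_cst].
    - exact/bounded_measurable_integrable/bounded_measurable_cst.
    - by apply: aeW => w m; rewrite normrM ler_pM.
  have l2 : \int[P]_w (s m (X k w)) @[m --> \oo] --> \int[P]_w u (X k w).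
    apply: (@Rintegral_dominated_cvg _ _ _ P (fun m w => s m (X k w)) _ (fun=> M)).
    - by move=> m; have [/(comp_bm k)[]] := Qs m.
    - by have [] := comp_bm k bu.
    - by apply: aeW => w; exact: su.
    - exact/bounded_measurable_integrable/bounded_measurable_cst.
    - by apply: aeW => w m; exact: sM.
  apply: cvg_unique l1 _ => //.
  rewrite (_ : (fun m => _) = (fun m => \int[P]_w (s m (X k w)) * g)).
    by apply: cvgM => //; exact: cvg_cst.
  by apply/funext => m; have [] := Qs m.
Qed.

(** The characteristic function of an independent sum is a product, here on real and imaginary
    parts. The addition formulas mix cosine and sine, so the two identities are proved jointly. *)
Lemma independent_sum_cos_sin (y a b : 'I_n -> R) :
  (forall i, \int[P]_w cos (y i * X i w) = expR (a i) * cos (b i)) ->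
  (forall i, \int[P]_w sin (y i * X i w) = expR (a i) * sin (b i)) ->
  \int[P]_w cos (\sum_(i < n) y i * X i w) = expR (\sum_i a i) * cos (\sum_i b i) /\
  \int[P]_w sin (\sum_(i < n) y i * X i w) = expR (\sum_i a i) * sin (\sum_i b i).
Proof.
move=> hc hs.
pose S k w := \sum_(i < n | (i < k)%N) y i * X i w.
pose A k := \sum_(i < n | (i < k)%N) a i.
pose B k := \sum_(i < n | (i < k)%N) b i.
pose Pi k (h : 'I_n -> R -> R) w := \prod_(i < n | (k <= i)%N) h i (X i w).
pose pi k (h : 'I_n -> R -> R) := \prod_(i < n | (k <= i)%N) \int[P]_w h i (X i w).
have mS k : measurable_fun setT (S k).
  rewrite /S; elim: (index_enum _) => [|i s ih].
    by under eq_fun do rewrite big_nil; exact: measurable_cst.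
  under eq_fun do rewrite big_cons; case: (i < k)%N => //.
  by apply: measurable_funD => //; exact: measurable_Ml.
have bPi k h : (forall i, bounded_measurable (h i)) -> bounded_measurable (Pi k h).
  by move=> bh; apply: bounded_measurable_prod => i; exact: comp_bm.
(* The first [k] variables are already in the sum, and the others enter through arbitrary factors
   [h]; the induction step takes the cosine or sine of the variable [k] as such a factor. *)
have claim k : (k <= n)%N -> forall h, (forall i, bounded_measurable (h i)) ->
    \int[P]_w (cos (S k w) * Pi k h w) = expR (A k) * cos (B k) * pi k h /\
    \int[P]_w (sin (S k w) * Pi k h w) = expR (A k) * sin (B k) * pi k h.
  elim: k => [_ h bh|k ih kn h bh].
    rewrite /S /A /B !big_pred0// expR0 cos0 sin0 mulr0 !mul1r mul0r.
    have E : \int[P]_w Pi 0%N h w = pi 0%N h by exact: independent_prod.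
    split; first by rewrite -E; apply: eq_Rintegral => w _; rewrite big_pred0// cos0 mul1r.
    rewrite -[RHS](prob_Rintegral_cst P); apply: eq_Rintegral => w _.
    by rewrite big_pred0// sin0 mul0r.
  pose q := Ordinal kn.
  pose upd (u : R -> R) i := if i == q then u else h i.
  have split_sum (F : 'I_n -> R) : \sum_(i < n | (i < k.+1)%N) F i =
      \sum_(i < n | (i < k)%N) F i + F q.
    rewrite (bigD1 q)//= addrC; congr (_ + _); apply: eq_bigl => i.
    by rewrite ltnS [RHS]ltn_neqAle andbC.
  have split_prod (F : 'I_n -> R) : \prod_(i < n | (k <= i)%N) F i =
      F q * \prod_(i < n | (k.+1 <= i)%N) F i.
    rewrite (bigD1 q)//=; congr (_ * _); apply: eq_bigl => i.
    by rewrite [RHS]ltn_neqAle andbC eq_sym.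
  have updq (F : 'I_n -> (R -> R) -> R) u :
      \prod_(i < n | (k.+1 <= i)%N) F i (upd u i) = \prod_(i < n | (k.+1 <= i)%N) F i (h i).
    apply: eq_bigr => i ki; rewrite /upd ifF//; apply/negbTE.
    by apply: contraTN ki => /eqP ->; rewrite ltnn.
  have bupd u : bounded_measurable u -> forall i, bounded_measurable (upd u i).
    by move=> bu i; rewrite /upd; case: ifP.
  have bc : bounded_measurable (fun x => cos (y q * x)).
    by apply: bounded_measurable_cos; exact: measurable_Ml.
  have bs : bounded_measurable (fun x => sin (y q * x)).
    by apply: bounded_measurable_sin; exact: measurable_Ml.
  have PiE u w : Pi k (upd u) w = u (X q w) * Pi k.+1 h w.
    by rewrite /Pi split_prod {1}/upd eqxx (updq (fun i v => v (X i w))).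
  have piE u : pi k (upd u) = \int[P]_w u (X q w) * pi k.+1 h.
    by rewrite /pi split_prod {1}/upd eqxx (updq (fun i v => \int[P]_w v (X i w))).
  have SE w : S k.+1 w = S k w + y q * X q w by rewrite /S split_sum.
  have [ihcc ihcs] := ih (ltnW kn) _ (bupd _ bc).
  have [ihsc ihss] := ih (ltnW kn) _ (bupd _ bs).
  have int F u : bounded_measurable F -> bounded_measurable u ->
      P.-integrable setT (EFin \o (fun w => F w * Pi k (upd u) w)).
    move=> bF bu; apply: bounded_measurable_integrable; apply: bounded_measurableM => //.
    by apply: bPi; exact: bupd.
  have bcS := bounded_measurable_cos (mS k); have bsS := bounded_measurable_sin (mS k).
  rewrite /A /B !split_sum -/(A k) -/(B k) expRD cosD sinD.
  split.
    rewrite [LHS](_ : _ = \int[P]_w (cos (S k w) * Pi k (upd (fun x => cos (y q * x))) w -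
        sin (S k w) * Pi k (upd (fun x => sin (y q * x))) w)).
      rewrite RintegralB//; [|exact: int|exact: int].
      by rewrite ihcc ihss !piE hc hs; ring.
    by apply: eq_Rintegral => w _; rewrite SE cosD !PiE; ring.
  rewrite [LHS](_ : _ = \int[P]_w (sin (S k w) * Pi k (upd (fun x => cos (y q * x))) w +
      cos (S k w) * Pi k (upd (fun x => sin (y q * x))) w)).
    rewrite RintegralD//; [|exact: int|exact: int].
    by rewrite ihcs ihsc !piE hc hs; ring.
  by apply: eq_Rintegral => w _; rewrite SE sinD !PiE; ring.
have [] := claim n (leqnn n) (fun=> fun=> 1) (fun=> bounded_measurable_cst 1).
have SnE (F : 'I_n -> R) : \sum_(i < n | (i < n)%N) F i = \sum_(i < n) F i.
  by apply: eq_bigl => i; rewrite ltn_ord.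
have -> : pi n (fun=> fun=> 1) = 1.
  by rewrite /pi big_pred0// => i; rewrite leqNgt ltn_ord.
have Pin w : Pi n (fun=> fun=> 1) w = 1.
  by rewrite /Pi big_pred0// => i; rewrite leqNgt ltn_ord.
rewrite !mulr1 /A /B !SnE => <- <-; split; apply: eq_Rintegral => w _;
  by rewrite Pin mulr1 /S SnE.
Qed.

End independent_products.

(** * The Levy exponent *)

Section levy_exponent_expansion.
Context {R : realType}.
Variables (a gamma : R) (nu : {measure set R -> \bar R}).
Hypothesis a0 : 0 <= a.
Hypothesis hnu : levy_measure nu.

Definition levy_re z := - (2^-1 * a * z ^+ 2) + \int[nu]_x (cos (x * z) - 1).
Definition levy_im z :=
  gamma * z + \int[nu]_x (sin (x * z) - x * z * \1_`[-1, 1]%classic x).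

Lemma levy_exponentE z :
  levy_exponent gamma a nu z = (levy_re z +i* levy_im z)%C.
Proof.
rewrite /levy_exponent /Cintegral /levy_re /levy_im.
have -> : (\int[nu]_x complex.Re (expC ('i%C * (x * z)%:C%C) - 1 -
    'i%C * (x * z * \1_`[-1, 1]%classic x)%:C%C)) = \int[nu]_x (cos (x * z) - 1).
  apply: eq_Rintegral => x _ /=.
  by rewrite !(mul0r, mul1r, mulr0, subr0, addr0, add0r, oppr0) expR0 mul1r.
have -> : (\int[nu]_x complex.Im (expC ('i%C * (x * z)%:C%C) - 1 -
    'i%C * (x * z * \1_`[-1, 1]%classic x)%:C%C)) =
    \int[nu]_x (sin (x * z) - x * z * \1_`[-1, 1]%classic x).
  apply: eq_Rintegral => x _ /=.
  by rewrite !(mul0r, mul1r, mulr0, subr0, addr0, add0r, oppr0) expR0 mul1r.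
apply/eqP; rewrite eq_complex /=.
by rewrite !(mul0r, mul1r, mulr0, subr0, addr0, add0r, oppr0) !eqxx.
Qed.

Let imin : nu.-integrable setT (EFin \o (fun x : R => Num.min 1 (x ^+ 2))).
Proof.
apply/integrableP; split.
  by apply/measurable_EFinP; apply: measurable_minr => //; exact: measurable_funX.
rewrite (eq_integral (fun x : R => (Num.min 1 (x ^+ 2))%:E)); first exact: hnu.2.
by move=> x _; rewrite /= ger0_norm// le_min ler01 sqr_ge0.
Qed.

Let mcos z : measurable_fun setT (fun x : R => cos (x * z)).
Proof.
rewrite (_ : (fun x => _) = (fun x => cos (z * x))).
  exact: measurable_cosM.
by apply/funext => x; rewrite mulrC.
Qed.

Let msin z : measurable_fun setT (fun x : R => sin (x * z)).
Proof.
rewrite (_ : (fun x => _) = (fun x => sin (z * x))).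
  exact: measurable_sinM.
by apply/funext => x; rewrite mulrC.
Qed.

Let icos z : nu.-integrable setT (EFin \o (fun x : R => cos (x * z) - 1)).
Proof.
apply: integrable_dominated (integrableRZ (2 + z ^+ 2) imin) _.
  exact: measurable_funB.
move=> x; rewrite distrC ger0_norm ?onem_cos_ge0//.
have min0 : 0 <= Num.min 1 (x ^+ 2) by rewrite le_min ler01 sqr_ge0.
rewrite [leRHS]ger0_norm; last by rewrite mulr_ge0// addr_ge0 ?sqr_ge0.
have h1 : 1 - cos (x * z) <= 2 by have := cos_geN1 (x * z); lra.
have h2 := onem_cos_le (x * z); have z20 := sqr_ge0 z; have x20 := sqr_ge0 x.
rewrite exprMn in h2.
by rewrite /Num.min; case: ifPn => _; nra.
Qed.

Lemma levy_re_le0 z : levy_re z <= 0.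
Proof.
have a1 : 0 <= 2^-1 * a * z ^+ 2 by apply: mulr_ge0 (sqr_ge0 _); exact: mulr_ge0.
suff I0 : \int[nu]_x (cos (x * z) - 1) <= 0 by rewrite /levy_re; lra.
have E : \int[nu]_x (-1 * (cos (x * z) - 1)) = - \int[nu]_x (cos (x * z) - 1).
  by rewrite (RintegralZl (-1) measurableT (icos z)) mulN1r.
rewrite -oppr_ge0 -E.
by apply: Rintegral_ge0 => x _; have := cos_le1 (x * z); lra.
Qed.

Section second_moment.
Context {d} {T : measurableType d} (P : probability T R).
Variable Y : T -> R.
Hypothesis mY : measurable_fun setT Y.
Hypothesis iY : P.-integrable setT (EFin \o (fun w => Y w ^+ 2)).
Hypothesis cosY : forall z, \int[P]_w cos (z * Y w) = expR (levy_re z) * cos (levy_im z).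

(** Chord moments of [Y] bound [1 - expR (levy_re z)], hence [- levy_re z] for small [z], hence the
    chord moments of [nu]; Fatou then gives the second moment of [nu]. *)
Lemma levy_measure_second_moment : nu.-integrable setT (EFin \o (fun x : R => x ^+ 2)).
Proof.
pose M := \int[P]_w (Y w ^+ 2).
have M0 : 0 <= M by apply: Rintegral_ge0 => w _; exact: sqr_ge0.
have ich n : nu.-integrable setT (EFin \o chord_sqr n).
  have := integrableRZ (- (2 * n.+1%:R ^+ 2)) (icos n.+1%:R^-1).
  congr (nu.-integrable _ _); apply/funext => x; congr EFin.
  by rewrite /chord_sqr (mulrC x) mulNr -mulrN opprB.
have chordE n : \int[nu]_x chord_sqr n x =
    - (2 * n.+1%:R ^+ 2) * \int[nu]_x (cos (x * n.+1%:R^-1) - 1).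
  rewrite -(RintegralZl (- (2 * n.+1%:R ^+ 2)) measurableT (icos n.+1%:R^-1)).
  by apply: eq_Rintegral => x _; rewrite /chord_sqr (mulrC x) mulNr -mulrN opprB.
(* For such [n], [e = expR (levy_re (1 / N))] is at least 1/2, so [- levy_re (1 / N) <= (1 - e) / e
   <= 2 * (1 - e)]. *)
have small n : M <= n.+1%:R ^+ 2 -> \int[nu]_x chord_sqr n x <= 2 * M.
  move=> Mn; pose N : R := n.+1%:R; have N0 : 0 < N by rewrite ltr0n.
  have N20 : 0 < N ^+ 2 by rewrite exprn_gt0.
  have h1 : 2 * N ^+ 2 * (1 - expR (levy_re N^-1)) <= M.
    apply: (@le_trans _ _ (\int[P]_w chord_sqr n (Y w))); last first.
      apply: le_Rintegral => //; last by move=> w _; exact: chord_sqr_le.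
      apply: integrable_dominated iY _; first exact: measurable_chord_sqr.
      by move=> w; rewrite !ger0_norm ?sqr_ge0 ?chord_sqr_ge0 ?chord_sqr_le.
    rewrite prob_Rintegral_chord// cosY ler_pM2l ?mulr_gt0// lerB//.
    by rewrite ler_piMr ?expR_ge0 ?cos_le1.
  pose e := expR (levy_re N^-1).
  have e0 : 0 < e by exact: expR_gt0.
  have h2 : e * (1 - levy_re N^-1) <= 1.
    have := expR_ge1Dx (- levy_re N^-1); rewrite -(ler_pM2l e0) /e -expRD subrr expR0.
    by [].
  have h3 : \int[nu]_x chord_sqr n x <= - (2 * N ^+ 2) * levy_re N^-1.
    rewrite chordE -/N /levy_re mulrDr lerDr mulNr mulrN opprK.
    by rewrite !mulr_ge0 ?sqr_ge0 ?invr_ge0 ?(ltW N0)// ltW.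
  apply: le_trans h3 _; have := levy_re_le0 N^-1; move: h1 h2; rewrite -/e.
  move: (levy_re _) => r h1 h2 r0.
  have h4 : 2^-1 <= e by nra.
  have h5 : - r <= 2 * (1 - e) by nra.
  by nra.
(* The bound [2 * M] is available only for large [n]; the finitely many other terms are bounded by
   themselves, which leaves the limit unchanged. *)
pose u n := if M <= n.+1%:R ^+ 2 then 2 * M else \int[nu]_x chord_sqr n x.
apply: (@integrable_sqr_fin _ _ _ nu id (2 * M)) => //.
apply: (@fatou_second_moment _ _ _ nu id u (2 * M)) => //.
- move=> n; have -> : (\int[nu]_x (chord_sqr n x)%:E = (\int[nu]_x chord_sqr n x)%:E)%E.
    by rewrite /Rintegral fineK//; apply: integrable_fin_num => //; exact: ich.
  by rewrite lee_fin /u; case: ifPn => // /small.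
- apply: cvg_near_cst; exists (Num.truncn M) => // n /= nM; rewrite /u ifT//.
  have : M < n.+1%:R by rewrite (lt_le_trans (truncnS_gt _))// ler_nat.
  move/ltW/le_trans; apply; rewrite ler_eXnr// ler1n//.
Qed.

End second_moment.

Hypothesis isqr : nu.-integrable setT (EFin \o (fun x : R => x ^+ 2)).

(** Variance and mean per unit volume, that is [- psi''(0)] and [psi'(0) / i]. Jumps larger than 1
    enter the mean because the compensator leaves them out. *)
Definition levy_var := a + \int[nu]_x (x ^+ 2).
Definition levy_mean := gamma + \int[nu]_x (x * (1 - \1_`[-1, 1]%classic x)).

Lemma levy_var_ge0 : 0 <= levy_var.
Proof. by rewrite addr_ge0// Rintegral_ge0// => x _; exact: sqr_ge0. Qed.

Let r1 z := levy_re z + levy_var / 2 * z ^+ 2.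
Let r2 z := levy_im z - levy_mean * z.

Let irem1 z : nu.-integrable setT
  (EFin \o (fun x : R => cos (x * z) - 1 + (x * z) ^+ 2 / 2)).
Proof.
apply: integrable_dominated (integrableRZ (z ^+ 2) isqr) _.
  by apply: measurable_funD; [exact: measurable_funB|apply: measurable_funM => //; apply: measurable_funX; exact: measurable_funM].
move=> x; rewrite (ger0_norm (cosDsqr_ge0 _)).
rewrite (ger0_norm (mulr_ge0 (sqr_ge0 _) (sqr_ge0 _))).
by apply: le_trans (cosDsqr_le2 _) _; have := sqr_ge0 (x * z); rewrite exprMn mulrC; lra.
Qed.

Let irem2 z : nu.-integrable setT (EFin \o (fun x : R => sin (x * z) - x * z)).
Proof.
apply: integrable_dominated (integrableRZ (2 * z ^+ 2) isqr) _.
  by apply: measurable_funB => //; exact: measurable_funM.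
move=> x; apply: le_trans (norm_sinB_le2 _) _.
rewrite ger0_norm; last by apply: mulr_ge0 (sqr_ge0 _); exact: mulr_ge0 (sqr_ge0 _).
by rewrite exprMn [x ^+ 2 * _]mulrC mulrA.
Qed.

Let ibig : nu.-integrable setT (EFin \o (fun x : R => x * (1 - \1_`[-1, 1]%classic x))).
Proof.
apply: integrable_dominated isqr _.
  by apply: measurable_funM => //; apply: measurable_funB.
move=> x; rewrite [leRHS]ger0_norm ?sqr_ge0// indicE.
case: (boolP (x \in _)) => [_|]; first by rewrite subrr mulr0 normr0 sqr_ge0.
rewrite notin_setE /= in_itv/= => /negP.
rewrite -ler_norml -ltNge => x1; rewrite subr0 mulr1 -(real_normK (num_real x)).
by rewrite ler_eXnr// ltW.
Qed.

Let r1E z : r1 z = \int[nu]_x (cos (x * z) - 1 + (x * z) ^+ 2 / 2).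
Proof.
have i2 := integrableRZ (z ^+ 2 / 2) isqr.
rewrite [RHS](_ : _ = \int[nu]_x ((cos (x * z) - 1) + z ^+ 2 / 2 * x ^+ 2)); last first.
  by apply: eq_Rintegral => x _; rewrite exprMn; ring.
rewrite (RintegralD measurableT (icos z) i2).
rewrite (RintegralZl (z ^+ 2 / 2) measurableT isqr) /r1 /levy_re /levy_var.
by move: (\int[nu]_x (cos _ - 1)) (\int[nu]_x (x ^+ 2)) => I J; field.
Qed.

Let r2E z : r2 z = \int[nu]_x (sin (x * z) - x * z).
Proof.
rewrite /r2 /levy_im /levy_mean.
have -> : \int[nu]_x (sin (x * z) - x * z * \1_`[-1, 1]%classic x) =
   \int[nu]_x (sin (x * z) - x * z) +
   z * \int[nu]_x (x * (1 - \1_`[-1, 1]%classic x)).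
  rewrite -(RintegralZl z measurableT ibig).
  rewrite -(RintegralD measurableT (irem2 z) (integrableRZ z ibig)).
  by apply: eq_Rintegral => x _; ring.
by move: (\int[nu]_x (sin _ - _)) (\int[nu]_x (x * _)) => I J; ring.
Qed.

(* The remainders of the expansion of the exponent are o(z^2) at 0. *)
Let rho (t : R) := \int[nu]_x (2 * x ^+ 2 * Num.min 1 (t * `|x|)).

Let mrho t : measurable_fun setT (fun x : R => 2 * x ^+ 2 * Num.min 1 (t * `|x|)).
Proof.
apply: measurable_funM.
  by apply: measurable_funM => //; exact: measurable_funX.
by apply: measurable_minr => //; apply: measurable_funM => //; exact: normr_measurable.
Qed.

Let irho t : 0 <= t ->
  nu.-integrable setT (EFin \o (fun x : R => 2 * x ^+ 2 * Num.min 1 (t * `|x|))).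
Proof.
move=> t0; apply: integrable_dominated (integrableRZ 2 isqr) _ => // x.
have min0 : 0 <= Num.min 1 (t * `|x|) by rewrite le_min ler01 mulr_ge0.
have x20 : 0 <= 2 * x ^+ 2 by exact: mulr_ge0 (sqr_ge0 _).
rewrite (ger0_norm (mulr_ge0 x20 min0)) (ger0_norm x20).
by rewrite ler_piMr// ge_min lexx.
Qed.

Let rho_cvg0 : rho n.+1%:R^-1 @[n --> \oo] --> 0.
Proof.
have -> : 0 = \int[nu]_x (0 : R) by rewrite Rintegral_cst// mul0r.
apply: (@Rintegral_dominated_cvg _ _ _ nu
  (fun n x => 2 * x ^+ 2 * Num.min 1 (n.+1%:R^-1 * `|x|)) _ (fun x => 2 * x ^+ 2)) => //.
- apply: aeW => x; have K0 : 2 * x ^+ 2 * (`|x| * harmonic n) @[n --> \oo] --> 0.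
    rewrite -[X in _ --> X](mulr0 (2 * x ^+ 2)); apply: cvgMr.
    by rewrite -[X in _ --> X](mulr0 `|x|); apply: cvgMr; exact: cvg_harmonic.
  apply: (squeeze_cvgr _ (cvg_cst 0) K0); near=> n.
  have min0 : 0 <= Num.min 1 (n.+1%:R^-1 * `|x|) by rewrite le_min ler01 mulr_ge0.
  have x20 : 0 <= 2 * x ^+ 2 by exact: mulr_ge0 (sqr_ge0 _).
  rewrite (mulr_ge0 x20 min0)/= ler_wpM2l// ge_min /harmonic [n.+1%:R^-1 * _]mulrC.
  by rewrite lexx orbT.
- exact: integrableRZ.
- apply: aeW => x n.
  have min0 : 0 <= Num.min 1 (n.+1%:R^-1 * `|x|) by rewrite le_min ler01 mulr_ge0.
  have x20 : 0 <= 2 * x ^+ 2 by exact: mulr_ge0 (sqr_ge0 _).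
  by rewrite (ger0_norm (mulr_ge0 x20 min0)) ler_piMr// ge_min lexx.
Unshelve. all: end_near. Qed.

Let rho_bound (t z : R) : `|z| <= t -> `|r1 z| <= z ^+ 2 * rho t /\ `|r2 z| <= z ^+ 2 * rho t.
Proof.
move=> zt; have t0 : 0 <= t by exact: le_trans zt.
have bnd (x : R) : 0 <= 2 * x ^+ 2 by exact: mulr_ge0 (sqr_ge0 _).
have rhoE : z ^+ 2 * rho t = \int[nu]_x (z ^+ 2 * (2 * x ^+ 2 * Num.min 1 (t * `|x|))).
  by rewrite (RintegralZl (z ^+ 2) measurableT (irho t0)).
have zx (x : R) : `|x * z| <= t * `|x| by rewrite normrM mulrC ler_wpM2r.
(* The quadratic bound is always integrable and the cubic one is small for small [z]; their minimum
   is the integrand of [rho]. *)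
have key x (F : R) : 0 <= F -> F <= 2 * (x * z) ^+ 2 -> F <= 2 * (x * z) ^+ 2 * `|x * z| ->
    F <= z ^+ 2 * (2 * x ^+ 2 * Num.min 1 (t * `|x|)).
  move=> F0 F1 F2; have E : z ^+ 2 * (2 * x ^+ 2) = 2 * (x * z) ^+ 2 by ring.
  rewrite mulrA E; rewrite /Num.min; case: ifPn => _; first by rewrite mulr1.
  apply: le_trans F2 _; apply: ler_wpM2l (zx x).
  by rewrite -E; exact: mulr_ge0 (sqr_ge0 _) (bnd x).
rewrite r1E r2E rhoE; split.
  apply: le_trans (le_normr_Rintegral measurableT (irem1 z)) _.
  apply: le_Rintegral => //; [exact: integrable_norm (irem1 z)|exact: integrableRZ (irho t0)|].
  move=> x _; rewrite (ger0_norm (cosDsqr_ge0 _)); apply: key.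
  - exact: cosDsqr_ge0.
  - by apply: le_trans (cosDsqr_le2 _) _; have := sqr_ge0 (x * z); lra.
  - have x2 := cosDsqr_le2 (x * z); have := cosDsqr_le4 (x * z).
    rewrite -[_ ^+ 4]/((x * z) ^+ (2 + 2)) exprD.
    rewrite -(real_normK (num_real (x * z))) in x2 *.
    move: (normr_ge0 (x * z)) x2; move: (`|x * z|) (cos _) => y c y0 x2 x4.
    have [y1|y1] := leP y 1.
      have h1 : 0 <= y ^+ 3 * (1 - y) by rewrite mulr_ge0 ?exprn_ge0 ?subr_ge0.
      have h2 : 0 <= y ^+ 3 by rewrite exprn_ge0.
      by lra.
    have h1 : 0 <= y ^+ 2 * (y - 1) by rewrite mulr_ge0 ?exprn_ge0 ?subr_ge0// ltW.
    have h2 : 0 <= y ^+ 2 by rewrite exprn_ge0.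
    by lra.
apply: le_trans (le_normr_Rintegral measurableT (irem2 z)) _.
apply: le_Rintegral => //; [exact: integrable_norm (irem2 z)|exact: integrableRZ (irho t0)|].
move=> x _; apply: key => //; first exact: norm_sinB_le2.
apply: le_trans (norm_sinB_le3 _) _; rewrite -(real_normK (num_real (x * z))).
rewrite -mulrA -exprSr; have : 0 <= `|x * z| ^+ 3 by rewrite exprn_ge0.
lra.
Qed.

(* A substitute for [x ^+ 2] off [-del, del] whose square root is Lipschitz, so that its
   integral is continuous in mean square. *)
Definition excess (del x : R) := Num.max (`|x| - del) 0 ^+ 2.

Lemma levy_remainder (e : R) : 0 < e -> exists del C : R, [/\ 0 < del, 0 <= C &
  forall z, `|levy_re z + levy_var / 2 * z ^+ 2| <= e * z ^+ 2 + C * excess del z /\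
            `|levy_im z - levy_mean * z| <= e * z ^+ 2 + C * excess del z].
Proof.
move=> e0.
have [n rn] : exists n, rho n.+1%:R^-1 <= e.
  have /cvgrPdist_le/(_ _ e0)[N _ /(_ N (leqnn N))] := rho_cvg0.
  by rewrite /= sub0r normrN => h; exists N; exact: le_trans (ler_norm _) h.
pose t : R := n.+1%:R^-1; have t0 : 0 < t by rewrite invr_gt0 ltr0n.
pose K := \int[nu]_x (2 * x ^+ 2).
have K0 : 0 <= K by apply: Rintegral_ge0 => x _; exact: mulr_ge0 (sqr_ge0 _).
have rhoK s : 0 <= s -> rho s <= K.
  move=> s0; apply: le_Rintegral => //; [exact: irho|exact: integrableRZ|].
  move=> x _; rewrite ler_piMr ?ge_min ?lexx//.
  exact: mulr_ge0 (sqr_ge0 _).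
(* Below [t] the choice of [n] gives [rho t <= e]. Beyond [t] only [rho <= K] is left, but there
   [|z| - t / 2 >= |z| / 2], so [z^2] is at most four times [excess (t / 2) z]. *)
exists (t / 2), (4 * K); split; [by rewrite divr_gt0|by rewrite mulr_ge0|].
move=> z; have ex0 : 0 <= excess (t / 2) z by exact: sqr_ge0.
have cl F : (forall s, `|z| <= s -> F <= z ^+ 2 * rho s) ->
    F <= e * z ^+ 2 + 4 * K * excess (t / 2) z.
  move=> hF; have [zt|zt] := leP `|z| t.
    apply: le_trans (hF _ zt) _; apply: le_trans (ler_wpM2l (sqr_ge0 _) rn) _.
    by rewrite mulrC lerDl; apply: mulr_ge0 ex0; exact: mulr_ge0.
  apply: le_trans (hF _ (lexx _)) _.
  apply: le_trans (ler_wpM2l (sqr_ge0 _) (rhoK _ (normr_ge0 _))) _.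
  have : z ^+ 2 <= 4 * excess (t / 2) z.
    rewrite /excess max_l; last by lra.
    by rewrite -(real_normK (num_real z)); move: zt; move: (`|z|) => y; nra.
  move=> h; apply: (@le_trans _ _ (4 * excess (t / 2) z * K)); first exact: ler_wpM2r.
  rewrite (_ : 4 * _ * K = 4 * K * excess (t / 2) z) ?lerDr; last by ring.
  by apply: mulr_ge0 (sqr_ge0 _); exact: ltW.
by split; apply: cl => s /rho_bound[].
Qed.

End levy_exponent_expansion.

(** * Integrals of simple functions *)

Section levy_simple.
Context {dT : measure_display} {T : measurableType dT} {R : realType}.
Context {P : probability T R} {d : nat}.
Local Notation V := 'rV[R]_d.
Local Notation lambda := (@lebesgue_rV R d).
Variable L : set V -> {RV P >-> R}.
Hypothesis hL : levy_basis L.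

(** Countable additivity on a constant sequence of empty sets: the partial sums [n * x] converge, so
    their increments [x] tend to 0. *)
Lemma levy_set0 : {ae P, forall w, L set0 w = 0}.
Proof.
have [hadd _ _] := hL.
have t0 : trivIset [set: nat] (fun=> set0 : set V).
  by apply/trivIsetP => i j _ _ _; rewrite setI0.
have := hadd _ (fun=> bounded_borel0) t0; rewrite bigcup0//.
move=> /(_ bounded_borel0); apply: filterS => w; set x := L set0 w => hx.
have hS : \sum_(0 <= k < n.+1) x @[n --> \oo] --> x.
  by rewrite (cvg_shiftS (fun n => \sum_(0 <= k < n) x)).
have : \sum_(0 <= k < n.+1) x - \sum_(0 <= k < n) x @[n --> \oo] --> x - x by exact: cvgB.
rewrite subrr (_ : (fun n => _) = fun=> x).
  by move=> x0; exact: cvg_unique (cvg_cst x) x0.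
by apply/funext => n; rewrite big_nat_recr//= addrAC subrr add0r.
Qed.

Lemma levy_fin_additive (I : finType) (B : I -> set V) :
  (forall i, bounded_borel (B i)) -> trivIset setT B ->
  bounded_borel (\bigcup_i B i) ->
  {ae P, forall w, L (\bigcup_i B i) w = \sum_i L (B i) w}.
Proof.
move=> bB tB bU; have [hadd _ _] := hL.
pose F n := oapp (fun k : 'I_#|I| => B (enum_val k)) set0 (insub n).
have FE (k : 'I_#|I|) : F k = B (enum_val k) by rewrite /F valK.
have F0 n : (#|I| <= n)%N -> F n = set0 by move=> In; rewrite /F insubF// ltnNge In.
have bF n : bounded_borel (F n).
  by rewrite /F; case: insubP => [k _ _|_] /=; [exact: bB|exact: bounded_borel0].
have tF : trivIset setT F.
  apply/trivIsetP => i j _ _ ij; rewrite /F.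
  case: insubP => [k _ ki|_] /=; last by rewrite set0I.
  case: insubP => [l _ lj|_] /=; last by rewrite setI0.
  move/trivIsetP : tB; apply => //; apply: contra ij => /eqP/enum_val_inj kl.
  by rewrite -ki -lj kl.
have UF : \bigcup_n F n = \bigcup_i B i.
  apply/seteqP; split=> u [n _].
    by rewrite /F; case: insubP => //= k _ _ Bu; exists (enum_val k).
  by move=> Bu; exists (enum_rank n) => //; rewrite FE enum_rankK.
have := hadd F bF tF; rewrite UF => /(_ bU); apply: filterS2 levy_set0 => w L0 hw.
apply: cvg_unique hw _ => //.
apply: cvg_near_cst; exists #|I| => // n /= In.
rewrite (big_cat_nat (leq0n _) In)//= [X in _ + X]big_nat_cond [X in _ + X]big1 ?addr0.
  rewrite big_mkord [RHS](reindex (@enum_val I predT)); last first.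
    by apply: onW_bij; exact: enum_val_bij.
  by apply: eq_bigr => k _; rewrite FE.
by move=> k /andP[/andP[Ik _] _]; rewrite F0.
Qed.

Section atoms.
Variable s : seq (R * set V).
Hypothesis bs : forall p, p \in s -> bounded_borel p.2.

Let m := size s.
Let x (i : 'I_m) := (tnth (in_tuple s) i).1.
Let A (i : 'I_m) := (tnth (in_tuple s) i).2.
Let bA i : bounded_borel (A i).
Proof. by apply: bs; exact: mem_tnth. Qed.

Let code u : {ffun 'I_m -> bool} := [ffun i => u \in A i].
(** Atoms of the algebra generated by the [A i]. The code without any true entry describes the
    complement of their union, which need not be bounded and on which [L] is unconstrained, so its
    atom is made empty. *)
Let atom (c : {ffun 'I_m -> bool}) : set V := [set u | code u = c /\ [exists i, c i]].
Let y (c : {ffun 'I_m -> bool}) : R := \sum_(i | c i) x i.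

Let matom c : measurable (atom c).
Proof.
have [c1|c0] := boolP [exists i, c i]; last first.
  by rewrite (_ : atom c = set0)// -subset0 => u [_]; rewrite (negbTE c0).
rewrite (_ : atom c = \bigcap_(i in [set: 'I_m]) (if c i then A i else ~` A i)).
  apply: fin_bigcap_measurable => // i _; have [mA _] := bA i.
  by case: ifP => _ //; exact: measurableC.
apply/seteqP; split=> u.
  move=> [<- _] i _; rewrite ffunE; case: ifPn; first by rewrite inE.
  by rewrite notin_setE.
move=> uc; split=> //; apply/ffunP => i; rewrite ffunE.
by have := uc i I; case: (c i) => [/mem_set//|]; exact: memNset.
Qed.

Let atom_sub (c : {ffun 'I_m -> bool}) i : c i -> atom c `<=` A i.
Proof. by move=> ci u [uc _]; have := congr1 (fun f : {ffun _} => f i) uc; rewrite ffunE ci => /set_mem. Qed.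

Let batom c : bounded_borel (atom c).
Proof.
have [/existsP[i ci]|c0] := boolP [exists i, c i].
  exact: bounded_borel_sub (matom c) (atom_sub ci) (bA i).
rewrite (_ : atom c = set0); first exact: bounded_borel0.
by rewrite -subset0 => u [_]; rewrite (negbTE c0).
Qed.

Let tatom : trivIset setT atom.
Proof.
apply/trivIsetP => c c' _ _ cc'; rewrite -subset0 => u [[uc _] [uc' _]].
by move: cc'; rewrite -uc -uc' eqxx.
Qed.

Let AE i : A i = \bigcup_(c in [set: {ffun 'I_m -> bool}]) (if c i then atom c else set0).
Proof.
apply/seteqP; split=> u.
  move=> Au; exists (code u) => //; rewrite ffunE mem_set//; split=> //.
  by apply/existsP; exists i; rewrite ffunE mem_set.
by move=> [c _]; case: ifP => // ci /(atom_sub ci).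
Qed.

Let sum_seqE (K : lmodType R) (F : R * set V -> K) :
  \sum_(p <- s) F p = \sum_(i < m) F (x i, A i).
Proof.
rewrite big_tnth; apply: eq_bigr => i _; congr F.
by rewrite /x /A; case: (tnth _ i).
Qed.

Let levy_atoms :
  {ae P, forall w, \sum_(p <- s) p.1 * L p.2 w = \sum_c y c * L (atom c) w}.
Proof.
have h i : {ae P, forall w, L (A i) w = \sum_(c : {ffun 'I_m -> bool} | c i) L (atom c) w}.
  have := @levy_fin_additive _ (fun c : {ffun 'I_m -> bool} => if c i then atom c else set0).
  rewrite -AE => /(_ _ _ (bA i)) h; apply: filterS2 levy_set0 (h _ _) => //.
  - move=> w L0 ->; rewrite [RHS]big_mkcond; apply: eq_bigr => c _.
    by case: ifP.
  - by move=> c; case: ifP => _; [exact: batom|exact: bounded_borel0].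
  - apply/trivIsetP => c c' _ _ cc'; case: ifP; rewrite ?set0I// => _.
    case: ifP; rewrite ?setI0// => _.
    by move/trivIsetP : tatom; exact.
have : {ae P, forall w i, L (A i) w = \sum_(c : {ffun 'I_m -> bool} | c i) L (atom c) w}.
  suff h' (r : seq 'I_m) : {ae P, forall w i, i \in r ->
      L (A i) w = \sum_(c : {ffun 'I_m -> bool} | c i) L (atom c) w}.
    by apply: filterS (h' (enum 'I_m)) => w hw i; apply: hw; rewrite mem_enum.
  elim: r => [|i r ih]; first exact: aeW.
  apply: filterS2 (h i) ih => w hw ih j; rewrite inE => /predU1P[->//|]; exact: ih.
apply: filterS => w hw.
rewrite (sum_seqE (fun p => p.1 * L p.2 w)) /=.
under eq_bigr do rewrite hw big_distrr /=.
rewrite (exchange_big_dep predT)//=.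
by apply: eq_bigr => c _; rewrite -big_distrl.
Qed.

(** Outside the atoms the simple function is 0 and the right-hand sum is empty; [Phi 0 = 0]
    reconciles the two. *)
Let simple_funE (Phi : R -> R) u : Phi 0 = 0 ->
  Phi (simple_fun s u) = \sum_c Phi (y c) * \1_(atom c) u.
Proof.
move=> Phi0.
have -> : simple_fun s u = y (code u).
  rewrite /simple_fun (sum_seqE (fun p => p.1 * \1_p.2 u)) /= /y [RHS]big_mkcond.
  apply: eq_bigr => i _; rewrite ffunE indicE.
  by case: (u \in A i); rewrite ?mulr1 ?mulr0.
rewrite (bigD1 (code u))//= big1 ?addr0; last first.
  move=> c cu; rewrite indicE memNset ?mulr0// => -[uc _].
  by move: cu; rewrite uc eqxx.
have [c1|c0] := boolP [exists i, code u i].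
  by rewrite indicE mem_set ?mulr1.
rewrite indicE memNset; last by move=> [_]; rewrite (negbTE c0).
rewrite mulr0 /y big1// => i ci; exfalso.
by move: c0; rewrite negb_exists => /forallP/(_ i); rewrite ci.
Qed.

Let iind c : lambda.-integrable setT (EFin \o \1_(atom c)).
Proof.
apply/integrableP; split; first by apply/measurable_EFinP.
rewrite (eq_integral (fun u => (\1_(atom c) u)%:E)); last first.
  by move=> u _ /=; rewrite ger0_norm.
by rewrite integral_indic// setIT; exact: bounded_borel_lty.
Qed.

Let isum (F : {ffun 'I_m -> bool} -> R) (r : seq {ffun 'I_m -> bool}) :
  lambda.-integrable setT (EFin \o (fun u => \sum_(c <- r) F c * \1_(atom c) u)) /\
  \int[lambda]_u (\sum_(c <- r) F c * \1_(atom c) u) =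
  \sum_(c <- r) F c * fine (lambda (atom c)).
Proof.
elim: r => [|c r [ih1 ih2]].
  split.
    under [X in EFin \o X]eq_fun do rewrite big_nil.
    exact: integrable0.
  under eq_Rintegral do rewrite big_nil.
  by rewrite Rintegral_cst// mul0r big_nil.
have ic := integrableRZ (F c) (iind c).
split.
  under [X in EFin \o X]eq_fun do rewrite big_cons.
  exact: integrableRD.
under eq_Rintegral do rewrite big_cons.
rewrite RintegralD// big_cons ih2; congr (_ + _).
rewrite (RintegralZl _ measurableT (iind c)); congr (_ * _).
by rewrite /Rintegral integral_indic// setIT.
Qed.

Let integrable_simple (Phi : R -> R) : Phi 0 = 0 ->
  lambda.-integrable setT (EFin \o (fun u => Phi (simple_fun s u))).
Proof.
move=> Phi0; under [X in EFin \o X]eq_fun do rewrite simple_funE//.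
by have [] := isum (Phi \o y) (index_enum _).
Qed.

Let Rintegral_simple (Phi : R -> R) : Phi 0 = 0 ->
  \int[lambda]_u Phi (simple_fun s u) = \sum_c Phi (y c) * fine (lambda (atom c)).
Proof.
move=> Phi0; under eq_Rintegral do rewrite simple_funE//.
by have [] := isum (Phi \o y) (index_enum _).
Qed.

Lemma simple_fun_integrable (Phi : R -> R) : Phi 0 = 0 ->
  lambda.-integrable setT (EFin \o (fun u => Phi (simple_fun s u))).
Proof. exact: integrable_simple. Qed.

(* [re] and [im] are the real and imaginary parts of the Levy exponent. *)
Lemma simple_levy_cos_sin (re im : R -> R) : re 0 = 0 -> im 0 = 0 ->
  (forall z B, bounded_borel B ->
    \int[P]_w cos (z * L B w) = expR (fine (lambda B) * re z) * cos (fine (lambda B) * im z) /\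
    \int[P]_w sin (z * L B w) = expR (fine (lambda B) * re z) * sin (fine (lambda B) * im z)) ->
  let S w := \sum_(p <- s) p.1 * L p.2 w in
  let a := \int[lambda]_u re (simple_fun s u) in
  let b := \int[lambda]_u im (simple_fun s u) in
  \int[P]_w cos (S w) = expR a * cos b /\ \int[P]_w sin (S w) = expR a * sin b.
Proof.
move=> re0 im0 hcs; rewrite /= !Rintegral_simple//.
have [_ hind _] := hL.
pose I := {ffun 'I_m -> bool}.
have tE : trivIset [set: 'I_#|I|] (fun k => atom (enum_val k)).
  apply/trivIsetP => k l _ _ kl; move/trivIsetP : tatom; apply => //.
  by apply: contra kl => /eqP/enum_val_inj ->.
have ind := hind _ _ (fun k => batom (enum_val k)) tE.
have [] := @independent_sum_cos_sin _ _ _ P #|I| _ ind (fun k => y (enum_val k))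
  (fun k => fine (lambda (atom (enum_val k))) * re (y (enum_val k)))
  (fun k => fine (lambda (atom (enum_val k))) * im (y (enum_val k)))
  (fun k => (hcs _ _ (batom _)).1) (fun k => (hcs _ _ (batom _)).2).
have E (F : I -> R) : \sum_(k < #|I|) F (enum_val k) = \sum_c F c.
  rewrite [RHS](reindex (@enum_val I predT))//.
  by apply: onW_bij; exact: enum_val_bij.
rewrite (E (fun c => fine (lambda (atom c)) * re (y c))).
rewrite (E (fun c => fine (lambda (atom c)) * im (y c))).
under [\sum_c re _ * _]eq_bigr do rewrite mulrC.
under [\sum_c im _ * _]eq_bigr do rewrite mulrC.
move=> <- <-.
have mS : measurable_fun setT (fun w => \sum_(p <- s) p.1 * L p.2 w).
  elim: (s) => [|p r ih]; first by under eq_fun do rewrite big_nil; exact: measurable_cst.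
  by under eq_fun do rewrite big_cons; apply: measurable_funD => //; exact: measurable_Ml.
have mS' : measurable_fun setT (fun w => \sum_(k < #|I|) y (enum_val k) * L (atom (enum_val k)) w).
  elim: (index_enum _) => [|p r ih]; first by under eq_fun do rewrite big_nil; exact: measurable_cst.
  by under eq_fun do rewrite big_cons; apply: measurable_funD => //; exact: measurable_Ml.
have cm : measurable_fun setT (@cos R) by apply: continuous_measurable_fun; exact: continuous_cos.
have sm : measurable_fun setT (@sin R) by apply: continuous_measurable_fun; exact: continuous_sin.
(* The sum over the list and the sum over atoms agree only almost surely, so they are exchanged
   under the integral. *)
have key (F : R -> R) : measurable_fun setT F ->
    \int[P]_w F (\sum_(p <- s) p.1 * L p.2 w) =
    \int[P]_w F (\sum_(k < #|I|) y (enum_val k) * L (atom (enum_val k)) w).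
  move=> mF; congr fine; apply: ae_eq_integral => //.
  - by apply/measurable_EFinP; exact: measurableT_comp mF mS.
  - by apply/measurable_EFinP; exact: measurableT_comp mF mS'.
  - apply: filterS levy_atoms => w -> _.
    by rewrite (E (fun c => y c * L (atom c) w)).
by split; apply: key.
Qed.

End atoms.

End levy_simple.

(** * Functions in L^1 and L^2 *)

Section L12.
Context {d} {X : measurableType d} {R : realType} (mu : {measure set X -> \bar R}).
Implicit Types f g h : X -> R.

Definition L12 f := [/\ measurable_fun setT f, mu.-integrable setT (EFin \o f) &
  mu.-integrable setT (EFin \o (fun x => f x ^+ 2))].

(** The L^1 norm plus the squared L^2 norm. This is not a norm, whence the factor 2 in [norm12D],
    but it tends to 0 exactly when both norms do. The L^1 part is there to control the mean. *)
Definition norm12 f := \int[mu]_x `|f x| + \int[mu]_x (f x ^+ 2).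

Lemma L12_dominated f g : L12 g -> measurable_fun setT f ->
  (forall x, `|f x| <= `|g x|) -> L12 f.
Proof.
move=> [mg ig ig2] mf fg; split=> //; first exact: integrable_dominated ig fg.
apply: integrable_dominated ig2 _; first exact: measurable_funX.
by move=> x; rewrite !normrX ler_sqr ?nnegrE.
Qed.

Lemma L12D f g : L12 f -> L12 g -> L12 (fun x => f x + g x).
Proof.
move=> [mf if1 if2] [mg ig1 ig2].
have mfg : measurable_fun setT (fun x => f x + g x) by exact: measurable_funD.
split=> //; first exact: integrableRD.
apply: integrable_dominated (integrableRZ 2 (integrableRD if2 ig2)) _.
  exact: measurable_funX.
move=> x; rewrite !ger0_norm ?sqr_ge0 ?mulr_ge0 ?addr_ge0 ?sqr_ge0//.
by have := sqr_ge0 (f x - g x); nra.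
Qed.

Lemma L12Z k f : L12 f -> L12 (fun x => k * f x).
Proof.
move=> [mf if1 if2]; split; [exact: measurable_Ml|exact: integrableRZ|].
by under [X in EFin \o X]eq_fun do rewrite exprMn; exact: integrableRZ.
Qed.

Lemma L12B f g : L12 f -> L12 g -> L12 (fun x => f x - g x).
Proof.
move=> hf /(L12Z (-1)) hg; have := L12D hf hg.
by under eq_fun do rewrite mulN1r.
Qed.

Lemma L12_0 : L12 (fun=> 0).
Proof.
split=> //; first exact: integrable0.
by under [X in EFin \o X]eq_fun do rewrite expr0n; exact: integrable0.
Qed.

Lemma L12_sum (I : Type) (r : seq I) (F : I -> X -> R) : (forall i, L12 (F i)) ->
  L12 (fun x => \sum_(i <- r) F i x).
Proof.
move=> hF; elim: r => [|i r ih].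
  by under eq_fun do rewrite big_nil; exact: L12_0.
by under eq_fun do rewrite big_cons; exact: L12D.
Qed.

Lemma L12_indic f (A : set X) : measurable A -> L12 f -> L12 (fun x => f x * \1_A x).
Proof.
move=> mA hf; have [mf _ _] := hf; apply: L12_dominated hf _ _.
  exact: measurable_funM.
by move=> x; rewrite normrM indicE; case: (_ \in _); rewrite ?normr1 ?normr0 ?mulr1 ?mulr0.
Qed.

Lemma L12_norm f : L12 f -> L12 (fun x => `|f x|).
Proof.
move=> hf; have [mf _ _] := hf; apply: L12_dominated hf _ _.
  exact: measurableT_comp.
by move=> x; rewrite normr_id.
Qed.

Lemma L12_prod_integrable f g : L12 f -> L12 g ->
  mu.-integrable setT (EFin \o (fun x => f x * g x)).
Proof.
move=> [mf _ if2] [mg _ ig2].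
apply: integrable_dominated (integrableRD if2 ig2) _; first exact: measurable_funM.
move=> x; rewrite normrM [leRHS]ger0_norm ?addr_ge0 ?sqr_ge0//.
rewrite -(real_normK (num_real (f x))) -(real_normK (num_real (g x))).
by have := sqr_ge0 (`|f x| - `|g x|); have := sqr_ge0 (`|f x|); have := sqr_ge0 (`|g x|); nra.
Qed.

Lemma norm12_ge0 f : 0 <= norm12 f.
Proof.
apply: addr_ge0; first by apply: Rintegral_ge0.
by apply: Rintegral_ge0 => x _; exact: sqr_ge0.
Qed.

Lemma le_norm12 f g : L12 f -> L12 g -> (forall x, `|f x| <= `|g x|) ->
  norm12 f <= norm12 g.
Proof.
move=> hf hg fg; have [_ if1 if2] := hf; have [_ ig1 ig2] := hg.
apply: lerD; apply: le_Rintegral => //.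
- exact: integrable_norm if1.
- exact: integrable_norm ig1.
- by move=> x _; rewrite -[leLHS]real_normK ?num_real// -[leRHS]real_normK ?num_real// ler_sqr ?nnegrE.
Qed.

Lemma norm12D f g : L12 f -> L12 g ->
  norm12 (fun x => f x + g x) <= 2 * norm12 f + 2 * norm12 g.
Proof.
move=> hf hg; have [_ if1 if2] := hf; have [_ ig1 ig2] := hg.
have [_ i1 i2] := L12D hf hg.
have in1 := integrable_norm if1; have in2 := integrable_norm ig1.
have h1 : \int[mu]_x `|f x + g x| <= \int[mu]_x `|f x| + \int[mu]_x `|g x|.
  rewrite -RintegralD//; apply: le_Rintegral => //.
  - exact: integrable_norm i1.
  - exact: integrableRD in1 in2.
  - by move=> x _; exact: ler_normD.
have h2 : \int[mu]_x ((f x + g x) ^+ 2) <=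
    2 * \int[mu]_x (f x ^+ 2) + 2 * \int[mu]_x (g x ^+ 2).
  rewrite -(RintegralZl 2 measurableT if2) -(RintegralZl 2 measurableT ig2).
  rewrite -RintegralD//; [|exact: integrableRZ if2|exact: integrableRZ ig2].
  apply: le_Rintegral => //.
    by apply: integrableRD; [exact: integrableRZ if2|exact: integrableRZ ig2].
  by move=> x _; have := sqr_ge0 (f x - g x); nra.
have n1 : 0 <= \int[mu]_x `|f x| by exact: Rintegral_ge0.
have n2 : 0 <= \int[mu]_x `|g x| by exact: Rintegral_ge0.
by rewrite /norm12; lra.
Qed.

Lemma norm_Rintegral_le_norm12 f : L12 f -> `|\int[mu]_x f x| <= norm12 f.
Proof.
move=> [_ if1 if2]; apply: le_trans (le_normr_Rintegral measurableT if1) _.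
by rewrite lerDl; apply: Rintegral_ge0 => x _; exact: sqr_ge0.
Qed.

Lemma sqr_Rintegral_le_norm12 f : L12 f -> \int[mu]_x (f x ^+ 2) <= norm12 f.
Proof. by move=> _; rewrite lerDr; apply: Rintegral_ge0. Qed.

Lemma norm12_cvg0 (f_ : nat -> X -> R) g : L12 g ->
  (forall n, measurable_fun setT (f_ n)) ->
  (forall n x, `|f_ n x| <= `|g x|) ->
  {ae mu, forall x, f_ n x @[n --> \oo] --> 0} -> norm12 (f_ n) @[n --> \oo] --> 0.
Proof.
move=> [mg ig1 ig2] mf fg f0.
have E0 : 0 = \int[mu]_x (0 : R) by rewrite Rintegral_cst// mul0r.
rewrite -[X in _ --> X]addr0 /norm12; apply: cvgD; rewrite [X in _ --> X]E0.
  apply: (@Rintegral_dominated_cvg _ _ _ mu (fun n x => `|f_ n x|) _ (fun x => `|g x|)) => //.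
  - by move=> n; exact: measurableT_comp.
  - by apply: filterS f0 => x fx0; apply/norm_cvg0P.
  - exact: integrable_norm ig1.
  - by apply: aeW => x n; rewrite normr_id.
apply: (@Rintegral_dominated_cvg _ _ _ mu (fun n x => f_ n x ^+ 2) _ (fun x => g x ^+ 2)) => //.
- by move=> n; exact: measurable_funX.
- apply: filterS f0 => x fx0.
  have := cvgM fx0 fx0; rewrite mulr0; exact.
- apply: aeW => x n; rewrite ger0_norm ?sqr_ge0//.
  by rewrite -[leLHS]real_normK ?num_real// -[leRHS]real_normK ?num_real// ler_sqr ?nnegrE.
Qed.

(* [phi] is the identity or the positive part of |x| - delta. *)
Lemma Rintegral_sqr_cvg (phi : R -> R) (f_ : nat -> X -> R) g :
  measurable_fun setT phi -> (forall x, `|phi x| <= `|x|) ->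
  (forall x y, `|phi x - phi y| <= `|x - y|) ->
  L12 g -> (forall n, L12 (f_ n)) ->
  norm12 (fun x => f_ n x - g x) @[n --> \oo] --> 0 ->
  \int[mu]_x (phi (f_ n x) ^+ 2) @[n --> \oo] --> \int[mu]_x (phi (g x) ^+ 2).
Proof.
move=> mphi phile philip hg hf fg0.
have Lphi h : L12 h -> L12 (fun x => phi (h x)).
  move=> hh; have [mh _ _] := hh; apply: L12_dominated hh _ _ => //.
  exact: measurableT_comp.
pose G := \int[mu]_x (g x ^+ 2).
have G0 : 0 <= G by apply: Rintegral_ge0 => x _; exact: sqr_ge0.
(* In place of Cauchy-Schwarz: [2 D H <= D^2 / eta + eta H^2], with [eta] chosen small against the
   integral of [g^2] before [n] is taken large. *)
have bound n eta : 0 < eta -> `|\int[mu]_x (phi (f_ n x) ^+ 2) - \int[mu]_x (phi (g x) ^+ 2)| <=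
    (1 + eta^-1) * norm12 (fun x => f_ n x - g x) + eta * G.
  move=> eta0; have [_ _ i1] := Lphi _ (hf n); have [_ _ i2] := Lphi _ hg.
  have hd := L12B (hf n) hg; have [_ _ id] := hd; have [_ _ ig2] := hg.
  rewrite -RintegralB//; apply: le_trans (le_normr_Rintegral measurableT (integrableRB i1 i2)) _.
  have k0 : 0 <= 1 + eta^-1 by rewrite addr_ge0// invr_ge0 ltW.
  apply: (@le_trans _ _ ((1 + eta^-1) * \int[mu]_x ((f_ n x - g x) ^+ 2) + eta * G)); last first.
    by rewrite lerD2r ler_wpM2l// sqr_Rintegral_le_norm12.
  rewrite -(RintegralZl _ measurableT id) -(RintegralZl _ measurableT ig2).
  rewrite -RintegralD//; [|exact: integrableRZ id|exact: integrableRZ ig2].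
  apply: le_Rintegral => //.
  - exact: integrable_norm (integrableRB i1 i2).
  - by apply: integrableRD; [exact: integrableRZ id|exact: integrableRZ ig2].
  move=> x _; set a := phi (f_ n x); set b := phi (g x).
  have h1 : `|a - b| <= `|f_ n x - g x| by exact: philip.
  have h2 : `|b| <= `|g x| by exact: phile.
  have -> : a ^+ 2 - b ^+ 2 = (a - b) ^+ 2 + 2 * ((a - b) * b) by ring.
  apply: le_trans (ler_normD _ _) _; rewrite normrX normrM normrM (@ger0_norm _ 2)//.
  rewrite -(real_normK (num_real (f_ n x - g x))) -(real_normK (num_real (g x))).
  move: h1 h2 (normr_ge0 (a - b)) (normr_ge0 b).
  move: (`|a - b|) (`|b|) (`|f_ n x - g x|) (`|g x|) => p q D H h1 h2 p0 q0.
  have pD : p ^+ 2 <= D ^+ 2 by rewrite ler_sqr ?nnegrE// (le_trans p0).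
  have pq : 2 * (p * q) <= 2 * (D * H) by rewrite ler_wpM2l// ler_pM.
  have DH : 2 * (D * H) <= eta^-1 * D ^+ 2 + eta * H ^+ 2.
    have -> : eta^-1 * D ^+ 2 + eta * H ^+ 2 = 2 * (D * H) + eta^-1 * (D - eta * H) ^+ 2.
      by field; rewrite gt_eqF.
    by rewrite lerDl; apply: mulr_ge0 (sqr_ge0 _); rewrite invr_ge0 ltW.
  by lra.
apply/cvgrPdist_le => e e0.
pose eta := e / (2 * (1 + G)).
have eta0 : 0 < eta by rewrite divr_gt0// mulr_gt0// ltr_pwDl.
have etaG : eta * G <= e / 2.
  rewrite /eta mulrAC ler_pdivrMr ?mulr_gt0 ?ltr_pwDl//.
  have -> : e / 2 * (2 * (1 + G)) = e + e * G by field.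
  by rewrite lerDr ltW.
pose K := 1 + eta^-1.
have K0 : 0 < K by rewrite ltr_pwDl// invr_ge0 ltW.
have e1 : 0 < e / 2 / K by rewrite !divr_gt0.
have /cvgrPdist_le/(_ _ e1) h := fg0.
near=> n; rewrite distrC; apply: le_trans (bound n eta eta0) _.
rewrite [leRHS](splitr e); apply: lerD => //.
have : `|0 - norm12 (fun x => f_ n x - g x)| <= e / 2 / K by near: n.
rewrite sub0r normrN (ger0_norm (norm12_ge0 _)) => hn.
by rewrite mulrC -ler_pdivlMr.
Unshelve. all: end_near. Qed.

End L12.

(** * Convergence in probability *)

Section convergence_in_probability.
Context {d} {T : measurableType d} {R : realType} (P : probability T R).
Implicit Types (Y Z : nat -> T -> R).

Definition null_in_probability Y := cvg_in_probability P Y (fun=> 0).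

Let mtail (f : T -> R) (e : R) : measurable_fun setT f -> measurable [set w | e <= `|f w|].
Proof.
move=> mf; have -> : [set w | e <= `|f w|] = (fun w => `|f w|) @^-1` `[e, +oo[.
  by apply/seteqP; split=> w; rewrite /= in_itv/= andbT.
by rewrite -[X in measurable X]setTI; apply: measurableT_comp.
Qed.

Lemma null_in_probabilityD Y Z : (forall n, measurable_fun setT (Y n)) ->
  (forall n, measurable_fun setT (Z n)) ->
  null_in_probability Y -> null_in_probability Z ->
  null_in_probability (fun n w => Y n w + Z n w).
Proof.
move=> mY mZ hY hZ e e0; have e20 : 0 < e / 2 by rewrite divr_gt0.
have h : (P [set w | e / 2 <= `|Y n w - 0|]%R + P [set w | e / 2 <= `|Z n w - 0|]%R)%E
    @[n --> \oo] --> 0%E.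
  by rewrite -[X in _ --> X]adde0; apply: cvgeD (hY _ e20) (hZ _ e20).
apply: (squeeze_cvge _ (cvg_cst 0%E) h); near=> n; rewrite measure_ge0/=.
have m1 : measurable [set w | e / 2 <= `|Y n w - 0|].
  by under eq_set do rewrite subr0; exact: mtail.
have m2 : measurable [set w | e / 2 <= `|Z n w - 0|].
  by under eq_set do rewrite subr0; exact: mtail.
apply: le_trans (measureU2 _ m1 m2).
apply: le_measure; rewrite ?inE//.
- under eq_set do rewrite subr0; apply: mtail; exact: measurable_funD.
- exact: measurableU.
move=> w /=; rewrite !subr0 => h1; apply/orP; rewrite -[_ || _]negbK negb_or -!ltNge.
apply/negP => /andP[h2 h3]; move: h1; rewrite leNgt => /negP; apply.
by rewrite (le_lt_trans (ler_normD _ _))// [ltRHS](splitr e) ltrD.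
Unshelve. all: end_near. Qed.

Lemma null_in_probabilityN Y : null_in_probability Y ->
  null_in_probability (fun n w => - Y n w).
Proof.
move=> hY e e0; have := hY e e0; apply: cvg_trans; apply: near_eq_cvg; apply: nearW => n.
by congr (P _); apply/seteqP; split=> w /=; rewrite !subr0 normrN.
Qed.

Lemma null_in_probability_eq Y Z : (forall n w, Y n w = Z n w) ->
  null_in_probability Y -> null_in_probability Z.
Proof. by move=> YZ; rewrite (_ : Y = Z)//; apply/funext => n; apply/funext => w. Qed.

Lemma cvg_in_probabilityB Y (Z : T -> R) : cvg_in_probability P Y Z ->
  null_in_probability (fun n w => Y n w - Z w).
Proof.
move=> hY e e0; have := hY e e0; apply: cvg_trans; apply: near_eq_cvg; apply: nearW => n.
by congr (P _); apply/seteqP; split=> w /=; rewrite subr0.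
Qed.

Lemma null_in_probability_subseq Y (phi : nat -> nat) : (forall n, (n <= phi n)%N) ->
  null_in_probability Y -> null_in_probability (fun n => Y (phi n)).
Proof.
move=> phin hY e e0; have := hY e e0 => h.
apply: (cvg_comp phi (fun n => P [set w | e <= `|Y n w - 0|])) h.
move=> A [N _ NA]; exists N => // n /= Nn; apply: NA => /=; exact: leq_trans Nn (phin n).
Qed.

Lemma second_moment_tail (Y : T -> R) (e M : R) : measurable_fun setT Y -> 0 < e ->
  (\int[P]_w (Y w ^+ 2)%:E <= M%:E)%E ->
  (P [set w | e <= `|Y w|]%R <= ((e ^+ 2)^-1 * M)%:E)%E.
Proof.
move=> mY e0 YM; have e20 : 0 < e ^+ 2 by rewrite exprn_gt0.
have mE : measurable [set w | e <= `|Y w|] by exact: mtail.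
have mY2 : measurable_fun setT (fun w => (Y w ^+ 2)%:E).
  by apply/measurable_EFinP; exact: measurable_funX.
have := le_integral_abse P measurableT mY2 e20; rewrite setTI.
rewrite (eq_integral (fun w => (Y w ^+ 2)%:E)); last first.
  by move=> w _; rewrite /= ger0_norm ?sqr_ge0.
move=> /le_trans/(_ YM) hn.
have -> : [set w | e <= `|Y w|] = [set x | ((e ^+ 2)%:E <= `|(Y x ^+ 2)%:E|)%E].
  by apply/seteqP; split=> w /=; rewrite lee_fin normrX ler_sqr ?nnegrE//; exact: ltW.
by rewrite [leRHS]EFinM lee_pdivlMl.
Qed.

Lemma null_in_probability_L2 Y (u : nat -> R) : (forall n, measurable_fun setT (Y n)) ->
  (forall n, \int[P]_w (Y n w ^+ 2)%:E <= (u n)%:E)%E -> u n @[n --> \oo] --> 0 ->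
  null_in_probability Y.
Proof.
move=> mY Yu u0 e e0.
have key n : (P [set w | e <= `|Y n w - 0|]%R <= ((e ^+ 2)^-1 * u n)%:E)%E.
  by under eq_set do rewrite subr0; exact: second_moment_tail.
have h0 : ((e ^+ 2)^-1 * u n)%:E @[n --> \oo] --> 0%E.
  apply: cvg_EFin; first exact: nearW.
  by rewrite -[X in _ --> X](mulr0 (e ^+ 2)^-1); exact: cvgMr.
apply: (squeeze_cvge _ (cvg_cst 0%E) h0); near=> n.
by rewrite measure_ge0 key.
Unshelve. all: end_near. Qed.

Lemma cvg_in_probability_Rintegral (F : R -> R) Y (Z : T -> R) :
  measurable_fun setT F -> (forall x, `|F x| <= 1) -> (forall x y, `|F x - F y| <= `|x - y|) ->
  (forall n, measurable_fun setT (Y n)) -> measurable_fun setT Z ->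
  cvg_in_probability P Y Z ->
  \int[P]_w F (Y n w) @[n --> \oo] --> \int[P]_w F (Z w).
Proof.
move=> mF F1 Flip mY mZ hYZ; apply/cvgrPdist_le => e e0.
have e20 : 0 < e / 2 by rewrite divr_gt0.
have e40 : 0 < e / 4 by rewrite divr_gt0.
have /fine_cvgP[_ /cvgrPdist_le/(_ _ e40) h] := hYZ _ e20.
near=> n; rewrite distrC.
have mE : measurable [set w | e / 2 <= `|Y n w - Z w|].
  by apply: mtail; exact: measurable_funB.
have mFY : measurable_fun setT (fun w => F (Y n w)) by exact: measurableT_comp.
have mFZ : measurable_fun setT (fun w => F (Z w)) by exact: measurableT_comp.
have near w : ~ [set w | e / 2 <= `|Y n w - Z w|] w -> `|F (Y n w) - F (Z w)| <= e / 2.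
  move=> /= /negP; rewrite -ltNge => /ltW; exact: le_trans.
apply: le_trans (prob_Rintegral_near P mE mFY mFZ (fun=> F1 _) (fun=> F1 _) near (ltW e20)) _.
have : `|0 - fine (P [set w | e / 2 <= `|Y n w - Z w|])| <= e / 4 by near: n.
rewrite sub0r normrN => hn; have := le_trans (ler_norm _) hn; lra.
Unshelve. all: end_near. Qed.

End convergence_in_probability.

(** * Second order estimates for integrals of simple functions *)

Section levy_expansion.
Context {dT : measure_display} {T : measurableType dT} {R : realType}.
Context {P : probability T R} {d : nat}.
Local Notation V := 'rV[R]_d.
Local Notation lambda := (@lebesgue_rV R d).
Variable L : set V -> {RV P >-> R}.

Definition second_order_remainder (re im : R -> R) (v c e del C : R) := forall z,
  `|re z + v / 2 * z ^+ 2| <= e * z ^+ 2 + C * excess del z /\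
  `|im z - c * z| <= e * z ^+ 2 + C * excess del z.

(** What the rest of the proof retains of the Levy triplet: the real and imaginary parts of the
    exponent, and their second order expansion with coefficients [v] and [c]. *)
Definition levy_expansion (re im : R -> R) (v c : R) :=
  [/\ 0 <= v, forall z, re z <= 0,
   forall z B, bounded_borel B ->
     \int[P]_w cos (z * L B w) = expR (fine (lambda B) * re z) * cos (fine (lambda B) * im z) /\
     \int[P]_w sin (z * L B w) = expR (fine (lambda B) * re z) * sin (fine (lambda B) * im z) &
   forall e, 0 < e -> exists del C, [/\ 0 < del, 0 <= C &
     second_order_remainder re im v c e del C]].

Lemma levy_basis_expansion : levy_basis L ->
  ('E_P[fun w => (L unit_cube w ^+ 2)%R] < +oo)%E ->
  exists re im v c, levy_expansion re im v c.
Proof.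
move=> [_ _ [a [gamma [nu [a0 hnu hcf]]]]] hL2.
have cs z B : bounded_borel B ->
    \int[P]_w cos (z * L B w) = expR (fine (lambda B) * levy_re a nu z) *
      cos (fine (lambda B) * levy_im gamma nu z) /\
    \int[P]_w sin (z * L B w) = expR (fine (lambda B) * levy_re a nu z) *
      sin (fine (lambda B) * levy_im gamma nu z).
  move=> bB; have := hcf z B bB; rewrite levy_exponentE.
  move: (fine _) (levy_re _ _ _) (levy_im _ _ _) => l r i.
  move=> /eqP; rewrite eq_complex => /andP[/eqP h1 /eqP h2]; split.
    transitivity (complex.Re (Cintegral P (fun w => expC ('i%C * (z * L B w)%:C%C)))).
      apply: eq_Rintegral => w _ /=.
      by rewrite !(mul0r, mul1r, mulr0, subr0, addr0, add0r, oppr0) expR0 mul1r.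
    by rewrite h1 /= !(mulr0, subr0, add0r) (mulrC r) (mulrC i).
  transitivity (complex.Im (Cintegral P (fun w => expC ('i%C * (z * L B w)%:C%C)))).
    apply: eq_Rintegral => w _ /=.
    by rewrite !(mul0r, mul1r, mulr0, subr0, addr0, add0r, oppr0) expR0 mul1r.
  by rewrite h2 /= !(mulr0, subr0, add0r) (mulrC r) (mulrC i).
have iY : P.-integrable setT (EFin \o (fun w => L unit_cube w ^+ 2)).
  apply/integrableP; split.
    by apply/measurable_EFinP; apply: measurable_funX.
  rewrite (eq_integral (fun w => (L unit_cube w ^+ 2)%:E)); last first.
    by move=> w _; rewrite /= ger0_norm ?sqr_ge0.
  by move: hL2; rewrite unlock.
have isqr : nu.-integrable setT (EFin \o (fun x : R => x ^+ 2)).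
  apply: (@levy_measure_second_moment _ a gamma _ a0 hnu _ _ P (L unit_cube)) => //.
  move=> z; have [-> _] := cs z _ bounded_borel_unit_cube.
  by rewrite lebesgue_unit_cube /= !mul1r.
exists (levy_re a nu), (levy_im gamma nu), (levy_var a nu), (levy_mean gamma nu); split => //.
- exact: levy_var_ge0.
- exact: levy_re_le0.
- exact: levy_remainder.
Qed.

End levy_expansion.

Section simple_integrals.
Context {dT : measure_display} {T : measurableType dT} {R : realType}.
Context {P : probability T R} {d : nat}.
Local Notation V := 'rV[R]_d.
Local Notation lambda := (@lebesgue_rV R d).
Variable L : set V -> {RV P >-> R}.
Hypothesis hL : levy_basis L.

Implicit Type s : seq (R * set V).

Definition bounded_simple s := forall p, p \in s -> bounded_borel p.2.
Definition simple_sum s w := \sum_(p <- s) p.1 * L p.2 w.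
Definition simple_scale (z : R) s := [seq (z * p.1, p.2) | p <- s].
Definition simple_restrict s (B : set V) := [seq (p.1, p.2 `&` B) | p <- s].

Lemma bounded_simple_cat s t : bounded_simple s -> bounded_simple t ->
  bounded_simple (s ++ t).
Proof. by move=> hs ht p; rewrite mem_cat => /orP[/hs|/ht]. Qed.

Lemma bounded_simple_scale z s : bounded_simple s -> bounded_simple (simple_scale z s).
Proof. by move=> hs p /mapP[q /hs hq ->]. Qed.

Lemma bounded_simple_restrict s B : measurable B -> bounded_simple s ->
  bounded_simple (simple_restrict s B).
Proof.
move=> mB hs p /mapP[q /hs hq ->] /=; apply: (bounded_borel_sub _ _ hq) => //.
by apply: measurableI => //; exact: hq.1.
Qed.

Lemma simple_sum_cat s t w : simple_sum (s ++ t) w = simple_sum s w + simple_sum t w.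
Proof. by rewrite /simple_sum big_cat. Qed.

Lemma simple_fun_cat s t (u : V) : simple_fun (s ++ t) u = simple_fun s u + simple_fun t u.
Proof. by rewrite /simple_fun big_cat. Qed.

Lemma simple_sum_scale z s w : simple_sum (simple_scale z s) w = z * simple_sum s w.
Proof.
rewrite /simple_sum /simple_scale big_map big_distrr.
by apply: eq_bigr => p _; rewrite /= mulrA.
Qed.

Lemma simple_fun_scale z s (u : V) : simple_fun (simple_scale z s) u = z * simple_fun s u.
Proof.
rewrite /simple_fun /simple_scale big_map big_distrr.
by apply: eq_bigr => p _; rewrite /= mulrA.
Qed.

Lemma simple_fun_restrict s B (u : V) :
  simple_fun (simple_restrict s B) u = simple_fun s u * \1_B u.
Proof.
rewrite /simple_fun /simple_restrict big_map big_distrl.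
by apply: eq_bigr => p _; rewrite /= indicI mulrA.
Qed.

Lemma simple_sum_restrict s B w :
  simple_sum (simple_restrict s B) w = simple_integral L s B w.
Proof. by rewrite /simple_sum /simple_restrict big_map. Qed.

Lemma measurable_simple_sum s : measurable_fun setT (simple_sum s).
Proof.
rewrite /simple_sum; elim: s => [|p r ih].
  by under eq_fun do rewrite big_nil; exact: measurable_cst.
by under eq_fun do rewrite big_cons; apply: measurable_funD => //; exact: measurable_Ml.
Qed.

Lemma measurable_simple_fun s : bounded_simple s ->
  measurable_fun setT (simple_fun s : V -> R).
Proof.
rewrite /simple_fun; elim: s => [|p r ih] bs.
  by under eq_fun do rewrite big_nil; exact: measurable_cst.
under eq_fun do rewrite big_cons; apply: measurable_funD.
  apply: measurable_Ml; apply: measurable_indic.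
  by have [] := bs p (mem_head _ _).
by apply: ih => q qr; apply: bs; rewrite inE qr orbT.
Qed.

Lemma L12_simple_fun s : bounded_simple s -> L12 lambda (simple_fun s).
Proof.
move=> bs; split; first exact: measurable_simple_fun.
- exact: (simple_fun_integrable bs (Phi := id)).
- by apply: (simple_fun_integrable bs (Phi := fun x => x ^+ 2)); rewrite expr0n.
Qed.

Variables (re im : R -> R) (v c : R).
Hypothesis hexp : levy_expansion L re im v c.

Lemma excess0 (del : R) : 0 < del -> excess del 0 = 0.
Proof.
by move=> d0; rewrite /excess normr0 sub0r max_r ?expr0n// oppr_le0 ltW.
Qed.

Lemma excess_ge0 (del x : R) : 0 <= excess del x.
Proof. exact: sqr_ge0. Qed.

(** Square root of [excess]; being 1-Lipschitz and dominated by [|x|], it fits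
    [Rintegral_sqr_cvg]. *)
Let pos_part (del x : R) := Num.max (`|x| - del) 0.

Let pos_part_le (del x : R) : 0 < del -> `|pos_part del x| <= `|x|.
Proof.
move=> d0; rewrite /pos_part ger0_norm ?le_max ?lexx ?orbT//.
by rewrite ge_max normr_ge0 andbT gerBl ltW.
Qed.

Let pos_part_lipschitz (del x y : R) : `|pos_part del x - pos_part del y| <= `|x - y|.
Proof.
have := lerB_dist x y; have := lerB_dist y x; rewrite (distrC y x) /pos_part => h1 h2.
rewrite /Num.max; case: ifPn => a; case: ifPn => b; rewrite ler_norml;
  move: a b; rewrite -?leNgt => a b; apply/andP; split; lra.
Qed.

Let measurable_pos_part (del : R) : measurable_fun setT (pos_part del).
Proof.
by apply: measurable_maxr => //; apply: measurable_funB => //; exact: normr_measurable.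
Qed.

Lemma excess_le_sqr (del x : R) : 0 < del -> excess del x <= x ^+ 2.
Proof.
move=> d0; rewrite -(real_normK (num_real x)) /excess -/(pos_part del x).
rewrite -(real_normK (num_real (pos_part del x))) ler_sqr ?nnegrE//.
exact: pos_part_le.
Qed.

Lemma L12_excess (del : R) (h : V -> R) : 0 < del -> L12 lambda h ->
  lambda.-integrable setT (EFin \o (fun u => excess del (h u))).
Proof.
move=> d0 hh; have [mh _ _] := hh.
suff [] : L12 lambda (fun u => pos_part del (h u)) by [].
apply: L12_dominated hh _ _; first exact: measurableT_comp.
by move=> u; exact: pos_part_le.
Qed.

Lemma excess_cvg (del : R) (f_ : nat -> V -> R) (g : V -> R) : 0 < del ->
  L12 lambda g -> (forall n, L12 lambda (f_ n)) ->
  norm12 lambda (fun x => f_ n x - g x) @[n --> \oo] --> 0 ->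
  \int[lambda]_x excess del (f_ n x) @[n --> \oo] --> \int[lambda]_x excess del (g x).
Proof.
by move=> d0; apply: (@Rintegral_sqr_cvg _ _ _ lambda (pos_part del)) => // x; exact: pos_part_le.
Qed.

(** The exponent of the integral is the integral of the exponent over the values of [g], so the
    pointwise remainder integrates. The factor 2 counts the errors of the real and of the imaginary
    part. *)
Lemma simple_cf_estimate s (e del C : R) : bounded_simple s -> 0 < del ->
  second_order_remainder re im v c e del C ->
  let g := simple_fun s : V -> R in
  let m1 := \int[lambda]_u g u in
  let m2 := \int[lambda]_u (g u ^+ 2) in
  let err := 2 * (e * m2 + C * \int[lambda]_u excess del (g u)) in
  `|\int[P]_w cos (simple_sum s w) - expR (- (v / 2 * m2)) * cos (c * m1)| <= err /\
  `|\int[P]_w sin (simple_sum s w) - expR (- (v / 2 * m2)) * sin (c * m1)| <= err.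
Proof.
move=> bs d0 hr; have [v0 re_le0 hcs _] := hexp.
have hr0 : e * 0 ^+ 2 + C * excess del 0 = 0 by rewrite excess0// expr0n/= !mulr0 addr0.
have re0 : re 0 = 0.
  have [] := hr 0; rewrite hr0 expr0n/= mulr0 addr0 normr_le0 => /eqP + _; exact.
have im0 : im 0 = 0.
  have [_] := hr 0; rewrite hr0 mulr0 subr0 normr_le0 => /eqP; exact.
have hg := L12_simple_fun bs; have [mg ig ig2] := hg.
have /= [hc hs] := simple_levy_cos_sin hL bs re0 im0 hcs.
rewrite /= /simple_sum hc hs; set g := simple_fun s.
set a := \int[_]_u re _; set b := \int[_]_u im _.
set m1 := \int[_]_u g u; set m2 := \int[_]_u (g u ^+ 2).
set err := e * m2 + _.
have ire := simple_fun_integrable bs re0; have iim := simple_fun_integrable bs im0.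
have iex := L12_excess d0 hg.
have ierr : lambda.-integrable setT (EFin \o (fun u => e * g u ^+ 2 + C * excess del (g u))).
  by apply: integrableRD; [exact: integrableRZ ig2|exact: integrableRZ iex].
have errE : err = \int[lambda]_u (e * g u ^+ 2 + C * excess del (g u)).
  rewrite (RintegralD measurableT (integrableRZ e ig2) (integrableRZ C iex)).
  by rewrite (RintegralZl _ measurableT ig2) (RintegralZl _ measurableT iex).
have m20 : 0 <= m2 by apply: Rintegral_ge0 => u _; exact: sqr_ge0.
have a0 : a <= 0.
  rewrite -oppr_ge0 -mulN1r -(RintegralZl (-1) measurableT ire).
  by apply: Rintegral_ge0 => u _; rewrite mulN1r oppr_ge0.
have a0' : - (v / 2 * m2) <= 0 by rewrite oppr_le0; apply: mulr_ge0 m20; exact: divr_ge0.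
have ha : `|a - (- (v / 2 * m2))| <= err.
  rewrite opprK errE -(RintegralZl (v / 2) measurableT ig2).
  have i1 := integrableRZ (v / 2) ig2; have i2 := integrableRD ire i1.
  rewrite -RintegralD//; apply: le_trans (le_normr_Rintegral measurableT i2) _.
  apply: le_Rintegral => //; first exact: integrable_norm i2.
  by move=> u _; have [] := hr (g u).
have hb : `|b - c * m1| <= err.
  rewrite errE -(RintegralZl c measurableT ig).
  have i1 := integrableRZ c ig; have i2 := integrableRB iim i1.
  rewrite -RintegralB//; apply: le_trans (le_normr_Rintegral measurableT i2) _.
  apply: le_Rintegral => //; first exact: integrable_norm i2.
  by move=> u _; have [] := hr (g u).
rewrite mulrDl mul1r; split.
  exact: le_trans (expRcos_lipschitz _ _ a0 a0') (lerD ha hb).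
exact: le_trans (expRsin_lipschitz _ _ a0 a0') (lerD ha hb).
Qed.

Let K2 := fun C : R => v + c ^+ 2 + 4 * (1 + C).

(** A crude continuity bound, enough for [null_in_probability_simple]; the exact moments follow
    later, for limits. One fixed precision [e = 1] suffices, and [excess] is bounded by the
    square. *)
Lemma simple_second_moment : exists2 K : R, 0 <= K & forall s, bounded_simple s ->
  let N := norm12 lambda (simple_fun s) in
  (\int[P]_w (simple_sum s w ^+ 2)%:E <= (K * (N + N ^+ 2))%:E)%E.
Proof.
have [v0 re_le0 hcs hrem] := hexp.
have [del [C [d0 C0 hr]]] := hrem 1 ltr01.
have c20 : 0 <= c ^+ 2 by exact: sqr_ge0.
exists (K2 C) => [|s bs]; first by rewrite /K2; lra.
have hg := L12_simple_fun bs; have [mg ig ig2] := hg.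
rewrite /=; set N := norm12 _ _.
set g := simple_fun s in N hg mg ig ig2 *.
pose m1 := \int[lambda]_u g u; pose m2 := \int[lambda]_u (g u ^+ 2).
have m20 : 0 <= m2 by apply: Rintegral_ge0 => u _; exact: sqr_ge0.
(* The first two terms form the exact second moment. The last is the price of [e = 1]: an error
   [2 * (1 + C) * z^2 * m2] in the characteristic function, multiplied by [2 / z^2]. *)
pose M := v * m2 + c ^+ 2 * m1 ^+ 2 + 4 * (1 + C) * m2.
have MN : M <= K2 C * (N + N ^+ 2).
  have N0 : 0 <= N by exact: norm12_ge0.
  have h1 : m2 <= N by exact: sqr_Rintegral_le_norm12.
  have h2 : m1 ^+ 2 <= N ^+ 2.
    rewrite -(real_normK (num_real m1)) ler_sqr ?nnegrE//; exact: norm_Rintegral_le_norm12.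
  have N20 : 0 <= N ^+ 2 by exact: sqr_ge0.
  have p1 : v * m2 <= v * (N + N ^+ 2) by rewrite ler_wpM2l//; lra.
  have p2 : c ^+ 2 * m1 ^+ 2 <= c ^+ 2 * (N + N ^+ 2) by rewrite ler_wpM2l//; lra.
  have p3 : 4 * (1 + C) * m2 <= 4 * (1 + C) * (N + N ^+ 2) by rewrite ler_wpM2l//; lra.
  by rewrite /M /K2 !mulrDl; lra.
apply: (@le_trans _ _ M%:E); last by rewrite lee_fin.
apply: (@fatou_second_moment _ _ _ P (simple_sum s) (fun=> M) M).
- exact: measurable_simple_sum.
- move=> n; rewrite integral_chordE ?lee_fin; last exact: measurable_simple_sum.
  rewrite prob_Rintegral_chord; last exact: measurable_simple_sum.
  set z : R := n.+1%:R^-1.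
  have z0 : 0 < z by rewrite invr_gt0 ltr0n.
  have -> : n.+1%:R = z^-1 :> R by rewrite /z invrK.
  have := @simple_cf_estimate (simple_scale z s) 1 del C (bounded_simple_scale bs) d0 hr.
  rewrite /=; under eq_Rintegral do rewrite simple_sum_scale.
  have -> : \int[lambda]_u simple_fun (simple_scale z s) u = z * m1.
    under eq_Rintegral do rewrite simple_fun_scale.
    by rewrite (RintegralZl _ measurableT ig).
  have -> : \int[lambda]_u (simple_fun (simple_scale z s) u ^+ 2) = z ^+ 2 * m2.
    under eq_Rintegral do rewrite simple_fun_scale exprMn.
    by rewrite (RintegralZl _ measurableT ig2).
  set ex := \int[_]_u excess _ _.
  have exle : ex <= z ^+ 2 * m2.
    rewrite -(RintegralZl _ measurableT ig2); apply: le_Rintegral => //.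
    - by apply: L12_excess => //; apply: L12_simple_fun; exact: bounded_simple_scale.
    - exact: integrableRZ ig2.
    - by move=> u _; apply: le_trans (excess_le_sqr _ d0) _; rewrite simple_fun_scale exprMn.
  move=> [hcos _]; move: hcos.
  move: (\int[P]_w cos _) => I hI.
  have z20 : 0 < z ^+ 2 by rewrite exprn_gt0.
  have s0 : 0 <= v / 2 * (z ^+ 2 * m2).
    apply: mulr_ge0; first exact: divr_ge0.
    by apply: mulr_ge0 m20; exact: ltW.
  have e1 := expR_ge1Dx (- (v / 2 * (z ^+ 2 * m2))).
  have e2 : expR (- (v / 2 * (z ^+ 2 * m2))) <= 1 by rewrite -[leRHS]expR0 ler_expR oppr_le0.
  have e3 := onem_cos_le (c * (z * m1)); have e4 := onem_cos_ge0 (c * (z * m1)).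
  have e5 := expR_ge0 (- (v / 2 * (z ^+ 2 * m2))).
  have Cex : C * ex <= C * (z ^+ 2 * m2) by rewrite ler_wpM2l.
  have hE : 1 - expR (- (v / 2 * (z ^+ 2 * m2))) * cos (c * (z * m1)) <=
      v / 2 * (z ^+ 2 * m2) + (c * (z * m1)) ^+ 2 / 2.
    have p1 : 0 <= (1 - expR (- (v / 2 * (z ^+ 2 * m2)))) * (1 - cos (c * (z * m1))).
      by rewrite mulr_ge0// subr_ge0.
    by move: e1 e2 e3 e4 e5 p1; move: (expR _) (cos _) (_ ^+ 2 / 2) => E co x2; lra.
  have h1I : 1 - I <= v / 2 * (z ^+ 2 * m2) + (c * (z * m1)) ^+ 2 / 2 +
      2 * (z ^+ 2 * m2 + C * (z ^+ 2 * m2)).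
    move: hI; rewrite ler_norml => /andP[hI1 hI2].
    by move: hE hI1; move: (expR _ * cos _) => E; lra.
  have -> : M = z^-1 ^+ 2 * (z ^+ 2 * M) by rewrite mulrA -exprMn mulVf ?gt_eqF// expr1n mul1r.
  rewrite [leLHS](_ : _ = z^-1 ^+ 2 * (2 * (1 - I))); last by ring.
  rewrite ler_wpM2l ?sqr_ge0//.
  rewrite [z ^+ 2 * M](_ : _ = 2 * (v / 2 * (z ^+ 2 * m2) + (c * (z * m1)) ^+ 2 / 2 +
      2 * (z ^+ 2 * m2 + C * (z ^+ 2 * m2)))); last by rewrite /M; field.
  by rewrite ler_wpM2l.
- exact: cvg_cst.
Qed.

Lemma null_in_probability_simple (s t : nat -> seq (R * set V)) :
  (forall n, bounded_simple (s n)) -> (forall n, bounded_simple (t n)) ->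
  norm12 lambda (fun u => simple_fun (s n) u - simple_fun (t n) u) @[n --> \oo] --> 0 ->
  null_in_probability P (fun n w => simple_sum (s n) w - simple_sum (t n) w).
Proof.
move=> bs bt hN; have [K K0 hK] := simple_second_moment.
pose r n := s n ++ simple_scale (-1) (t n).
have br n : bounded_simple (r n).
  by apply: bounded_simple_cat => //; exact: bounded_simple_scale.
have rw n w : simple_sum (r n) w = simple_sum (s n) w - simple_sum (t n) w.
  by rewrite simple_sum_cat simple_sum_scale mulN1r.
have ru n : simple_fun (r n) = (fun u : V => simple_fun (s n) u - simple_fun (t n) u).
  by apply/funext => u; rewrite simple_fun_cat simple_fun_scale mulN1r.
apply: null_in_probability_eq rw _.
pose N n := norm12 lambda (simple_fun (r n)).
apply: (@null_in_probability_L2 _ _ _ _ _ (fun n => K * (N n + N n ^+ 2))).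
- by move=> n; exact: measurable_simple_sum.
- by move=> n; exact: hK.
have N0 : N n @[n --> \oo] --> 0 by rewrite /N; under eq_fun do rewrite ru.
rewrite -[X in _ --> X](mulr0 K); apply: cvgMr.
rewrite -[X in _ --> X](addr0 0); apply: cvgD => //.
by have := cvgM N0 N0; rewrite mulr0; exact.
Qed.

End simple_integrals.

(** * Integrals as limits of integrals of simple functions *)

Section null12.
Context {d} {X : measurableType d} {R : realType} (mu : {measure set X -> \bar R}).
Implicit Types f g : nat -> X -> R.

Definition null12 f := (forall n, L12 mu (f n)) /\ norm12 mu (f n) @[n --> \oo] --> 0.

Lemma null12_dominated f g : null12 g -> (forall n, measurable_fun setT (f n)) ->
  (forall n x, `|f n x| <= `|g n x|) -> null12 f.
Proof.
move=> [hg g0] mf fg; have hf n : L12 mu (f n) by exact: L12_dominated (hg n) _ _.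
split=> //; apply: squeeze_cvgr (cvg_cst 0) g0; near=> n.
by rewrite norm12_ge0/= le_norm12.
Unshelve. all: end_near. Qed.

Lemma null12_normD f g : null12 f -> null12 g -> null12 (fun n x => `|f n x| + `|g n x|).
Proof.
move=> [hf f0] [hg g0]; have hfg n := L12D (L12_norm (hf n)) (L12_norm (hg n)).
split=> //; apply: (@squeeze_cvgr _ _ _ _ (fun=> 0)
    (fun n => 2 * norm12 mu (f n) + 2 * norm12 mu (g n))).
- near=> n; rewrite norm12_ge0/=.
  apply: le_trans (norm12D (L12_norm (hf n)) (L12_norm (hg n))) _.
  by rewrite lerD// ler_wpM2l// le_norm12 => // [|x||x]; rewrite ?normr_id//; exact: L12_norm.
- exact: cvg_cst.
- rewrite -[X in _ --> X](addr0 0) -[X in _ --> X + _](mulr0 2) -[X in _ --> _ + X](mulr0 2).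
  by apply: cvgD; apply: cvgMr.
Unshelve. all: end_near. Qed.

Lemma null12_rate f : (forall n, L12 mu (f n)) ->
  (forall n, norm12 mu (f n) <= n.+1%:R^-1) -> null12 f.
Proof.
move=> hf fn; split=> //; apply: squeeze_cvgr (cvg_cst 0) (@cvg_harmonic R); near=> n.
by rewrite norm12_ge0/=; exact: fn.
Unshelve. all: end_near. Qed.

Lemma null12_comp f (phi : nat -> nat) : (forall n, (n <= phi n)%N) -> null12 f ->
  null12 (fun n => f (phi n)).
Proof.
move=> phin [hf f0]; split=> // A /f0[N _ NA]; exists N => // n /= Nn.
by apply: NA => /=; exact: leq_trans Nn (phin n).
Qed.

(* [B] collects every other increment of [E]: on [E (k j.+1) `\` E (k j)], where
   [g_ (n j)] is out of control, one of two consecutive indices sees [B] and the other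
   does not. *)
Lemma gliding_hump (g_ : nat -> X -> R) (g : X -> R) (E : nat -> set X) :
  L12 mu g -> (forall n, L12 mu (g_ n)) -> (forall k, measurable (E k)) ->
  (forall k l, (k <= l)%N -> E k `<=` E l) ->
  (forall k, norm12 mu (fun x => (g_ n x - g x) * \1_(E k) x) @[n --> \oo] --> 0) ->
  (forall n, norm12 mu (fun x => g_ n x * \1_(~` E k) x) @[k --> \oo] --> 0) ->
  norm12 mu (fun x => g x * \1_(~` E k) x) @[k --> \oo] --> 0 ->
  exists n n' k : nat -> nat, exists B : set X,
  [/\ forall i, (i <= n i)%N, forall i, (i <= n' i)%N, measurable B,
      null12 (fun i x => g_ (n i) x * \1_(E (k i)) x - g x) &
      null12 (fun i x => g_ (n i) x * \1_(E (k i)) x - g_ (n i) x +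
                         (g_ (n i) x * \1_B x - g_ (n' i) x * \1_B x))].
Proof.
move=> hg hg_ mE ndE gE g_E gE0.
have close (u : nat -> R) (j m : nat) : u n @[n --> \oo] --> 0 ->
    exists n, (m <= n)%N /\ `|u n| <= j.+1%:R^-1.
  move=> /cvgrPdist_le /(_ j.+1%:R^-1); rewrite invr_gt0 ltr0n => /(_ isT)[N _ hN].
  exists (maxn m N); split; first exact: leq_maxl.
  by have := hN _ (leq_maxr m N); rewrite sub0r normrN.
(* [g_ (nu k)] is close to [g] on [E k], and then [ka k] is so large that [g_ (nu k)] is negligible
   off [E (ka k)]; iterating [ka] gives the levels [kk]. *)
have /choice[nu hnu] k := close _ k k (gE k).
have /choice[ka hka] k := close _ k k.+1 (g_E (nu k)).
pose kk j := iter j ka 0%N.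
have kk_lt j : (kk j < kk j.+1)%N by have [] := hka (kk j).
have kk_ge j : (j <= kk j)%N by elim: j => // j ih; exact: leq_ltn_trans ih (kk_lt j).
have kk_le i j : (i <= j)%N -> (kk i <= kk j)%N.
  elim: j => [|j ih]; first by rewrite leqn0 => /eqP ->.
  rewrite leq_eqVlt => /predU1P[->//|]; rewrite ltnS => /ih ij.
  exact: leq_trans ij (ltnW (kk_lt j)).
pose h j := g_ (nu (kk j)).
have hC k : measurable (~` E k) by exact: measurableC.
have rate j : j.+1%:R^-1 >= (kk j).+1%:R^-1 :> R.
  by rewrite lef_pV2 ?posrE// ler_nat ltnS.
have nE : null12 (fun j x => (h j x - g x) * \1_(E (kk j)) x).
  apply: null12_rate => j; first exact: (L12_indic (mE _) (L12B (hg_ _) hg)).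
  exact: le_trans (le_trans (ler_norm _) (hnu (kk j)).2) (rate j).
have nC : null12 (fun j x => h j x * \1_(~` E (kk j.+1)) x).
  apply: null12_rate => j; first exact: (L12_indic (hC _) (hg_ _)).
  exact: le_trans (le_trans (ler_norm _) (hka (kk j)).2) (rate j).
have ng : null12 (fun j x => g x * \1_(~` E (kk j)) x).
  apply: (@null12_comp (fun k x => g x * \1_(~` E k) x)) => //; split=> // k.
  exact: (L12_indic (hC _) hg).
have dbl i : (i <= i.*2)%N by rewrite -addnn leq_addr.
pose B := \bigcup_i (E (kk i.*2.+1) `\` E (kk i.*2)).
have mB : measurable B by apply: bigcupT_measurable => i; exact: measurableD.
exists (fun i => nu (kk i.*2)), (fun i => nu (kk i.*2.+1)), (fun i => kk i.*2), B.
have nun k : (k <= nu k)%N by have [] := hnu k.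
split=> //.
- by move=> i; apply: leq_trans (nun _); apply: leq_trans (kk_ge _).
- by move=> i; apply: leq_trans (nun _); apply: leq_trans (kk_ge _); exact: leqW.
- have := null12_normD (null12_comp dbl nE) (null12_comp dbl ng).
  move/null12_dominated; apply=> [i|i x].
    by have [] := L12B (L12_indic (mE (kk i.*2)) (hg_ (nu (kk i.*2)))) hg.
  rewrite -/(h i.*2) [leRHS]ger0_norm ?addr_ge0// !indicE in_setC.
  by case: (x \in _) => /=; rewrite !(mulr1, mulr0, normr0, addr0, add0r, sub0r, normrN).
have dblS i : (i <= i.*2.+1)%N by exact: leqW.
(* Pointwise, with [j = i.*2]: on [E (kk j)] what is left is [h j - h j.+1] or 0, and both are close
   to [g]. On the next shell, inside [B], [- h j.+1] is left, which is close to [- g], itself small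
   off [E (kk j)]. On the shell after that, outside [B], [- h j] is left, which is small off
   [E (kk j.+1)]. Farther out [h j] and [h j.+1] are both small. *)
have := null12_normD (null12_normD (null12_normD (null12_normD
  (null12_comp dbl nE) (null12_comp dblS nE)) (null12_comp dbl ng))
  (null12_comp dbl nC)) (null12_comp dblS nC).
move/null12_dominated; apply=> [i|i x].
  have [] // : L12 mu (fun x => h i.*2 x * \1_(E (kk i.*2)) x - h i.*2 x +
    (h i.*2 x * \1_B x - h i.*2.+1 x * \1_B x)).
  apply: L12D; first exact: (L12B (L12_indic (mE _) (hg_ _)) (hg_ _)).
  exact: (L12B (L12_indic mB (hg_ _)) (L12_indic mB (hg_ _))).
have nn (a b : R) : `| `|a| + `|b| | = `|a| + `|b| by rewrite ger0_norm ?addr_ge0.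
rewrite -/(h i.*2) -/(h i.*2.+1) !nn !indicE !in_setC.
have s01 : x \in E (kk i.*2) -> x \in E (kk i.*2.+1).
  by rewrite !inE; apply: ndE; exact: kk_le.
have s12 : x \in E (kk i.*2.+1) -> x \in E (kk i.*2.+2).
  by rewrite !inE; apply: ndE; exact: kk_le.
have b1 : x \in E (kk i.*2.+1) -> x \notin E (kk i.*2) -> x \in B.
  by rewrite notin_setE !inE => x1 x0; exists i.
have b2 : x \in E (kk i.*2.+2) -> x \notin E (kk i.*2.+1) -> x \notin B.
  rewrite !notin_setE !inE => x2 x1 [j _ [xj1 xj0]].
  have [ij|ij] := leqP j i.
    by apply: x1; apply: ndE xj1; apply: kk_le; rewrite ltnS leq_double.
  by apply: xj0; apply: ndE x2; apply: kk_le; rewrite -doubleS leq_double.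
move: s01 s12 b1 b2; move: (h _ x) (h _ x) (g x) => y z w.
have t1 : `|z - y| <= `|z - w| + `|y - w| by rewrite (distrC y); exact: ler_distD.
have t2 : `|y| <= `|y - w| + `|w| by rewrite -[X in `|X| <= _](subrK w) ler_normD.
have n1 := normr_ge0 y; have n2 := normr_ge0 z; have n3 := normr_ge0 w.
have n4 := normr_ge0 (y - w); have n5 := normr_ge0 (z - w).
case: (x \in E (kk i.*2)) => /=; case: (x \in E (kk i.*2.+1)) => /=;
case: (x \in E (kk i.*2.+2)) => /=; case: (x \in B) => //= s01 s12 b1 b2;
  do ?[by have := s01 isT|by have := s12 isT|by have := b1 isT isT|by have := b2 isT isT];
  rewrite ?(mulr1, mulr0, normr0, addr0, add0r, subr0, sub0r, subrr, addKr, normrN, oppr0); lra.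
Qed.

End null12.

Section levy_integral.
Context {dT : measure_display} {T : measurableType dT} {R : realType}.
Context {P : probability T R} {d : nat}.
Local Notation V := 'rV[R]_d.
Local Notation lambda := (@lebesgue_rV R d).
Variable L : set V -> {RV P >-> R}.
Hypothesis hL : levy_basis L.
Variables (re im : R -> R) (v c : R).
Hypothesis hexp : levy_expansion L re im v c.

(** The new approximants are the given ones cut to the sets [E k]. That their integrals still tend
    to [Y] uses the convergence over the set [B] of [gliding_hump], which depends on the sequence
    itself. *)
Lemma levy_integral_simple (g : V -> R) (Y : {RV P >-> R}) : L12 lambda g ->
  is_levy_integral L g setT Y ->
  exists s : nat -> seq (R * set V), [/\ forall n, bounded_simple (s n),
    norm12 lambda (fun u => simple_fun (s n) u - g u) @[n --> \oo] --> 0 &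
    cvg_in_probability P (fun n => simple_sum L (s n)) Y].
Proof.
move=> hg [_ [s [bs sg sB sY]]]; have [mg _ _] := hg.
pose g_ n : V -> R := simple_fun (s n).
have bsn n : bounded_simple (s n) by move=> p; exact: bs.
have hg_ n : L12 lambda (g_ n) by exact: L12_simple_fun.
have mg_ n : measurable_fun setT (g_ n) by exact: measurable_simple_fun.
(* The bound holds for all [n] at once. Where [g_ n u] converges it is bounded in [n], so almost
   every [u] lies in [E k] for all large [k]. *)
pose E (k : nat) : set V := [set u | `|u| <= k%:R] `&` \bigcap_n [set u | `|g_ n u| <= k%:R].
have mE k : measurable (E k).
  apply: measurableI; first exact: measurable_box.
  apply: bigcap_measurable => [|n _]; first by exists 0%N.
  rewrite (_ : mkset _ = (fun u => `|g_ n u|) @^-1` `]-oo, k%:R]); last first.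
    by apply/seteqP; split=> u; rewrite /= in_itv.
  by rewrite -[X in measurable X]setTI; apply: measurableT_comp.
have ndE k l : (k <= l)%N -> E k `<=` E l.
  move=> kl u [uk gk]; split => [|n _] /=.
    by apply: le_trans uk _; rewrite ler_nat.
  by apply: le_trans (gk n I) _; rewrite ler_nat.
have Eae : {ae lambda, forall u, \forall k \near \oo, E k u}.
  apply: filterS sg => u gu.
  have /cvg_seq_bounded[M [_ hM]] : cvg (g_ n u @[n --> \oo]) by apply/cvg_ex; exists (g u).
  have hM1 n : `|g_ n u| <= `|M| + 1.
    by apply: (hM (`|M| + 1)) => //; apply: le_lt_trans (ler_norm _) _; rewrite ltrDl.
  pose K := (Num.truncn (`|u| + (`|M| + 1))).+1.
  have uK : `|u| + (`|M| + 1) <= K%:R by apply/ltW/truncnS_gt.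
  exists K => // k /= Kk; have kK : K%:R <= k%:R :> R by rewrite ler_nat.
  have M0 := normr_ge0 M; have u0 := normr_ge0 u.
  by split=> [|n _] /=; [|apply: le_trans (hM1 n) _]; lra.
have off (h : V -> R) : L12 lambda h ->
    norm12 lambda (fun x => h x * \1_(~` E k) x) @[k --> \oo] --> 0.
  move=> hh; have [mh _ _] := hh; apply: (norm12_cvg0 hh).
  - by move=> k; apply: measurable_funM => //; apply: measurable_indic; exact: measurableC.
  - move=> k u; rewrite normrM indicE; case: (_ \in _); rewrite ?normr1 ?normr0 ?mulr1 ?mulr0//.
  apply: filterS Eae => u Eu; apply: cvg_near_cst; apply: filterS Eu => k Eku.
  by rewrite indicE memNset ?mulr0//; apply/negP; rewrite notin_setE /=; apply; rewrite inE.
have gE k : norm12 lambda (fun x => (g_ n x - g x) * \1_(E k) x) @[n --> \oo] --> 0.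
  (* On [E k] all [g_ n] are bounded by [k] and live on one ball, so a single function in L^1 and
     L^2 dominates the differences. *)
  pose G u := k%:R * \1_[set u : V | `|u| <= k%:R] u + `|g u|.
  have hG : L12 lambda G.
    apply: L12D (L12_norm hg); have := @L12_simple_fun R d [:: (k%:R, [set u : V | `|u| <= k%:R])].
    rewrite (_ : simple_fun _ = (fun u => k%:R * \1_[set u : V | `|u| <= k%:R] u)).
      by apply=> p; rewrite inE => /eqP->; exact: bounded_borel_box.
    by apply/funext => u; rewrite /simple_fun big_seq1.
  apply: (norm12_cvg0 hG) => [n|n u|].
  - apply: measurable_funM; first exact: measurable_funB.
    by apply: measurable_indic.
  - have [[uk gk]|Eu] := pselect (E k u); last first.
      by rewrite indicE memNset// mulr0 normr0.
    rewrite /G !indicE !mem_set// !mulr1 [leRHS]ger0_norm ?addr_ge0//.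
    by apply: le_trans (ler_normB _ _) _; rewrite lerD2r; exact: gk.
  - apply: filterS sg => u gu; rewrite -[X in _ --> X](mul0r (\1_(E k) u)).
    by apply: cvgMl; rewrite subr_cvg0.
have [n [n' [k [B [ni n'i mB [_ nA] [_ nR]]]]]] :=
  gliding_hump hg hg_ mE ndE gE (fun n => off _ (hg_ n)) (off _ hg).
pose res n A := simple_restrict (s n) A.
have bres m A : measurable A -> bounded_simple (res m A).
  by move=> mA; exact: bounded_simple_restrict.
exists (fun i => res (n i) (E (k i))); split=> [i||]; first exact: bres.
  rewrite (_ : (fun i => _) = (fun i => norm12 lambda
    (fun x => g_ (n i) x * \1_(E (k i)) x - g x)))//.
  by apply/funext => i; congr norm12; apply/funext => u; rewrite simple_fun_restrict.
have [Z hZ] := sB B mB.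
have nY := null_in_probability_subseq ni (cvg_in_probabilityB sY).
have nZ := null_in_probability_subseq ni (cvg_in_probabilityB hZ).
have nZ' := null_in_probability_subseq n'i (cvg_in_probabilityB hZ).
(* Writing [S m A] for the integral of [s m] over [A], the difference [S n E - Y] is [(r1 - r2) + (S
   n setT - Y) - (S n B - Z) + (S n' B - Z)], a sum of four null sequences. *)
pose r1 i := res (n i) (E (k i)) ++ res (n i) B.
pose r2 i := res (n i) setT ++ res (n' i) B.
have br1 i : bounded_simple (r1 i) by apply: bounded_simple_cat; exact: bres.
have br2 i : bounded_simple (r2 i) by apply: bounded_simple_cat; exact: bres.
have nr : null_in_probability P (fun i w => simple_sum L (r1 i) w - simple_sum L (r2 i) w).
  apply: (null_in_probability_simple hL hexp) => //.
  rewrite (_ : (fun i => _) = (fun i => norm12 lambda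
    (fun x => g_ (n i) x * \1_(E (k i)) x - g_ (n i) x +
      (g_ (n i) x * \1_B x - g_ (n' i) x * \1_B x))))//.
  apply/funext => i; congr norm12; apply/funext => u.
  rewrite !simple_fun_cat !simple_fun_restrict indicT /= mulr1 /g_.
  by ring.
have mI m A : measurable_fun setT (simple_integral L (s m) A).
  by rewrite -(funext (simple_sum_restrict L (s m) A)); exact: measurable_simple_sum.
have mSY m : measurable_fun setT (fun w => simple_integral L (s m) setT w - Y w).
  exact: measurable_funB.
have mSZ m : measurable_fun setT (fun w => simple_integral L (s m) B w - Z w).
  exact: measurable_funB.
have mr i : measurable_fun setT (fun w => simple_sum L (r1 i) w - simple_sum L (r2 i) w).
  by apply: measurable_funB; exact: measurable_simple_sum.
have mSZN m : measurable_fun setT (fun w => - (simple_integral L (s m) B w - Z w)).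
  exact: measurableT_comp.
have := null_in_probabilityD (fun i => measurable_funD (mr i) (mSY (n i)))
  (fun i => measurable_funD (mSZN (n i)) (mSZ (n' i)))
  (null_in_probabilityD mr (fun i => mSY (n i)) nr nY)
  (null_in_probabilityD (fun i => mSZN (n i)) (fun i => mSZ (n' i))
    (null_in_probabilityN nZ) nZ').
move=> h e e0; have := h e e0; apply: cvg_trans; apply: near_eq_cvg; apply: nearW => i.
congr (P _); apply/seteqP; split=> w /=; rewrite subr0 /r1 /r2 !simple_sum_cat !simple_sum_restrict;
  rewrite (_ : _ + _ + _ = simple_integral L (s (n i)) (E (k i)) w - Y w)//; ring.
Qed.

End levy_integral.

Section simple_limit.
Context {dT : measure_display} {T : measurableType dT} {R : realType}.
Context {P : probability T R} {d : nat}.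
Local Notation V := 'rV[R]_d.
Local Notation lambda := (@lebesgue_rV R d).
Variable L : set V -> {RV P >-> R}.

(** The working notion of integral over the whole space: the approximants converge in L^1 and L^2,
    so characteristic function estimates pass to the limit, and finite linear combinations inherit
    it. *)
Definition simple_limit (g : V -> R) (Y : T -> R) := [/\ L12 lambda g,
  measurable_fun setT Y & exists s : nat -> seq (R * set V),
  [/\ forall n, bounded_simple (s n),
    norm12 lambda (fun u => simple_fun (s n) u - g u) @[n --> \oo] --> 0 &
    cvg_in_probability P (fun n => simple_sum L (s n)) Y]].

Lemma simple_limit0 : simple_limit (fun=> 0) (fun=> 0).
Proof.
split=> //; first exact: L12_0.
exists (fun=> [::]); split=> //.
  rewrite (_ : (fun _ => _) = fun=> 0); first exact: cvg_cst.
  apply/funext => n; rewrite /norm12 /simple_fun.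
  under eq_Rintegral do rewrite big_nil subrr normr0.
  under [X in _ + X]eq_Rintegral do rewrite big_nil subrr expr0n.
  by rewrite !Rintegral_cst// !mul0r addr0.
move=> e e0; rewrite (_ : (fun _ => _) = fun=> 0%E); first exact: cvg_cst.
apply/funext => n; rewrite (_ : mkset _ = set0) ?measure0//.
by rewrite -subset0 => w /=; rewrite /simple_sum big_nil subrr normr0 leNgt e0.
Qed.

Lemma cvg_in_probability_null (Y : nat -> T -> R) (Z : T -> R) :
  null_in_probability P (fun n w => Y n w - Z w) -> cvg_in_probability P Y Z.
Proof.
move=> hY e e0; have := hY e e0; apply: cvg_trans; apply: near_eq_cvg; apply: nearW => n.
by congr (P _); apply/seteqP; split=> w /=; rewrite subr0.
Qed.

Lemma simple_limitD g h Y Z : simple_limit g Y -> simple_limit h Z ->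
  simple_limit (fun u => g u + h u) (fun w => Y w + Z w).
Proof.
move=> [hg mY [s [bs sg sY]]] [hh mZ [t [bt th tZ]]].
split; [exact: L12D|exact: measurable_funD|exists (fun n => s n ++ t n); split].
- by move=> n; exact: bounded_simple_cat.
- have ls n : L12 lambda (fun u => simple_fun (s n) u - g u).
    exact: (L12B (L12_simple_fun (bs n)) hg).
  have lt n : L12 lambda (fun u => simple_fun (t n) u - h u).
    exact: (L12B (L12_simple_fun (bt n)) hh).
  rewrite (_ : (fun n => _) = (fun n => norm12 lambda
      (fun u => simple_fun (s n) u - g u + (simple_fun (t n) u - h u)))); last first.
    by apply/funext => n; congr norm12; apply/funext => u; rewrite simple_fun_cat; ring.
  have b0 : 2 * norm12 lambda (fun u => simple_fun (s n) u - g u) +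
      2 * norm12 lambda (fun u => simple_fun (t n) u - h u) @[n --> \oo] --> 0.
    rewrite -[X in _ --> X](addr0 0) -[X in _ --> X + _](mulr0 2) -[X in _ --> _ + X](mulr0 2).
    by apply: cvgD; apply: cvgMr.
  apply: (squeeze_cvgr _ (cvg_cst 0) b0); near=> n.
  by rewrite norm12_ge0/= norm12D.
- have mS (r : nat -> seq (R * set V)) (U : T -> R) n : measurable_fun setT U ->
      measurable_fun setT (fun w => simple_sum L (r n) w - U w).
    by move=> mU; apply: measurable_funB => //; exact: measurable_simple_sum.
  have := null_in_probabilityD (fun n => mS s Y n mY) (fun n => mS t Z n mZ)
    (cvg_in_probabilityB sY) (cvg_in_probabilityB tZ).
  move/null_in_probability_eq => nE; apply/cvg_in_probability_null/nE => n w.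
  by rewrite simple_sum_cat; ring.
Unshelve. all: end_near. Qed.

Lemma simple_limitZ k g Y : simple_limit g Y ->
  simple_limit (fun u => k * g u) (fun w => k * Y w).
Proof.
move=> [hg mY [s [bs sg sY]]].
split; [exact: L12Z|exact: measurable_Ml|exists (fun n => simple_scale k (s n)); split].
- by move=> n; exact: bounded_simple_scale.
- have ls n : L12 lambda (fun u => simple_fun (s n) u - g u).
    exact: (L12B (L12_simple_fun (bs n)) hg).
  have E n : norm12 lambda (fun u => simple_fun (simple_scale k (s n)) u - k * g u) =
      `|k| * \int[lambda]_u `|simple_fun (s n) u - g u| +
      k ^+ 2 * \int[lambda]_u ((simple_fun (s n) u - g u) ^+ 2).
    have [_ i1 i2] := ls n.
    rewrite -(RintegralZl _ measurableT (integrable_norm i1)) -(RintegralZl _ measurableT i2).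
    by congr (_ + _); apply: eq_Rintegral => u _; rewrite simple_fun_scale -mulrBr ?normrM ?exprMn.
  under eq_fun do rewrite E.
  have b0 : (`|k| + k ^+ 2) * norm12 lambda (fun u => simple_fun (s n) u - g u) @[n --> \oo] --> 0.
    by rewrite -[X in _ --> X](mulr0 (`|k| + k ^+ 2)); exact: cvgMr.
  apply: (squeeze_cvgr _ (cvg_cst 0) b0); near=> n.
  have k20 := sqr_ge0 k; have k0 := normr_ge0 k.
  have i10 : 0 <= \int[lambda]_u `|simple_fun (s n) u - g u| by exact: Rintegral_ge0.
  have i20 : 0 <= \int[lambda]_u ((simple_fun (s n) u - g u) ^+ 2).
    by apply: Rintegral_ge0 => u _; exact: sqr_ge0.
  rewrite /norm12; apply/andP; split; first by rewrite addr_ge0// mulr_ge0.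
  by rewrite mulrDl !mulrDr; have := mulr_ge0 k0 i20; have := mulr_ge0 k20 i10; lra.
- apply: cvg_in_probability_null => e e0.
  have [->|k0] := eqVneq k 0.
    rewrite (_ : (fun _ => _) = fun=> 0%E); first exact: cvg_cst.
    apply/funext => n; rewrite (_ : mkset _ = set0) ?measure0//.
    by rewrite -subset0 => w /=; rewrite simple_sum_scale !mul0r !subrr normr0 leNgt e0.
  have kp : 0 < `|k| by rewrite normr_gt0.
  have := sY (e / `|k|); rewrite divr_gt0// => /(_ isT).
  apply: cvg_trans; apply: near_eq_cvg; apply: nearW => n.
  congr (P _); apply/seteqP; split=> w /=;
    by rewrite simple_sum_scale subr0 -mulrBr normrM ler_pdivrMr// mulrC.
Unshelve. all: end_near. Qed.

Lemma simple_limit_sum (I : Type) (r : seq I) (g : I -> V -> R) (Y : I -> T -> R) :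
  (forall i, simple_limit (g i) (Y i)) ->
  simple_limit (fun u => \sum_(i <- r) g i u) (fun w => \sum_(i <- r) Y i w).
Proof.
move=> h; elim: r => [|i r ih].
  under [X in simple_limit X]eq_fun do rewrite big_nil.
  by under [X in simple_limit _ X]eq_fun do rewrite big_nil; exact: simple_limit0.
under [X in simple_limit X]eq_fun do rewrite big_cons.
by under [X in simple_limit _ X]eq_fun do rewrite big_cons; exact: simple_limitD.
Qed.

Hypothesis hL : levy_basis L.
Variables (re im : R -> R) (v c : R).
Hypothesis hexp : levy_expansion L re im v c.

(** Every term of the estimate for simple functions is continuous along the approximation: the
    left-hand sides since cosine and sine are bounded and Lipschitz, the [excess] term by
    [excess_cvg]. *)
Lemma cf_estimate g Y (e del C : R) : simple_limit g Y -> 0 < del ->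
  second_order_remainder re im v c e del C ->
  let m1 := \int[lambda]_u g u in
  let m2 := \int[lambda]_u (g u ^+ 2) in
  let err := 2 * (e * m2 + C * \int[lambda]_u excess del (g u)) in
  `|\int[P]_w cos (Y w) - expR (- (v / 2 * m2)) * cos (c * m1)| <= err /\
  `|\int[P]_w sin (Y w) - expR (- (v / 2 * m2)) * sin (c * m1)| <= err.
Proof.
move=> [hg mY [s [bs sg sY]]] d0 hr /=.
have ls n : L12 lambda (simple_fun (s n)) by exact: L12_simple_fun.
have mS n := @measurable_simple_sum _ _ _ P _ L (s n).
have c1 : \int[lambda]_u simple_fun (s n) u @[n --> \oo] --> \int[lambda]_u g u.
  apply/subr_cvg0/norm_cvg0P; apply: (squeeze_cvgr _ (cvg_cst 0) sg); near=> n.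
  have [_ i1 _] := ls n; have [_ i2 _] := hg.
  rewrite normr_ge0 -RintegralB//=; apply: norm_Rintegral_le_norm12.
  exact: (L12B (ls n) hg).
have c2 : \int[lambda]_u (simple_fun (s n) u ^+ 2) @[n --> \oo] --> \int[lambda]_u (g u ^+ 2).
  by apply: (@Rintegral_sqr_cvg _ _ _ lambda id).
have c3 := excess_cvg d0 hg ls sg.
have cerr : 2 * (e * \int[lambda]_u (simple_fun (s n) u ^+ 2) +
    C * \int[lambda]_u excess del (simple_fun (s n) u)) @[n --> \oo] -->
    2 * (e * \int[lambda]_u (g u ^+ 2) + C * \int[lambda]_u excess del (g u)).
  by apply: cvgMr; apply: cvgD; apply: cvgMr.
have cE : expR (- (v / 2 * \int[lambda]_u (simple_fun (s n) u ^+ 2))) @[n --> \oo] -->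
    expR (- (v / 2 * \int[lambda]_u (g u ^+ 2))).
  by apply: continuous_cvg; [exact: continuous_expR|apply: cvgN; apply: cvgMr].
have cc (F : R -> R) : continuous F -> F (c * \int[lambda]_u simple_fun (s n) u) @[n --> \oo] -->
    F (c * \int[lambda]_u g u).
  by move=> cF; apply: continuous_cvg; [exact: cF|apply: cvgMr].
split.
  apply: (ler_cvg_to _ cerr).
    2: by apply: nearW => n; exact: (simple_cf_estimate hL hexp (bs n) d0 hr).1.
  apply: cvg_norm; apply: cvgB; last by apply: cvgM => //; exact: cc (@continuous_cos R).
  apply: cvg_in_probability_Rintegral => //.
  - by apply: continuous_measurable_fun; exact: continuous_cos.
  - exact: norm_cos_le1.
  - exact: norm_cosB_le.
apply: (ler_cvg_to _ cerr).
  2: by apply: nearW => n; exact: (simple_cf_estimate hL hexp (bs n) d0 hr).2.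
apply: cvg_norm; apply: cvgB; last by apply: cvgM => //; exact: cc (@continuous_sin R).
apply: cvg_in_probability_Rintegral => //.
- by apply: continuous_measurable_fun; exact: continuous_sin.
- exact: norm_sin_le1.
- exact: norm_sinB_le.
Unshelve. all: end_near. Qed.

Lemma excess_scale (del z x : R) : 0 < z -> excess del (z * x) = z ^+ 2 * excess (del / z) x.
Proof.
move=> z0; rewrite /excess -exprMn maxr_pMr ?ltW// mulr0 mulrBr normrM gtr0_norm//.
by rewrite [z * (_ / _)]mulrC divfK ?gt_eqF.
Qed.

(** The threshold tends to infinity, so at each point the integrand is eventually 0, under the
    dominating function [g^2]. *)
Lemma excess_near0 g (del : R) : 0 < del -> L12 lambda g ->
  \int[lambda]_u excess (del / n.+1%:R^-1) (g u) @[n --> \oo] --> 0.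
Proof.
move=> d0 hg; have [mg _ ig2] := hg.
have dn n : 0 < del / n.+1%:R^-1 by rewrite divr_gt0// invr_gt0.
have E0 : 0 = \int[lambda]_u (0 : R) by rewrite Rintegral_cst// mul0r.
rewrite [X in _ --> X]E0.
apply: (@Rintegral_dominated_cvg _ _ _ lambda
  (fun n u => excess (del / n.+1%:R^-1) (g u)) (fun=> 0) (fun u => g u ^+ 2)) => //.
- move=> n; have /integrableP[/measurable_EFinP + _] := L12_excess (dn n) hg; exact.
- apply/aeW => u; apply: cvg_near_cst; near=> n; rewrite /excess invrK max_r ?expr0n//.
  rewrite subr_le0 mulrC -ler_pdivrMr//; near: n.
  exists (Num.truncn (`|g u| / del)).+1 => // n /= hn.
  apply: le_trans (ltW (truncnS_gt _)) _; rewrite ler_nat; exact: leqW.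
- by apply/aeW => u n; rewrite ger0_norm ?excess_ge0// excess_le_sqr.
Unshelve. all: end_near. Qed.

(** The estimate is applied to [z * g] with [z] tending to 0. Scaling extracts [z^2] and raises the
    threshold of [excess] to [del / z], so the error is o(z^2) and [moments_of_expansion]
    applies. *)
Lemma simple_limit_moments g Y : simple_limit g Y ->
  [/\ P.-integrable setT (EFin \o (fun w => Y w ^+ 2)),
      \int[P]_w Y w = c * \int[lambda]_u g u &
      \int[P]_w (Y w ^+ 2) = v * \int[lambda]_u (g u ^+ 2) + (c * \int[lambda]_u g u) ^+ 2].
Proof.
move=> hgY; have [hg mY _] := hgY; have [mg ig ig2] := hg.
have [v0 _ _ hrem] := hexp.
set m1 := \int[lambda]_u g u; set m2 := \int[lambda]_u (g u ^+ 2).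
have m20 : 0 <= m2 by apply: Rintegral_ge0 => u _; exact: sqr_ge0.
pose z (n : nat) : R := n.+1%:R^-1.
have z0 n : 0 < z n by rewrite invr_gt0.
pose dc n := \int[P]_w cos (z n * Y w) - expR (- (v * m2 / 2 * z n ^+ 2)) * cos (z n * (c * m1)).
pose ds n := \int[P]_w sin (z n * Y w) - expR (- (v * m2 / 2 * z n ^+ 2)) * sin (z n * (c * m1)).
(* The two errors are added so that one null sequence serves both the cosine and the sine
   hypothesis. *)
pose eps n := z n ^- 2 * (`|dc n| + `|ds n|).
have epsE n : `|dc n| + `|ds n| = z n ^+ 2 * eps n.
  by rewrite /eps mulrA divff ?mul1r// expf_neq0// gt_eqF.
have dcs (e del C : R) n : 0 < del -> second_order_remainder re im v c e del C ->
    eps n <= 4 * (e * m2 + C * \int[lambda]_u excess (del / z n) (g u)).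
  move=> d0 hr; have := cf_estimate (simple_limitZ (z n) hgY) d0 hr.
  rewrite /= (RintegralZl _ measurableT ig) -/m1.
  have -> : \int[lambda]_u ((z n * g u) ^+ 2) = z n ^+ 2 * m2.
    by under eq_Rintegral do rewrite exprMn; rewrite (RintegralZl _ measurableT ig2).
  have -> : \int[lambda]_u excess del (z n * g u) =
      z n ^+ 2 * \int[lambda]_u excess (del / z n) (g u).
    under eq_Rintegral do rewrite excess_scale//.
    by rewrite (RintegralZl _ measurableT)//; apply: L12_excess => //; exact: divr_gt0.
  have -> : v / 2 * (z n ^+ 2 * m2) = v * m2 / 2 * z n ^+ 2 by ring.
  rewrite (mulrCA c) -/(dc n) -/(ds n) => -[hc hs].
  rewrite /eps ler_pdivrMl ?exprn_gt0//.
  by move: hc hs; move: (\int[_]_u _) => ex; lra.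
apply: (@moments_of_expansion _ _ _ P Y (c * m1) (v * m2) eps) => //; first exact: mulr_ge0.
- apply/cvgrPdist_le => e e0.
  pose e1 := e / (8 * (m2 + 1)).
  have e10 : 0 < e1 by rewrite divr_gt0// mulr_gt0// ltr_wpDl.
  have [del [C [d0 C0 hr]]] := hrem e1 e10.
  have : 4 * C * \int[lambda]_u excess (del / z n) (g u) @[n --> \oo] --> 0.
    by rewrite -[X in _ --> X](mulr0 (4 * C)); apply: cvgMr; exact: excess_near0.
  move=> /cvgrPdist_le /(_ (e / 2)); rewrite divr_gt0// => /(_ isT).
  apply: filterS => n; rewrite !sub0r !normrN => hn.
  rewrite ger0_norm; last by rewrite mulr_ge0 ?addr_ge0// invr_ge0 exprn_ge0// ltW.
  apply: le_trans (dcs _ _ _ n d0 hr) _; have := le_trans (ler_norm _) hn; rewrite -/(z n).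
  have : 4 * (e1 * m2) <= e / 2.
    rewrite /e1 [leLHS](_ : _ = (e / 2) * (m2 / (m2 + 1))); last first.
      by field; rewrite gt_eqF// ltr_wpDl.
    by rewrite ler_piMr ?divr_ge0 ?(ltW e0)// ler_pdivrMr ?ltr_wpDl// mul1r lerDl.
  by move: (\int[_]_u _) => ex; move: (e1 * m2) => y; lra.
- by move=> n; rewrite -/(z n) -/(dc n) -epsE lerDl.
- by move=> n; rewrite -/(z n) -/(ds n) -epsE lerDr.
Qed.

End simple_limit.

(** * Sums over the lattice *)

Section esum_dominated.
Context {R : realType} {I : choiceType}.
Implicit Types x y : I -> R.

Definition rsum x : R := fine (\esum_(i in [set: I]) (x i)%:E)%E.

Definition rsummable x := (forall i, 0 <= x i) /\ (\esum_(i in [set: I]) (x i)%:E < +oo)%E.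

Lemma rsummable_dominated x y : rsummable y -> (forall i, 0 <= x i <= y i) -> rsummable x.
Proof.
move=> [y0 yoo] xy; split=> [i|]; first by have /andP[] := xy i.
by apply: le_lt_trans yoo; apply: le_esum => i _; rewrite lee_fin; have /andP[] := xy i.
Qed.

Lemma rsumE x : rsummable x -> (\esum_(i in [set: I]) (x i)%:E)%E = (rsum x)%:E.
Proof.
move=> [x0 xoo]; rewrite /rsum fineK// ge0_fin_numE//.
by apply: esum_ge0 => i _; rewrite lee_fin.
Qed.

Lemma rsum_ge0 x : rsummable x -> 0 <= rsum x.
Proof. by move=> [x0 _]; apply: fine_ge0; apply: esum_ge0 => i _; rewrite lee_fin. Qed.

Lemma le_rsum x y : rsummable y -> (forall i, 0 <= x i <= y i) -> rsum x <= rsum y.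
Proof.
move=> hy xy; rewrite -lee_fin -!rsumE//; last exact: rsummable_dominated hy xy.
by apply: le_esum => i _; rewrite lee_fin; have /andP[] := xy i.
Qed.

Lemma rsummableZ k x : 0 <= k -> rsummable x -> rsummable (fun i => k * x i).
Proof.
move=> k0 hx; have [x0 xoo] := hx; split=> [i|]; first exact: mulr_ge0.
apply: (@le_lt_trans _ _ (k * rsum x)%:E); last exact: ltry.
apply: ge_ereal_sup => _ [X [fX _] <-]; rewrite fsumEFin// lee_fin.
have -> : \sum_(i \in X) k * x i = k * \sum_(i \in X) x i.
  by rewrite !fsbig_finite//= mulr_sumr.
apply: ler_wpM2l => //; rewrite -lee_fin -fsumEFin// -rsumE//.
by apply: esum_ge; exists X.
Qed.

(** Dominated convergence for unordered sums: a finite set carries the sum of [y] up to [e / 2],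
    which bounds all tails at once, and on it convergence is termwise. *)
Lemma rsum_dominated_cvg (x_ : nat -> I -> R) x y : rsummable y ->
  (forall n i, 0 <= x_ n i <= y i) -> (forall i, x_ n i @[n --> \oo] --> x i) ->
  rsum (x_ n) @[n --> \oo] --> rsum x.
Proof.
move=> hy xy x_x; have [y0 yoo] := hy.
have xy' i : 0 <= x i <= y i.
  apply/andP; split.
    by apply: (cvgr_to_ge (x_x i)); apply: nearW => n; have /andP[] := xy n i.
  by apply: (cvgr_to_le (x_x i)); apply: nearW => n; have /andP[] := xy n i.
apply/cvgrPdist_le => e e0.
have [X [fX XI] yX] : exists2 X : set I, fsets setT X & (rsum y - e / 2 < \sum_(i \in X) y i).
  have e20 : 0 < e / 2 by rewrite divr_gt0.
  have := rsumE hy; rewrite /esum => yE.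
  have /(ub_ereal_sup_adherent e20)[_ [X XI <-]] :
    ereal_sup [set (\sum_(i \in A) (y i)%:E)%E | A in fsets [set: I]] \is a fin_num by rewrite yE.
  rewrite yE => h; exists X => //; move: h; have [fX _] := XI.
  by rewrite fsumEFin.
pose S z : R := \sum_(i \in X) z i.
have tail z : (forall i, 0 <= z i <= y i) -> 0 <= rsum z - S z <= e / 2.
  move=> zy; have hz := rsummable_dominated hy zy; have [z0 zoo] := hz.
  have split' w : rsummable w ->
      exists2 t, rsum w - S w = t & (\esum_(i in ~` X) (w i)%:E = t%:E)%E.
    move=> hw; have [w0 woo] := hw.
    have : (\esum_(i in [set: I]) (w i)%:E = \esum_(i in setT `&` X) (w i)%:E +
        \esum_(i in setT `&` ~` X) (w i)%:E)%E.
      by apply: esumID => i _; rewrite lee_fin.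
    rewrite !setTI rsumE// [X in (_ = X + _)%E](_ : _ = (S w)%:E); last first.
      by rewrite -fsumEFin// -esum_fset// => i _; rewrite lee_fin.
    have : (0 <= \esum_(i in ~` X) (w i)%:E)%E by apply: esum_ge0 => i _; rewrite lee_fin.
    case: (\esum_(i in ~` X) _)%E => //= t _ [->]; exists t => //; ring.
  have [t -> tE] := split' z hz; have [t' t'E t'E'] := split' y hy.
  rewrite -!lee_fin -tE; apply/andP; split.
    by apply: esum_ge0 => i _; rewrite lee_fin.
  apply: (@le_trans _ _ t'%:E).
    by rewrite -t'E'; apply: le_esum => i _; rewrite lee_fin; have /andP[] := zy i.
  by rewrite lee_fin -t'E; move: yX; rewrite -/(S y); lra.
have cS : S (x_ n) @[n --> \oo] --> S x.
  rewrite /S fsbig_finite//; under eq_fun do rewrite fsbig_finite//.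
  apply: cvg_big => //; exact: add_continuous.
move/cvgrPdist_le : cS => /(_ (e / 2)); rewrite divr_gt0// => /(_ isT).
apply: filterS => n; have := tail _ xy'; have := tail _ (xy n).
move: (rsum _) (rsum _) (S _) (S _) => a b a' b'.
move=> /andP[h1 h2] /andP[h3 h4]; rewrite !ler_norml => /andP[h5 h6].
by apply/andP; split; lra.
Qed.

End esum_dominated.

(** * Frequencies of differences *)

Section difference_frequencies.
Context {R : realType} {d : nat}.
Local Notation Z := 'rV[int]_d.
Implicit Types (G : {fset Z}) (l : Z).

Lemma diff_freqE G l :
  diff_freq G l = (\sum_(s <- G) \sum_(t <- G) (s - t == l)%:R) / #|` G|%:R :> R.
Proof.
rewrite /diff_freq; congr (_ / _).
under eq_bigr do rewrite -natr_sum; rewrite -natr_sum; congr (_%:R).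
rewrite -(@big_allpairs _ _ _ _ _ _ _ (fun p : Z * Z => nat_of_bool (p.1 - p.2 == l))).
rewrite (eq_bigr (fun p : Z * Z => if p.1 - p.2 == l then 1%N else 0%N)); last first.
  by move=> p _; case: eqP.
rewrite -big_mkcond/= sum1_count -size_filter; apply/perm_size/uniq_perm.
- exact: fset_uniq.
- by apply/filter_uniq/allpairs_uniq => //; [exact: fset_uniq|exact: fset_uniq|case=> a b []].
- move=> [s t]; rewrite mem_filter !inE /= andbC; congr (_ && _).
  apply/andP/allpairsP => [[sG tG]|[[s' t'] /= [sG tG [-> ->]]]] //.
  by exists (s, t).
Qed.

Lemma diff_freq_ge0 G l : 0 <= diff_freq G l :> R.
Proof. by rewrite /diff_freq divr_ge0. Qed.

(** For each [s] at most one [t] satisfies [s - t = l]. This makes the suprema over [n] real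
    numbers. *)
Lemma diff_freq_le1 G l : diff_freq G l <= 1 :> R.
Proof.
rewrite diff_freqE; have [->|G0] := eqVneq #|` G| 0%N; first by rewrite invr0 mulr0.
rewrite ler_pdivrMr ?ltr0n ?lt0n// mul1r.
have -> : #|` G|%:R = \sum_(s <- G) 1 :> R by rewrite -(natr_sum _ _ _ (fun=> 1%N)) sum1_size.
apply: ler_sum => s _; rewrite -natr_sum lern1.
have -> : (\sum_(t <- G) (s - t == l)%R = count_mem (s - l)%R G)%N.
  rewrite -sum1_count [RHS]big_mkcond; apply: eq_bigr => t _ /=.
  by rewrite subr_eq addrC -subr_eq eq_sym; case: eqP.
by rewrite count_uniq_mem ?fset_uniq//; case: (_ \in _).
Qed.

Definition pair_mean G (phi : Z -> R) : R :=
  (\sum_(s <- G) \sum_(t <- G) phi (s - t)) / #|` G|%:R.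

(** Sorting pairs by their difference: only finitely many frequencies are nonzero, and nonnegativity
    lets the sums be exchanged. *)
Lemma esum_diff_freq G (phi : Z -> R) : (forall l, 0 <= phi l) ->
  (\esum_(l in [set: Z]) (diff_freq G l * phi l)%:E = (pair_mean G phi)%:E)%E.
Proof.
move=> phi0; pose q : R := #|` G|%:R^-1.
have q0 : 0 <= q by rewrite invr_ge0.
have single k : (\esum_(l in [set: Z]) ((k == l)%:R * phi l * q)%:E = (phi k * q)%:E)%E.
  transitivity (\esum_(l in [set k]) (phi l * q)%:E)%E; last first.
    by rewrite esum_set1// lee_fin mulr_ge0.
  rewrite [RHS]esum_mkcond; apply: eq_esum => l _; rewrite (eq_sym k).
  by rewrite in_set1; case: eqP => _; rewrite ?mul1r ?mul0r.
transitivity (\esum_(l in [set: Z]) (\sum_(s <- G) \sum_(t <- G)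
    ((s - t == l)%:R * phi l * q)%:E))%E.
  apply: eq_esum => l _; rewrite diff_freqE -/q.
  under [RHS]eq_bigr do rewrite sumEFin; rewrite sumEFin; congr EFin.
  rewrite mulrAC !mulr_suml; apply: eq_bigr => s _; rewrite !mulr_suml.
  by apply: eq_bigr.
rewrite esum_sum => [|l s _ _]; last first.
  by apply: sume_ge0 => t _; rewrite lee_fin !mulr_ge0.
under eq_bigr => s _.
  rewrite esum_sum => [|l t _ _]; last by rewrite lee_fin !mulr_ge0.
  under eq_bigr do rewrite single; over.
rewrite /pair_mean -/q mulr_suml -sumEFin; apply: eq_bigr => s _.
by rewrite mulr_suml sumEFin.
Qed.

End difference_frequencies.

Section lattice.
Context {R : realType} {d : nat}.
Local Notation Z := 'rV[int]_d.
Local Notation V := 'rV[R]_d.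
Local Notation tau := (@rV_of_int R d).

Lemma rV_of_intB (s t : Z) : tau (s - t) = tau s - tau t.
Proof. by apply/rowP => i; rewrite !mxE rmorphB. Qed.

(** Each coordinate of such a [t] lies within [m] of the integer part of that of [u], which leaves
    [2 m + 1] values; so the bound is uniform in [G] and [u]. *)
Lemma lattice_count (m : nat) : exists K : nat, forall (G : {fset Z}) (u : V),
  (count (fun t => `|tau t - u| <= m%:R)%R G <= K)%N.
Proof.
exists #|{: {ffun 'I_d -> 'I_(m + m).+1}}| => G u.
pose shift (t : Z) i : int := t 0 i - Num.floor (u 0 i) + m%:Z.
pose h (t : Z) : {ffun 'I_d -> 'I_(m + m).+1} := [ffun i => inord `|shift t i|%N].
pose s := [seq t <- G | `|tau t - u| <= m%:R].
have sP t : t \in s -> forall i, (0 <= shift t i) && (shift t i <= (m + m)%:Z).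
  rewrite mem_filter norm_rV_le ?ler0n// => /andP[/forallP + _] i => /(_ i).
  rewrite !mxE ler_norml => /andP[t1 t2].
  have /andP[f1 f2] := floor_itv (u 0 i).
  have a1 : (Num.floor (u 0 i) - m%:Z)%:~R <= (t 0 i)%:~R :> R.
    by rewrite intrB; move: t1 f1; rewrite -[m%:~R]pmulrn; lra.
  have a2 : (t 0 i)%:~R < (Num.floor (u 0 i) + 1 + m%:Z)%:~R :> R.
    by rewrite intrD; move: t2 f2; rewrite -[m%:~R]pmulrn; lra.
  move: a1 a2; rewrite ler_int ltr_int /shift PoszD; move: (t 0 i) (Num.floor _) => a b.
  by move=> h1 h2; apply/andP; split; lia.
have hinj : {in s &, injective h}.
  move=> t t' ts ts' /ffunP hh; apply/rowP => i; have := hh i; rewrite !ffunE.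
  have /andP[a1 a2] := sP t ts i; have /andP[b1 b2] := sP t' ts' i.
  move=> /(congr1 val) /=; rewrite !inordK ?ltnS; last 2 first.
  - by move: b1 b2; move: (shift t' i) => x; lia.
  - by move: a1 a2; move: (shift t i) => x; lia.
  by move: a1 b1; rewrite /shift; lia.
rewrite -size_filter -/s -(size_map h).
have /card_uniqP <- : uniq (map h s) by rewrite map_inj_in_uniq// filter_uniq// fset_uniq.
exact: max_card.
Qed.
End lattice.

(** * Correlations and truncation of the kernel *)

Section correlation.
Context {R : realType} {d : nat}.
Local Notation Z := 'rV[int]_d.
Local Notation V := 'rV[R]_d.
Local Notation tau := (@rV_of_int R d).
Local Notation lambda := (@lebesgue_rV R d).
Implicit Types (f h : V -> R) (G : {fset Z}).

Lemma Rintegral_reflect (c : V) f : measurable_fun setT f ->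
  \int[lambda]_u f (c - u) = \int[lambda]_u f u.
Proof.
exact: (Rintegral_preserving (measurable_reflect c) (lebesgue_rV_reflect c)).
Qed.

Lemma L12_reflect (c : V) h : L12 lambda h -> L12 lambda (fun u => h (c - u)).
Proof.
have mr := @measurable_reflect R d c.
move=> [mh ih ih2]; split; first exact: measurableT_comp.
- exact: (integrable_preserving mr (lebesgue_rV_reflect c) ih).
- exact: (integrable_preserving mr (lebesgue_rV_reflect c) ih2).
Qed.

Definition corr h (l : Z) := \int[lambda]_u (h (tau l - u) * h (- u)).
Definition acorr h (l : Z) := \int[lambda]_u `|h (- u) * h (tau l - u)|.
Definition lattice_sum G h (u : V) := \sum_(t <- G) h (tau t - u).

Lemma corr_integrable h (a b : V) : L12 lambda h ->
  lambda.-integrable setT (EFin \o (fun u => h (a - u) * h (b - u))).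
Proof. by move=> hh; apply: L12_prod_integrable; exact: L12_reflect. Qed.

(** Translation by [tau t], written as the composite of the reflections [u |-> tau t - u] and
    [w |-> 0 - w]. *)
Lemma corr_shift h (s t : Z) : L12 lambda h ->
  \int[lambda]_u (h (tau s - u) * h (tau t - u)) = corr h (s - t).
Proof.
move=> hh; have [mh _ _] := hh.
pose E (u : V) : R := h (tau (s - t) - u) * h (0 - u).
have mE : measurable_fun setT E.
  by have /integrableP[/measurable_EFinP + _] := corr_integrable (tau (s - t)) 0 hh; exact.
have mF : measurable_fun setT (fun w : V => E (0 - w)).
  exact: measurableT_comp mE (measurable_reflect 0).
transitivity (\int[lambda]_u E (0 - (tau t - u))).
  apply: eq_Rintegral => u _; rewrite /E rV_of_intB !sub0r !opprK.
  by rewrite addrA subrK.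
rewrite (Rintegral_reflect (tau t) mF) (Rintegral_reflect 0 mE) /corr.
by apply: eq_Rintegral => u _; rewrite /E sub0r.
Qed.

Lemma norm_corr_le h l : L12 lambda h -> `|corr h l| <= acorr h l.
Proof.
move=> hh; have i0 := corr_integrable (tau l) 0 hh.
have i : lambda.-integrable setT (EFin \o (fun u => h (tau l - u) * h (- u))).
  rewrite (_ : (fun u => _) = (fun u => h (tau l - u) * h (0 - u)))//.
  by apply/funext => u; rewrite sub0r.
apply: le_trans (le_normr_Rintegral measurableT i) _.
by rewrite /acorr; under [leRHS]eq_Rintegral do rewrite mulrC.
Qed.

Lemma acorr_ge0 h l : 0 <= acorr h l.
Proof. exact: Rintegral_ge0. Qed.

Lemma acorr_integrable h l : L12 lambda h ->
  lambda.-integrable setT (EFin \o (fun u => `|h (- u) * h (tau l - u)|)).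
Proof.
move=> hh; apply: (@integrable_norm _ _ _ lambda setT (fun u => h (- u) * h (tau l - u))).
rewrite (_ : (fun u => _) = (fun u => h (0 - u) * h (tau l - u))); last first.
  by apply/funext => u; rewrite sub0r.
exact: corr_integrable.
Qed.

Lemma Rintegral_sum (I : Type) (r : seq I) (F : I -> V -> R) :
  (forall i, lambda.-integrable setT (EFin \o F i)) ->
  lambda.-integrable setT (EFin \o (fun u => \sum_(i <- r) F i u)) /\
  \int[lambda]_u (\sum_(i <- r) F i u) = \sum_(i <- r) \int[lambda]_u F i u.
Proof.
move=> iF; elim: r => [|i r [ih1 ih2]].
  under [X in EFin \o X]eq_fun do rewrite big_nil.
  under eq_Rintegral do rewrite big_nil; rewrite big_nil Rintegral_cst// mul0r.
  by split=> //; exact: integrable0.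
under [X in EFin \o X]eq_fun do rewrite big_cons.
under eq_Rintegral do rewrite big_cons.
by rewrite big_cons RintegralD// ih2; split=> //; exact: integrableRD.
Qed.

Lemma L12_lattice_sum G h : L12 lambda h -> L12 lambda (lattice_sum G h).
Proof. by move=> hh; apply: L12_sum => t; exact: L12_reflect. Qed.

Lemma sqr_lattice_sum G h : L12 lambda h ->
  #|` G|%:R^-1 * \int[lambda]_u (lattice_sum G h u ^+ 2) = pair_mean G (corr h).
Proof.
move=> hh; rewrite mulrC; congr (_ / _).
pose F s t u := h (tau s - u) * h (tau t - u).
have iF s t : lambda.-integrable setT (EFin \o F s t) by exact: corr_integrable.
transitivity (\int[lambda]_u (\sum_(s <- G) \sum_(t <- G) F s t u)).
  by apply: eq_Rintegral => u _; rewrite /lattice_sum expr2 big_distrlr.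
rewrite (Rintegral_sum G (fun s => (Rintegral_sum G (iF s)).1)).2.
apply: eq_bigr => s _; rewrite (Rintegral_sum G (iF s)).2.
by apply: eq_bigr => t _; exact: corr_shift.
Qed.

Lemma Rintegral_lattice_sum G h : L12 lambda h ->
  \int[lambda]_u lattice_sum G h u = #|` G|%:R * \int[lambda]_u h u.
Proof.
move=> hh; have iF t : lambda.-integrable setT (EFin \o (fun u => h (tau t - u))).
  by have [] := L12_reflect (tau t) hh.
rewrite (Rintegral_sum G iF).2; have [mh _ _] := hh.
under eq_bigr do rewrite Rintegral_reflect//.
by rewrite big_const_seq count_predT iter_addr_0 mulr_natl.
Qed.

Lemma ler_normM (a b a' b' : R) : `|a| <= `|a'| -> `|b| <= `|b'| ->
  `|a * b| <= `|a' * b'|.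
Proof. by move=> ha hb; rewrite !normrM ler_pM. Qed.

Section truncation.
Variable f : V -> R.
Hypothesis hf : L12 lambda f.

(** The cut is made both in space, to bound the number of overlapping translates, and in height, to
    bound each of them. *)
Definition core (m : nat) : set V := [set u | `|u| <= m%:R] `&` [set u | `|f u| <= m%:R].
Definition head_part m u := f u * \1_(core m) u.
Definition tail_part m u := f u * \1_(~` core m) u.

Lemma measurable_core m : measurable (core m).
Proof.
have [mf _ _] := hf; apply: measurableI; first exact: measurable_box.
rewrite (_ : mkset _ = (fun u => `|f u|) @^-1` `]-oo, m%:R]); last first.
  by apply/seteqP; split=> u; rewrite /= in_itv.
by rewrite -[X in measurable X]setTI; apply: measurableT_comp.
Qed.

Lemma head_tailE m u : f u = head_part m u + tail_part m u.
Proof.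
rewrite /head_part /tail_part !indicE in_setC.
by case: (_ \in _); rewrite /= ?mulr1 ?mulr0 ?addr0 ?add0r.
Qed.

Lemma norm_tail_le m u : `|tail_part m u| <= `|f u|.
Proof.
rewrite /tail_part normrM indicE; case: (_ \in _);
  by rewrite ?normr1 ?normr0 ?mulr1 ?mulr0.
Qed.

Lemma L12_tail m : L12 lambda (tail_part m).
Proof. exact: L12_indic (measurableC (measurable_core m)) hf. Qed.

Lemma lattice_sum_head m : exists K : R, forall G u, `|lattice_sum G (head_part m) u| <= K.
Proof.
have [K hK] := @lattice_count R d m; exists (m%:R * K%:R) => G u.
have term t : `|head_part m (tau t - u)| <= m%:R * (`|tau t - u| <= m%:R)%R%:R.
  rewrite /head_part normrM indicE; case: (boolP (_ \in _)) => [|_].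
    by rewrite inE => -[/= -> fm]; rewrite normr1 !mulr1.
  by rewrite normr0 mulr0 mulr_ge0.
apply: le_trans (ler_norm_sum _ _ _) _; apply: le_trans (ler_sum _ (fun t _ => term t)) _.
rewrite -mulr_sumr -natr_sum ler_wpM2l// ler_nat.
by apply: leq_trans (hK G u); rewrite -sum1_count [leqRHS]big_mkcond; apply: leq_sum => t _; case: ifP.
Qed.

Lemma lattice_sumE G m u :
  lattice_sum G f u = lattice_sum G (head_part m) u + lattice_sum G (tail_part m) u.
Proof. by rewrite /lattice_sum -big_split; apply: eq_bigr => t _; exact: head_tailE. Qed.

Lemma acorr_tail_le m l : acorr (tail_part m) l <= acorr f l.
Proof.
apply: le_Rintegral => //; [exact: acorr_integrable (L12_tail m)|exact: acorr_integrable|].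
by move=> u _; apply: ler_normM; exact: norm_tail_le.
Qed.

Lemma tail_near0 u : \forall m \near \oo, tail_part m u = 0.
Proof.
exists (Num.truncn (`|u| + `|f u|)).+1 => // m /= hm.
have h : `|u| + `|f u| <= m%:R.
  by apply: le_trans (ltW (truncnS_gt _)) _; rewrite ler_nat.
rewrite /tail_part indicE memNset ?mulr0//; apply.
have := normr_ge0 u; have := normr_ge0 (f u).
by move=> a b; split=> /=; lra.
Qed.

Lemma acorr_tail_cvg0 l : acorr (tail_part m) l @[m --> \oo] --> 0.
Proof.
have E0 : 0 = \int[lambda]_u (0 : R) by rewrite Rintegral_cst// mul0r.
rewrite [X in _ --> X]E0.
apply: (@Rintegral_dominated_cvg _ _ _ lambda
  (fun m u => `|tail_part m (- u) * tail_part m (tau l - u)|) (fun=> 0)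
  (fun u => `|f (- u) * f (tau l - u)|)) => //.
- move=> m; have /integrableP[/measurable_EFinP + _] := acorr_integrable l (L12_tail m); exact.
- apply/aeW => u; apply: cvg_near_cst; have := tail_near0 (- u); apply: filterS => m /= ->.
  by rewrite mul0r normr0.
- exact: acorr_integrable.
- by apply/aeW => u m; rewrite normr_id; apply: ler_normM; exact: norm_tail_le.
Qed.

End truncation.
End correlation.

(** * The limit theorem *)

Section levy_moments.
Context {dT : measure_display} {T : measurableType dT} {R : realType}.
Context {P : probability T R} {d : nat}.
Local Notation V := 'rV[R]_d.
Local Notation lambda := (@lebesgue_rV R d).
Variable L : set V -> {RV P >-> R}.
Hypothesis hL : levy_basis L.
Variables (re im : R -> R) (v c : R).
Hypothesis hexp : levy_expansion L re im v c.

Lemma simple_limit_integrable g Y : simple_limit L g Y -> P.-integrable setT (EFin \o Y).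
Proof.
move=> hgY; have [_ mY _] := hgY; have [iY2 _ _] := simple_limit_moments hL hexp hgY.
have i1 : P.-integrable setT (EFin \o (fun=> 1 : R)).
  by apply: (@prob_integrable_bounded _ _ _ P _ 1) => // x; rewrite normr1.
apply: (integrable_dominated mY (integrableRD i1 iY2)) => w.
rewrite [leRHS]ger0_norm ?addr_ge0 ?sqr_ge0// -(real_normK (num_real (Y w))).
by have := sqr_ge0 (`|Y w| - 1); rewrite sqrrB mulr1 expr1n; have := normr_ge0 (Y w); nra.
Qed.

(** Polarization: the second moment formula for the integral of [g + h] determines the mixed
    moment. *)
Lemma simple_limit_covariance g h Y Z : simple_limit L g Y -> simple_limit L h Z ->
  covariance P Y Z = (v * \int[lambda]_u (g u * h u))%:E.
Proof.
move=> hg hh; have hgh := simple_limitD hg hh.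
have [iY2 EY EY2] := simple_limit_moments hL hexp hg.
have [iZ2 EZ EZ2] := simple_limit_moments hL hexp hh.
have [iS2 ES ES2] := simple_limit_moments hL hexp hgh.
have [lg mY _] := hg; have [lh mZ _] := hh.
have iY := simple_limit_integrable hg; have iZ := simple_limit_integrable hh.
have iYZ : P.-integrable setT (EFin \o (fun w => Y w * Z w)).
  apply: (integrable_dominated _ (integrableRD iY2 iZ2)); first exact: measurable_funM.
  move=> w; rewrite normrM [leRHS]ger0_norm ?addr_ge0 ?sqr_ge0//.
  rewrite -(real_normK (num_real (Y w))) -(real_normK (num_real (Z w))).
  by have := sqr_ge0 (`|Y w| - `|Z w|); have := sqr_ge0 (`|Y w| + `|Z w|); nra.
have igh := L12_prod_integrable lg lh.
have [_ ig ig2] := lg; have [_ ih ih2] := lh.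
have hP : \int[P]_w ((Y w + Z w) ^+ 2) =
    \int[P]_w (Y w ^+ 2) + 2 * \int[P]_w (Y w * Z w) + \int[P]_w (Z w ^+ 2).
  rewrite -(RintegralZl 2 measurableT iYZ) -RintegralD//; last exact: integrableRZ.
  rewrite -RintegralD//; last by apply: integrableRD => //; exact: integrableRZ.
  by apply: eq_Rintegral => w _; ring.
have hl : \int[lambda]_u ((g u + h u) ^+ 2) =
    \int[lambda]_u (g u ^+ 2) + 2 * \int[lambda]_u (g u * h u) + \int[lambda]_u (h u ^+ 2).
  rewrite -(RintegralZl 2 measurableT igh) -RintegralD//; last exact: integrableRZ.
  rewrite -RintegralD//; last by apply: integrableRD => //; exact: integrableRZ.
  by apply: eq_Rintegral => w _; ring.
have hm : \int[lambda]_u (g u + h u) = \int[lambda]_u g u + \int[lambda]_u h u by exact: RintegralD.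
have E (U : T -> R) : P.-integrable setT (EFin \o U) -> ('E_P[U] = (\int[P]_w U w)%:E)%E.
  by move=> iU; rewrite unlock /Rintegral fineK//; exact: integrable_fin_num.
rewrite covarianceE; [|exact/Lfun1_integrable..].
rewrite (E _ iYZ) (E _ iY) (E _ iZ) EY EZ -EFinM -EFinB; congr EFin.
move: ES2; rewrite hP hl hm EY2 EZ2.
move: (\int[_]_w (Y w * Z w)) (\int[_]_u (g u * h u)) (\int[_]_u g u) (\int[_]_u h u).
move: (\int[_]_u (g u ^+ 2)) (\int[_]_u (h u ^+ 2)) => a b yz gh mg mh hh'; nra.
Qed.

(** The mean formula, read for the indicator of a cube of volume 1. *)
Lemma levy_mean_unit_cube : fine 'E_P[L unit_cube]%E = c.
Proof.
pose s := [:: (1 : R, unit_cube : set V)].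
have bs : bounded_simple s.
  by move=> p; rewrite inE => /eqP ->; exact: bounded_borel_unit_cube.
have h : simple_limit L (simple_fun s) (simple_sum L s).
  split; [exact: L12_simple_fun|exact: measurable_simple_sum|exists (fun=> s); split=> //].
    rewrite (_ : (fun _ => _) = fun=> 0); first exact: cvg_cst.
    apply/funext => n; rewrite /norm12; under eq_Rintegral do rewrite subrr normr0.
    under [X in _ + X]eq_Rintegral do rewrite subrr expr0n.
    by rewrite !Rintegral_cst// !mul0r addr0.
  move=> e e0; rewrite (_ : (fun _ => _) = fun=> 0%E); first exact: cvg_cst.
  apply/funext => n; rewrite (_ : mkset _ = set0) ?measure0//.
  by rewrite -subset0 => w /=; rewrite subrr normr0 leNgt e0.
have [_ + _] := simple_limit_moments hL hexp h.
have -> : simple_fun s = \1_(unit_cube : set V) :> (V -> R).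
  by apply/funext => u; rewrite /simple_fun big_seq1 mul1r.
have -> : \int[lambda]_u \1_(unit_cube : set V) u = 1.
  rewrite /Rintegral integral_indic// ?setIT; last by have [] := @bounded_borel_unit_cube R d.
  by rewrite [X in fine X]lebesgue_unit_cube.
rewrite mulr1 => <-; rewrite unlock; congr fine; apply: eq_integral => w _.
by rewrite /simple_sum big_seq1 mul1r.
Qed.

End levy_moments.

Section normal_limit.
Context {dT : measure_display} {T : measurableType dT} {R : realType}.
Context {P : probability T R} {d : nat}.
Local Notation Z := 'rV[int]_d.
Local Notation V := 'rV[R]_d.
Local Notation lambda := (@lebesgue_rV R d).
Local Notation tau := (@rV_of_int R d).
Variable L : set V -> {RV P >-> R}.
Hypothesis hL : levy_basis L.
Variables (re im : R -> R) (v c : R).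
Hypothesis hexp : levy_expansion L re im v c.
Variables (f : V -> R) (X : V -> T -> R).
Hypothesis hf : L12 lambda f.
Hypothesis hX : forall t, simple_limit L (fun u => f (t - u)) (X t).
Variables (Gamma : nat -> {fset Z}) (a b : Z -> R).
Hypothesis Gamma_card : #|` Gamma n| @[n --> \oo] --> \oo.
Hypothesis ha : forall l, diff_freq (Gamma n) l @[n --> \oo] --> a l.
Hypothesis hb : forall n l, diff_freq (Gamma n) l <= b l.
Hypothesis b_sum : rsummable (fun l => b l * acorr f l).

Let q n : R := (Num.sqrt #|` Gamma n|%:R)^-1.

Let q_ge0 n : 0 <= q n. Proof. by rewrite invr_ge0 sqrtr_ge0. Qed.

Let sqr_q n : q n ^+ 2 = #|` Gamma n|%:R^-1.
Proof. by rewrite /q exprVn sqr_sqrtr. Qed.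

Let q_cvg0 : q n @[n --> \oo] --> 0.
Proof.
apply/cvgrPdist_le => e e0.
have /cvgnyPge /(_ (Num.truncn (e ^- 2)).+1) := Gamma_card; apply: filterS => n hn.
have e20 : 0 < e ^- 2 by rewrite invr_gt0 exprn_gt0.
have hN : e ^- 2 <= #|` Gamma n|%:R.
  by apply: le_trans (ltW (truncnS_gt _)) _; rewrite ler_nat.
rewrite sub0r normrN ger0_norm// -ler_sqr ?nnegrE//; last exact: ltW.
by rewrite sqr_q -[leRHS]invrK lef_pV2 ?posrE//; exact: lt_le_trans hN.
Qed.

Let pair_mean_rsum n (phi : Z -> R) : (forall l, 0 <= phi l) ->
  pair_mean (Gamma n) phi = rsum (fun l => diff_freq (Gamma n) l * phi l).
Proof. by move=> phi0; rewrite /rsum esum_diff_freq. Qed.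

Let dominated n (k : R) (phi : Z -> R) : 0 <= k -> (forall l, 0 <= phi l <= k * acorr f l) ->
  forall l, 0 <= diff_freq (Gamma n) l * phi l <= k * (b l * acorr f l).
Proof.
move=> k0 hphi l; have /andP[p0 p1] := hphi l.
rewrite mulr_ge0 ?diff_freq_ge0//= mulrCA; apply: ler_pM => //; exact: diff_freq_ge0.
Qed.

Let pair_mean_cvg (k : R) (phi : Z -> R) : 0 <= k -> (forall l, 0 <= phi l <= k * acorr f l) ->
  pair_mean (Gamma n) phi @[n --> \oo] --> rsum (fun l => a l * phi l).
Proof.
move=> k0 hphi; have phi0 l : 0 <= phi l by have /andP[] := hphi l.
under eq_fun do rewrite pair_mean_rsum//.
apply: (rsum_dominated_cvg (rsummableZ k0 b_sum)) => [n i|i]; first exact: dominated.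
by apply: cvgMl; exact: ha.
Qed.

Lemma limit_summable (k : R) (phi : Z -> R) : 0 <= k ->
  (forall l, 0 <= phi l <= k * acorr f l) -> rsummable (fun l => a l * phi l).
Proof.
move=> k0 hphi; apply: (rsummable_dominated (rsummableZ k0 b_sum)) => l.
have /andP[phi0 _] := hphi l.
have hc : diff_freq (Gamma n) l * phi l @[n --> \oo] --> a l * phi l.
  by apply: cvgMl; exact: ha.
apply/andP; split.
  by apply: (cvgr_to_ge hc); apply: nearW => n; have /andP[] := dominated n k0 hphi l.
by apply: (cvgr_to_le hc); apply: nearW => n; have /andP[] := dominated n k0 hphi l.
Qed.

Let g n u := q n * lattice_sum (Gamma n) f u.
Let W n w := q n * \sum_(t <- Gamma n) X (tau t) w.

Let hW n : simple_limit L (g n) (W n).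
Proof. by apply: simple_limitZ; apply: simple_limit_sum => t; exact: hX. Qed.

Let sqr_lsum n (h : V -> R) : L12 lambda h ->
  q n ^+ 2 * \int[lambda]_u (lattice_sum (Gamma n) h u ^+ 2) = pair_mean (Gamma n) (corr h).
Proof. by move=> hh; rewrite sqr_q sqr_lattice_sum. Qed.

Let sigma n := \int[lambda]_u (g n u ^+ 2).

Let sigmaE n : sigma n = pair_mean (Gamma n) (corr f).
Proof.
have [_ _ i2] := L12_lattice_sum (Gamma n) hf.
rewrite -sqr_lsum// -(RintegralZl _ measurableT i2).
by apply: eq_Rintegral => u _; rewrite exprMn.
Qed.

(* [tail_part] is small in mean square, while the lattice sum of [head_part] is bounded
   uniformly in n, hence below the threshold of [excess] after normalisation. *)
Let excess_g_cvg0 (z del : R) : 0 < del ->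
  \int[lambda]_u excess del (z * g n u) @[n --> \oo] --> 0.
Proof.
move=> d0; apply/cvgrPdist_le => e e0.
have rho_cvg : rsum (fun l => b l * acorr (tail_part f m) l) @[m --> \oo] --> 0.
  have -> : 0 = rsum (fun l : Z => b l * 0).
    by rewrite /rsum esum1// => l _; rewrite mulr0.
  have b0 l : 0 <= b l by apply: le_trans (hb 0 l); exact: diff_freq_ge0.
  apply: (rsum_dominated_cvg b_sum) => [m l|l].
    by rewrite mulr_ge0 ?acorr_ge0//= ler_wpM2l// acorr_tail_le.
  by apply: cvgMr; exact: acorr_tail_cvg0.
(* The level [m] is fixed before [n]: since [b] dominates every frequency, the tail is small
   uniformly in [n], and the bound [K] for the head then depends on [m] alone. *)
have [m hm] : exists m, z ^+ 2 * rsum (fun l => b l * acorr (tail_part f m) l) <= e.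
  have : z ^+ 2 * rsum (fun l => b l * acorr (tail_part f m) l) @[m --> \oo] --> 0.
    by rewrite -[X in _ --> X](mulr0 (z ^+ 2)); exact: cvgMr.
  move=> /cvgrPdist_le /(_ e e0)[m _ /(_ m (leqnn m))].
  by rewrite sub0r normrN => h; exists m; exact: le_trans (ler_norm _) h.
have [K hK] := lattice_sum_head f m.
have := q_cvg0 => /cvgrPdist_le /(_ (del / (`|z| * `|K| + 1))).
have K0 : 0 < `|z| * `|K| + 1 by rewrite ltr_wpDl// mulr_ge0.
rewrite divr_gt0// => /(_ isT); apply: filterS => n; rewrite !sub0r !normrN ger0_norm//.
rewrite ler_pdivlMr// => hq.
have hg : L12 lambda (g n) by apply/L12Z/L12_lattice_sum.
have ht := L12_lattice_sum (Gamma n) (L12_tail hf m); have [_ _ it2] := ht.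
have ex0 : 0 <= \int[lambda]_u excess del (z * g n u).
  by apply: Rintegral_ge0 => u _; exact: excess_ge0.
rewrite ger0_norm//; apply: le_trans hm.
apply: (@le_trans _ _ (\int[lambda]_u ((z * q n) ^+ 2 *
    lattice_sum (Gamma n) (tail_part f m) u ^+ 2))).
  apply: le_Rintegral => //; first by apply: L12_excess => //; exact: L12Z.
  - exact: integrableRZ.
  - move=> u _; rewrite -exprMn /excess -[leRHS]real_normK ?num_real//.
    rewrite ler_sqr ?nnegrE ?le_max ?lexx ?orbT// ge_max normr_ge0 andbT lerBlDl.
    rewrite /g (lattice_sumE f _ m) mulrA mulrDr; apply: le_trans (ler_normD _ _) _.
    rewrite lerD2r; apply: le_trans hq; rewrite !normrM (ger0_norm (q_ge0 n)).
    have hKn : `|lattice_sum (Gamma n) (head_part f m) u| <= `|K|.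
      exact: le_trans (hK _ _) (ler_norm _).
    rewrite mulrDr mulr1 mulrA (mulrC (q n)); apply: ler_wpDr => //.
    by rewrite ler_wpM2l// mulr_ge0.
rewrite (RintegralZl _ measurableT it2) exprMn -mulrA ler_wpM2l ?sqr_ge0//.
rewrite sqr_lsum; last exact: L12_tail.
apply: (@le_trans _ _ (pair_mean (Gamma n) (acorr (tail_part f m)))).
  rewrite /pair_mean ler_wpM2r ?invr_ge0//; apply: ler_sum => s _; apply: ler_sum => t _.
  by apply: le_trans (ler_norm _) (norm_corr_le _ _); exact: L12_tail.
rewrite pair_mean_rsum; last by move=> l; exact: acorr_ge0.
have b0 l : 0 <= b l by apply: le_trans (hb 0 l); exact: diff_freq_ge0.
apply: le_rsum => [|l].
  apply: (rsummable_dominated b_sum) => l.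
  by rewrite mulr_ge0 ?acorr_ge0//= ler_wpM2l// acorr_tail_le.
by rewrite mulr_ge0 ?acorr_ge0 ?diff_freq_ge0//= ler_wpM2r// acorr_ge0.
Qed.

(** Covariances may have either sign while [rsum] treats nonnegative families, so the positive and
    negative parts converge separately. *)
Let phip l := Num.max (v * corr f l) 0.
Let phin l := Num.max (- (v * corr f l)) 0.
Let var := rsum (fun l => a l * phip l) - rsum (fun l => a l * phin l).

Let v0 : 0 <= v. Proof. by have [] := hexp. Qed.

Let phip_dom l : 0 <= phip l <= v * acorr f l.
Proof.
rewrite le_max lexx orbT ge_max mulr_ge0 ?acorr_ge0// andbT ler_wpM2l//.
exact: le_trans (ler_norm _) (norm_corr_le _ hf).
Qed.

Let phin_dom l : 0 <= phin l <= v * acorr f l.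
Proof.
rewrite le_max lexx orbT ge_max mulr_ge0 ?acorr_ge0// andbT -mulrN ler_wpM2l//.
by apply: le_trans (norm_corr_le _ hf); rewrite -normrN ler_norm.
Qed.

Let sigma_cvg : v * sigma n @[n --> \oo] --> var.
Proof.
have E n : v * sigma n = pair_mean (Gamma n) phip - pair_mean (Gamma n) phin.
  rewrite sigmaE /pair_mean mulrA -mulrBl; congr (_ / _).
  rewrite mulr_sumr -sumrB; apply: eq_bigr => s _; rewrite mulr_sumr -sumrB.
  apply: eq_bigr => t _; rewrite /phip /phin.
  by case: (leP 0 (v * corr f (s - t))) => h; rewrite ?(max_l h) ?(max_r (ltW h));
    [rewrite max_r ?oppr_le0// subr0|rewrite max_l ?oppr_ge0 ?ltW// sub0r opprK].
under eq_fun do rewrite E.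
by apply: cvgB; exact: (pair_mean_cvg v0).
Qed.

Let var_ge0 : 0 <= var.
Proof.
apply: (cvgr_to_ge sigma_cvg); apply: nearW => n; apply: mulr_ge0 => //.
by apply: Rintegral_ge0 => u _; exact: sqr_ge0.
Qed.

Let m1 n := \int[lambda]_u g n u.
Let Y n w := W n w - c * m1 n.

Let mW n : measurable_fun setT (W n). Proof. by have [] := hW n. Qed.

Let mY n : measurable_fun setT (Y n).
Proof. exact: measurable_funB. Qed.

(** The mean [c * m1 n] grows like [sqrt |Gamma n|] unless [f] or [L] is centred, so it is kept as a
    phase here and removed by a rotation in [cos_cvg] and [sin_cvg]. *)
Let cf_error (z e : R) : 0 < e -> \forall n \near \oo,
  `|\int[P]_w cos (z * W n w) - expR (- (v / 2 * (z ^+ 2 * sigma n))) * cos (z * (c * m1 n))| <= e /\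
  `|\int[P]_w sin (z * W n w) - expR (- (v / 2 * (z ^+ 2 * sigma n))) * sin (z * (c * m1 n))| <= e.
Proof.
move=> e0; have [_ _ _ hrem] := hexp.
(* A bound uniform in [n] lets the precision [e1], and with it [del] and [C], be chosen before
   [n]. *)
have [S S0 hS] : exists2 S : R, 0 < S & forall n, sigma n <= S.
  exists (rsum (fun l => b l * acorr f l) + 1) => [|k].
    by apply: ltr_wpDl => //; exact: rsum_ge0.
  rewrite sigmaE; apply: ler_wpDr => //.
  apply: (@le_trans _ _ (pair_mean (Gamma k) (acorr f))).
    rewrite /pair_mean ler_wpM2r ?invr_ge0//; apply: ler_sum => s _; apply: ler_sum => t _.
    exact: le_trans (ler_norm _) (norm_corr_le _ hf).
  rewrite pair_mean_rsum; last by move=> l; exact: acorr_ge0.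
  apply: le_rsum => // l.
  by rewrite mulr_ge0 ?acorr_ge0 ?diff_freq_ge0//= ler_wpM2r// acorr_ge0.
pose e1 := e / (4 * (z ^+ 2 * S + 1)).
have zS : 0 < z ^+ 2 * S + 1 by rewrite ltr_wpDl// mulr_ge0 ?sqr_ge0// ltW.
have e10 : 0 < e1 by rewrite divr_gt0// mulr_gt0.
have [del [C [d0 C0 hr]]] := hrem e1 e10.
have : C * \int[lambda]_u excess del (z * g n u) @[n --> \oo] --> 0.
  by rewrite -[X in _ --> X](mulr0 C); apply: cvgMr; exact: excess_g_cvg0.
move=> /cvgrPdist_le /(_ (e / 4)); rewrite divr_gt0// => /(_ isT).
apply: filterS => n; rewrite sub0r normrN => hn.
have := cf_estimate hL hexp (simple_limitZ z (hW n)) d0 hr.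
have [_ ig ig2] : L12 lambda (g n) by have [] := hW n.
rewrite /= (RintegralZl _ measurableT ig) -/(m1 n) (mulrCA c).
have -> : \int[lambda]_u ((z * g n u) ^+ 2) = z ^+ 2 * sigma n.
  by under eq_Rintegral do rewrite exprMn; rewrite (RintegralZl _ measurableT ig2).
have herr : 2 * (e1 * (z ^+ 2 * sigma n) + C * \int[lambda]_u excess del (z * g n u)) <= e.
  have h1 : e1 * (z ^+ 2 * sigma n) <= e / 4.
    apply: (@le_trans _ _ (e1 * (z ^+ 2 * S + 1))).
      rewrite ler_wpM2l ?(ltW e10)//; apply: ler_wpDr => //.
      by rewrite ler_wpM2l ?sqr_ge0.
    by rewrite /e1 le_eqVlt; apply/orP; left; apply/eqP; field; rewrite gt_eqF.
  by have := le_trans (ler_norm _) hn; move: h1; move: (_ * (_ * _)) (C * _) => x y; lra.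
by move=> [h1 h2]; split; [exact: le_trans h1 herr|exact: le_trans h2 herr].
Qed.

Let E_cvg (z : R) : expR (- (v / 2 * (z ^+ 2 * sigma n))) @[n --> \oo] -->
  expR (- (var * z ^+ 2) / 2).
Proof.
apply: continuous_cvg; first exact: continuous_expR.
rewrite (_ : (fun n => _) = (fun n => - (v * sigma n * z ^+ 2) / 2)); last first.
  by apply/funext => n; field.
by apply: cvgMl; apply: cvgN; apply: cvgMl.
Qed.

Let cos_cvg (z : R) : \int[P]_w cos (z * Y n w) @[n --> \oo] -->
  expR (- (var * z ^+ 2) / 2).
Proof.
pose E n := expR (- (v / 2 * (z ^+ 2 * sigma n))).
suff h : (\int[P]_w cos (z * Y n w)) - E n @[n --> \oo] --> 0.
  rewrite -[X in _ --> X]add0r.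
  rewrite (_ : (fun n => _) = (fun n => (\int[P]_w cos (z * Y n w)) - E n + E n)).
    by apply: cvgD; [exact: h|exact: E_cvg].
  by apply/funext => n; rewrite subrK.
apply/cvgrPdist_le => e e0.
have e20 : 0 < e / 2 by rewrite divr_gt0.
have := cf_error z e20; apply: filterS => n [hc hs]; rewrite sub0r normrN.
have ic := @prob_integrable_bounded _ _ _ P _ 1 (measurable_cosM z (mW n))
  (fun w => norm_cos_le1 _).
have is_ := @prob_integrable_bounded _ _ _ P _ 1 (measurable_sinM z (mW n))
  (fun w => norm_sin_le1 _).
rewrite -/(E n) in hc hs *; set th := z * (c * m1 n) in hc hs.
have -> : \int[P]_w cos (z * Y n w) =
    cos th * \int[P]_w cos (z * W n w) + sin th * \int[P]_w sin (z * W n w).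
  rewrite -(RintegralZl _ measurableT ic) -(RintegralZl _ measurableT is_).
  rewrite -RintegralD//; [|exact: integrableRZ ic|exact: integrableRZ is_].
  by apply: eq_Rintegral => w _; rewrite /Y mulrBr cosB -/th (mulrC (cos th)) (mulrC (sin th)).
move: (\int[P]_w cos _) (\int[P]_w sin _) (E n) hc hs => Ic Is {}E hc hs.
(* Rotation by [- th]: writing [E] as [E * (cos th ^ 2 + sin th ^ 2)] distributes it over the two
   error terms. *)
have -> : cos th * Ic + sin th * Is - E =
    cos th * (Ic - E * cos th) + sin th * (Is - E * sin th).
  by rewrite -[X in _ - X]mulr1 -(cos2Dsin2 th); ring.
apply: le_trans (ler_normD _ _) _; rewrite !normrM.
have := norm_cos_le1 th; have := norm_sin_le1 th.
have := ler_pM (normr_ge0 _) (normr_ge0 _) (norm_cos_le1 th) hc.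
have := ler_pM (normr_ge0 _) (normr_ge0 _) (norm_sin_le1 th) hs.
by rewrite !mul1r; lra.
Qed.

Let sin_cvg (z : R) : \int[P]_w sin (z * Y n w) @[n --> \oo] --> 0.
Proof.
apply/cvgrPdist_le => e e0; have e20 : 0 < e / 2 by rewrite divr_gt0.
have := cf_error z e20; apply: filterS => n [hc hs]; rewrite sub0r normrN.
have ic := @prob_integrable_bounded _ _ _ P _ 1 (measurable_cosM z (mW n))
  (fun w => norm_cos_le1 _).
have is_ := @prob_integrable_bounded _ _ _ P _ 1 (measurable_sinM z (mW n))
  (fun w => norm_sin_le1 _).
set th := z * (c * m1 n) in hc hs.
have -> : \int[P]_w sin (z * Y n w) =
    cos th * \int[P]_w sin (z * W n w) - sin th * \int[P]_w cos (z * W n w).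
  rewrite -(RintegralZl _ measurableT ic) -(RintegralZl _ measurableT is_).
  rewrite -RintegralB//; [|exact: integrableRZ is_|exact: integrableRZ ic].
  by apply: eq_Rintegral => w _; rewrite /Y mulrBr sinB -/th (mulrC (cos th)) (mulrC (sin th)).
move: (\int[P]_w cos _) (\int[P]_w sin _) (expR _) hc hs => Ic Is E hc hs.
have -> : cos th * Is - sin th * Ic =
    cos th * (Is - E * sin th) - sin th * (Ic - E * cos th) by ring.
apply: le_trans (ler_normB _ _) _; rewrite !normrM.
have := ler_pM (normr_ge0 _) (normr_ge0 _) (norm_cos_le1 th) hs.
have := ler_pM (normr_ge0 _) (normr_ge0 _) (norm_sin_le1 th) hc.
by rewrite !mul1r; lra.
Qed.

Let second_moment_Y n : (\int[P]_w (Y n w ^+ 2)%:E = (v * sigma n)%:E)%E.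
Proof.
have [iW2 EW EW2] := simple_limit_moments hL hexp (hW n).
have iW := simple_limit_integrable hL hexp (hW n).
have i1 : P.-integrable setT (EFin \o (fun=> (c * m1 n) ^+ 2)).
  by apply: (@prob_integrable_bounded _ _ _ P _ ((c * m1 n) ^+ 2)) => // x; rewrite ger0_norm ?sqr_ge0.
have iZ := integrableRZ (- (2 * (c * m1 n))) iW.
have E w : Y n w ^+ 2 = W n w ^+ 2 + - (2 * (c * m1 n)) * W n w + (c * m1 n) ^+ 2.
  by rewrite /Y; ring.
have iY : P.-integrable setT (EFin \o (fun w => Y n w ^+ 2)).
  by rewrite (funext E); apply: integrableRD => //; exact: integrableRD.
transitivity (\int[P]_w (Y n w ^+ 2))%:E.
  by rewrite /Rintegral fineK//; exact: integrable_fin_num iY.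
under eq_Rintegral do rewrite E.
rewrite (RintegralD measurableT (integrableRD iW2 iZ) i1) (RintegralD measurableT iW2 iZ).
rewrite (RintegralZl _ measurableT iW) prob_Rintegral_cst EW EW2 -/(sigma n) -/(m1 n).
by congr EFin; ring.
Qed.

Let tight_Y (e : R) : 0 < e -> exists K : R, forall n, fine (P [set w | K <= `|Y n w|]) <= e.
Proof.
move=> e0; have /cvg_seq_bounded[M [_ hM]] : cvg (v * sigma n @[n --> \oo]).
  by apply/cvg_ex; exists var.
pose S := `|M| + 1; have S0 : 0 < S by rewrite ltr_wpDl.
have hS n : v * sigma n <= S.
  apply: le_trans (ler_norm _) (hM S _ n I).
  by apply: le_lt_trans (ler_norm _) _; rewrite ltrDl.
(* Chebyshev's bound [S / K^2] is at most [e], since [K >= 1] gives [K^2 >= K] and [e * K >= S]. *)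
pose K := 1 + S / e; have K1 : 1 <= K by rewrite lerDl divr_ge0// ltW.
have K0 : 0 < K by exact: lt_le_trans K1.
exists K => n; rewrite -lee_fin fineK ?fin_num_measure//; last first.
  rewrite (_ : mkset _ = (fun w => `|Y n w|) @^-1` `[K, +oo[); last first.
    by apply/seteqP; split=> w; rewrite /= in_itv/= andbT.
  by rewrite -[X in measurable X]setTI; apply: measurableT_comp.
have h2 : (\int[P]_w (Y n w ^+ 2)%:E <= S%:E)%E by rewrite second_moment_Y lee_fin.
apply: le_trans (second_moment_tail (mY n) K0 h2) _.
rewrite lee_fin ler_pdivrMl ?exprn_gt0//.
have : S <= e * K by rewrite /K mulrDr mulr1 mulrCA divff ?gt_eqF// mulr1 lerDr ltW.
move=> /le_trans; apply; rewrite mulrC ler_wpM2r ?(ltW e0)//.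
by rewrite expr2 ler_peMl// ltW.
Qed.

Lemma lattice_normal_limit : cvg_in_distribution P
  (fun n w => (Num.sqrt #|` Gamma n|%:R)^-1 *
    \sum_(t <- Gamma n) (X (tau t) w - c * \int[lambda]_u f u))
  (normal_law 0 (rsum (fun l => a l * Num.max (v * corr f l) 0) -
                 rsum (fun l => a l * Num.max (- (v * corr f l)) 0))).
Proof.
rewrite -/var (_ : (fun n w => _) = Y); last first.
  apply/funext => n; apply/funext => w; rewrite /Y /W /m1 -/(q n).
  have [_ i1 _] := L12_lattice_sum (Gamma n) hf.
  rewrite (RintegralZl _ measurableT i1) Rintegral_lattice_sum// sumrB big_const_seq.
  by rewrite count_predT iter_addr_0 -mulr_natl; ring.
apply: levy_continuity => // z.
  rewrite [X in _ --> X](_ : _ = expR (- (var * z ^+ 2) / 2)); first exact: cos_cvg.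
  have := normal_law_cos z 0 var_ge0; rewrite cos0 mul1r => <-.
  by apply: eq_Rintegral => x _; rewrite addr0.
(* The sine integral of the normal law is the case of phase [- pi / 2], where the factor [cos th]
   vanishes. *)
rewrite [X in _ --> X](_ : _ = 0); first exact: sin_cvg.
have := normal_law_cos z (- (pi / 2)) var_ge0; rewrite cosN cos_pihalf mul0r => hE.
by rewrite -[RHS]hE; apply: eq_Rintegral => x _; rewrite cosBpihalf.
Qed.

End normal_limit.

Theorem theorem3p1 (R : realType) (dT : measure_display)
    (T : measurableType dT) (P : probability T R) (d : nat) (d_gt0 : (0 < d)%N)
    (L : set 'rV[R]_d -> {RV P >-> R}) (hL : levy_basis L)
    (hL2 : ('E_P[fun w => (L unit_cube w ^+ 2)%R] < +oo)%E)
    (f : 'rV[R]_d -> R)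
    (f1 : f \in Lfun lebesgue_rV 1%:E)
    (f2 : f \in Lfun lebesgue_rV 2%:E)
    (X : 'rV[R]_d -> {RV P >-> R})
    (hX : forall t, is_levy_integral L (fun u => f (t - u)) [set: 'rV[R]_d] (X t))
    (Gamma : nat -> {fset 'rV[int]_d})
    (Gamma_sub : forall n, (Gamma n `<=` Gamma n.+1)%fset)
    (Gamma_card : #|` Gamma n| @[n --> \oo] --> \oo)
    (a : 'rV[int]_d -> R)
    (ha : forall l, diff_freq (Gamma n) l @[n --> \oo] --> a l)
    (hsum : (\esum_(t in [set: 'rV[int]_d])
       (ereal_sup (range (fun n => (diff_freq (Gamma n) t : R)%:E)) *
        \int[lebesgue_rV]_u `|f (- u) * f (rV_of_int t - u)|%:E)
       < +oo)%E) :
  (\esum_(t in [set: 'rV[int]_d])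
     ((a t)%:E * `|covariance P (X (rV_of_int t)) (X 0%R)|) < +oo)%E /\
  cvg_in_distribution P
    (fun n w => (Num.sqrt #|` Gamma n|%:R)^-1 *
       \sum_(t <- Gamma n)
         (X (rV_of_int t) w -
          fine 'E_P[L unit_cube] * \int[lebesgue_rV]_u f u))
    (normal_law 0
      (signed_esum (fun t : 'rV[int]_d =>
         ((a t)%:E * covariance P (X (rV_of_int t)) (X 0%R))%E))).
Proof.
have [re [im [v [c hexp]]]] := levy_basis_expansion hL hL2.
have [v0 _ _ _] := hexp.
have hf : L12 lebesgue_rV f.
  split; first by move: f1; rewrite inE => /andP[+ _]; rewrite inE.
  - exact/Lfun1_integrable.
  - exact: Lfun2_integrable_sqr.
have hX' t : simple_limit L (fun u => f (t - u)) (X t).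
  have hft := L12_reflect t hf.
  by split=> //; exact: (levy_integral_simple hL hexp hft (hX t)).
(* Frequencies lie in [[0, 1]], so the supremum is a real number; [b l * acorr f l] is the
   dominating family for all sums over the lattice. *)
pose b l : R := fine (ereal_sup (range (fun n => (diff_freq (Gamma n) l : R)%:E))).
have bE l : ereal_sup (range (fun n => (diff_freq (Gamma n) l : R)%:E)) = (b l)%:E.
  rewrite /b fineK// fin_numE; apply/andP; split.
    rewrite gt_eqF// (@lt_le_trans _ _ (diff_freq (Gamma 0) l : R)%:E) ?ltNyr//.
    by apply: ereal_sup_ubound; exists 0%N.
  rewrite lt_eqF// (@le_lt_trans _ _ 1%:E) ?ltry//.
  by apply: ge_ereal_sup => _ [n _ <-]; rewrite lee_fin diff_freq_le1.
have hb n l : diff_freq (Gamma n) l <= b l.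
  by rewrite -lee_fin -bE; apply: ereal_sup_ubound; exists n.
have b_sum : rsummable (fun l => b l * acorr f l).
  split=> [l|].
    by rewrite mulr_ge0 ?acorr_ge0//; apply: le_trans (hb 0%N l); exact: diff_freq_ge0.
  apply: le_lt_trans hsum; apply: le_esum => l _; rewrite bE EFinM lee_wpmul2l//.
    by rewrite lee_fin; apply: le_trans (hb 0%N l); exact: diff_freq_ge0.
  by rewrite /acorr /Rintegral fineK//; apply: integrable_fin_num => //; exact: acorr_integrable.
have cov t : covariance P (X (rV_of_int t)) (X 0) = (v * corr f t)%:E.
  rewrite (simple_limit_covariance hL hexp (hX' _) (hX' _)); congr EFin; congr (_ * _).
  by apply: eq_Rintegral => u _; rewrite sub0r.
have phi_sum (phi : 'rV[int]_d -> R) : (forall l, 0 <= phi l <= v * acorr f l) ->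
    rsummable (fun l => a l * phi l).
  exact: (limit_summable ha hb b_sum v0).
have a0 l : 0 <= a l.
  by apply: (cvgr_to_ge (ha l)); apply: nearW => n; exact: diff_freq_ge0.
have cov_le l : `|v * corr f l| <= v * acorr f l.
  by rewrite normrM ger0_norm// ler_wpM2l// norm_corr_le.
split.
  have [|_] := phi_sum (fun l => `|v * corr f l|) => [l|]; first by rewrite normr_ge0/=.
  by apply: le_lt_trans; apply: le_esum => t _; rewrite cov -EFinM lee_fin.
have mean : fine 'E_P[L unit_cube]%E = c by exact: (levy_mean_unit_cube hL hexp).
rewrite mean (_ : signed_esum _ =
  rsum (fun l => a l * Num.max (v * corr f l) 0) -
  rsum (fun l => a l * Num.max (- (v * corr f l)) 0)).
  exact: (lattice_normal_limit hL hexp hf hX' Gamma_card ha hb b_sum).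
have part (x : R) l : x <= v * acorr f l -> 0 <= Num.max x 0 <= v * acorr f l.
  by move=> xl; rewrite le_max lexx orbT ge_max xl mulr_ge0// acorr_ge0.
have sp := phi_sum (fun l => Num.max (v * corr f l) 0)
  (fun l => part _ l (le_trans (ler_norm _) (cov_le l))).
have sn : rsummable (fun l => a l * Num.max (- (v * corr f l)) 0).
  by apply: phi_sum => l; apply: part; apply: le_trans (cov_le l); rewrite -normrN ler_norm.
(* As [a l >= 0], taking positive and negative parts commutes with the weight, which matches the two
   sums in [signed_esum]. *)
have maxE (x : R) l : a l * Num.max x 0 = Num.max (a l * x) 0.
  by rewrite maxr_pMr// mulr0.
have -> : rsum (fun l => a l * Num.max (v * corr f l) 0) -
    rsum (fun l => a l * Num.max (- (v * corr f l)) 0) =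
  fine ((rsum (fun l => a l * Num.max (v * corr f l) 0))%:E -
    (rsum (fun l => a l * Num.max (- (v * corr f l)) 0))%:E)%E by [].
rewrite -(rsumE sp) -(rsumE sn) /signed_esum; congr (fine (_ - _)%E).
  by apply: eq_esum => t _; rewrite funeposE cov -EFinM maxE -EFin_max.
by apply: eq_esum => t _; rewrite funenegE cov -EFinM maxE -EFinN mulrN -EFin_max.
Qed.
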